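(* Let $C\subset\mathbb{P}^2(\overline{\mathbb{Q}})$ be the line $x_0+x_1+x_2=0$. Let $a\in\mathbb{Z}^2$ be a primitive vector and $e$ a positive integer, and let $(\omega_\ell)_{\ell\ge1}$ be a strict sequence in $V_{a,e}$ of nontrivial torsion points. Then \[ \lim_{\ell\to+\infty}\mathrm{h}(C\cap\omega_\ell C)=\eta_{a,e},\qquad\text{where}\quad \eta_{a,e}=\int_{\mathbb{D}_{a,e}}f\,d\tau_{a,e}. \]
   Context: $\overline{\mathbb{Q}}$ is an algebraic closure of $\mathbb{Q}$. For $a=(a_1,a_2)\in\mathbb{Z}^2$, $\chi^a(\gamma)=\gamma_1^{a_1}\gamma_2^{a_2}$ on $(\overline{\mathbb{Q}}^\times)^2$; $a$ is primitive if $\gcd(a_1,a_2)=1$. Let $\Phi_e$ be the $e$-th cyclotomic polynomial and \[ V_{a,e}=\{\gamma\in(\overline{\mathbb{Q}}^\times)^2\mid\Phi_e(\chi^a(\gamma))=0\}. \] A torsion point of $(\overline{\mathbb{Q}}^\times)^2$ is a pair of roots of unity; it is nontrivial if it differs from $(1,1)$. A sequence $(\gamma_\ell)_{\ell\ge1}$ in $V_{a,e}$ is strict in $V_{a,e}$ if for every algebraic subgroup $H$ of $(\overline{\mathbb{Q}}^\times)^2$ not containing $V_{a,e}$ there is $\ell_0\ge1$ with $\gamma_\ell\notin H$ for all $\ell\ge\ell_0$. Let \[ \mathbb{D}_{a,e}=\bigcup_{j\in(\mathbb{Z}/e\mathbb{Z})^\times}\Big\{u\in(\mathbb{R}/2\pi\mathbb{Z})^2\;\Big|\;a_1u_1+a_2u_2=\frac{2\pi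 j}{e}\Big\} \] (equality modulo $2\pi$), a union of $\varphi(e)$ parallel segments, with $\varphi$ the Euler totient function, and let $\tau_{a,e}$ be the probability measure on it induced by the Euclidean metric (normalized arc length). Let $f\colon(\mathbb{R}/2\pi\mathbb{Z})^2\to\mathbb{R}\cup\{-\infty\}$ be \[ f(u)=\log\max(|\mathrm{e}^{\mathrm{i}u_2}-\mathrm{e}^{\mathrm{i}u_1}|,|\mathrm{e}^{\mathrm{i}u_2}-1|,|\mathrm{e}^{\mathrm{i}u_1}-1|). \] The torus acts on $\mathbb{P}^2(\overline{\mathbb{Q}})$ by $\omega\,[\xi_0:\xi_1:\xi_2]=[\xi_0:\omega_1\xi_1:\omega_2\xi_2]$. For $\omega$ a nontrivial torsion point, $C\cap\omega C$ consists of the single point $[\omega_2^{-1}-\omega_1^{-1}:1-\omega_2^{-1}:\omega_1^{-1}-1]$, and $\mathrm{h}(C\cap\omega C)$ denotes its height. The (canonical) height of $\xi=[\xi_0:\dots:\xi_n]\in\mathbb{P}^n(\overline{\mathbb{Q}})$ is \[ \mathrm{h}(\xi)=\sum_{v}\sum_{w\mid v}\frac{[K_w:\mathbb{Q}_v]}{[K:\mathbb{Q}]}\log\max(|\xi_0|_w,\dots,|\xi_n|_w), \] where $K$ is any number field containing all $\xi_i$, $v$ ranges over the places of $\mathbb{Q}$ (with the usual Archimedean and $p$-adic absolute values), $w$ ranges over the places of $K$ above $v$, and $|\cdot|_w$ extends $|\cdot|_v$. *)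

(* Defs.v *)
From HB Require Import structures.
From mathcomp Require Import all_boot all_order all_algebra all_field.
From mathcomp Require Import polyXY complex zify ring lra.
From mathcomp Require Import all_classical all_reals all_analysis.
From mathcomp Require Import measurable_realfun.

Set Implicit Arguments.
Unset Strict Implicit.
Unset Printing Implicit Defensive.

Import Order.TTheory GRing.Theory Num.Theory.
Import numFieldNormedType.Exports.

Local Open Scope classical_set_scope.
Local Open Scope ring_scope.

Definition torus : set (algC * algC) := [set g | g.1 != 0 /\ g.2 != 0].

Definition chi (a : int * int) (g : algC * algC) : algC :=
  g.1 ^ a.1 * g.2 ^ a.2.

Definition primitive_vec (a : int * int) : Prop := gcdz a.1 a.2 = 1.

Definition Vtor (a : int * int) (e : nat) : set (algC * algC) :=
  torus `&` [set g | root (map_poly intr 'Phi_e) (chi a g)].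

Definition root_of_unity (x : algC) : Prop :=
  exists2 n : nat, (0 < n)%N & x ^+ n = 1.

Definition torsion_point (g : algC * algC) : Prop :=
  root_of_unity g.1 /\ root_of_unity g.2.

Definition nontrivial_torsion_point (g : algC * algC) : Prop :=
  torsion_point g /\ g <> (1, 1).

(* Laurent polynomials and polynomials have the same zero loci in the torus,
   since monomials are invertible there. *)
Definition zariski_closed (H : set (algC * algC)) : Prop :=
  exists S : set {poly {poly algC}},
    H = torus `&` [set g | forall p, S p -> p.[g.1, g.2] = 0].

Definition algebraic_subgroup (H : set (algC * algC)) : Prop :=
  [/\ zariski_closed H, H (1, 1),
      forall g h, H g -> H h -> H (g.1 * h.1, g.2 * h.2)
    & forall g, H g -> H (g.1^-1, g.2^-1)].

Definition strict_in (W : set (algC * algC)) (g : nat -> algC * algC) : Prop :=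
  (forall l, W (g l)) /\
  forall H, algebraic_subgroup H -> ~ (W `<=` H) ->
    exists l0, forall l, (l0 <= l)%N -> ~ H (g l).

Section Height.
Variable R : realType.

Definition absolute_value (F : fieldType) (w : F -> R) : Prop :=
  [/\ forall x, 0 <= w x, forall x, w x = 0 <-> x = 0,
      forall x y, w (x * y) = w x * w y
    & forall x y, w (x + y) <= w x + w y].

(* Places of rat: [None] is the Archimedean one, [Some p] the p-adic one. *)
Definition places_rat : set (option nat) :=
  [set v | if v is Some p then prime p else true].

Definition padic_abs (p : nat) (x : rat) : R :=
  if x == 0 then 0
  else p%:R ^ ((logn p `|denq x|)%:Z - (logn p `|numq x|)%:Z).

Definition rat_abs (v : option nat) (x : rat) : R :=
  if v is Some p then padic_abs p x else ratr `|x|.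

(* The places of K above v are the absolute values of K extending [rat_abs v]:
   two equivalent absolute values which agree on rat with the nontrivial
   [rat_abs v] are equal. *)
Definition places_above (K : fieldExtType rat) (v : option nat) :
    set (K -> R) :=
  [set w | absolute_value w /\ forall q : rat, w q%:A = rat_abs v q].

Section LocalDegree.
Variables (K : fieldExtType rat) (v : rat -> R) (w : K -> R).

Definition cauchy_for (F : zmodType) (u : F -> R) (x : nat -> F) : Prop :=
  forall eps : R, 0 < eps ->
    exists N, forall m n, (N <= m)%N -> (N <= n)%N -> u (x m - x n) < eps.

Definition null_for (F : Type) (u : F -> R) (x : nat -> F) : Prop :=
  u (x n) @[n --> \oo] --> (0 : R).

(* The completion K_w is the field of w-Cauchy sequences of K modulo the null
   ones, and likewise for Q_v.  The predicate says that the classes of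
   b_0, ..., b_(d-1) form a basis of K_w over Q_v. *)
Definition completion_basis (d : nat) (b : 'I_d -> nat -> K) : Prop :=
  [/\ forall i, cauchy_for w (b i),
      forall x, cauchy_for w x ->
        exists2 c : 'I_d -> nat -> rat, forall i, cauchy_for v (c i) &
          null_for w (fun n => x n - \sum_i c i n *: b i n)
    & forall c : 'I_d -> nat -> rat, (forall i, cauchy_for v (c i)) ->
        null_for w (fun n => \sum_i c i n *: b i n) ->
        forall i, null_for v (c i)].

(* [K_w : Q_v] *)
Definition local_degree : nat :=
  xget 0%N [set d | exists b : 'I_d -> nat -> K, completion_basis b].

End LocalDegree.

Definition height_over (K : fieldExtType rat) (n : nat) (xi : 'rV[K]_n.+1) : R :=
  \sum_(v \in places_rat) \sum_(w \in @places_above K v)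
    (local_degree (rat_abs v) w)%:R / (\dim {:K})%:R
      * ln (\big[Num.max/0]_(i < n.+1) w (xi 0 i)).

(* The sum defining the height is the same for all number fields containing
   the coordinates; [xget] takes its value for some such field. *)
Definition height (n : nat) (xi : 'rV[algC]_n.+1) : R :=
  xget 0 [set h | exists (K : fieldExtType rat) (iota : {rmorphism K -> algC})
                    (y : 'rV[K]_n.+1),
                    map_mx iota y = xi /\ h = height_over y].

End Height.

(* Points of P^2 are given by nonzero coordinate vectors up to scaling. *)

Definition line : set 'rV[algC]_3 := [set x | \sum_i x 0 i = 0].

Definition torus_act (g : algC * algC) (x : 'rV[algC]_3) : 'rV[algC]_3 :=
  \row_i ([:: 1; g.1; g.2]`_i * x 0 i).

Definition inter_point (g : algC * algC) : 'rV[algC]_3 :=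
  \row_i [:: g.2^-1 - g.1^-1; 1 - g.2^-1; g.1^-1 - 1]`_i.

Lemma sum3E (x : 'rV[algC]_3) :
  \sum_i x 0 i = x 0 0 + x 0 1 + x 0 (1 + 1).
Proof.
by rewrite !big_ord_recl big_ord0 addr0 addrA; congr (_ + x 0 _ + x 0 _);
  apply: val_inj.
Qed.

Lemma inter_point_neq0 g : g <> (1, 1) -> inter_point g != 0.
Proof.
move=> g1; apply/eqP => /rowP E; apply: g1.
have := E 1; have := E (1 + 1); rewrite !mxE /= => /eqP h1 /eqP h2.
move: h1; rewrite subr_eq0 invr_eq1 => /eqP h1.
move: h2; rewrite subr_eq0 eq_sym invr_eq1 => /eqP h2.
by case: g h1 h2 {E} => ? ? /= -> ->.
Qed.

(* The line C and its translate gC meet in the single point of P^2 with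
   homogeneous coordinates [inter_point g]. *)
Lemma line_inter_translate g : torus g -> g <> (1, 1) ->
  (line `&` torus_act g @` line) `\ 0 =
  [set c *: inter_point g | c in [set c | c != 0]].
Proof.
case: g => g1 g2 [/= g10 g20] gN1; apply/seteqP; split => x.
  move=> [[xC [y yC yx]] /= /eqP xN0].
  have xE0 : x 0 0 = y 0 0 by rewrite -yx !mxE /= mul1r.
  have xE1 : x 0 1 = g1 * y 0 1 by rewrite -yx !mxE.
  have xE2 : x 0 (1 + 1) = g2 * y 0 (1 + 1) by rewrite -yx !mxE.
  move: xC yC; rewrite /line /= !sum3E xE0 xE1 xE2.
  move=> C1 C2.
  have s0 : y 0 0 = - (g1 * y 0 1) - g2 * y 0 (1 + 1).
    by rewrite -[LHS]subr0 -C1; ring.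
  have C3 : (1 - g1) * y 0 1 + (1 - g2) * y 0 (1 + 1) = 0.
    by rewrite -C2 s0; ring.
  pose p := inter_point (g1, g2).
  have p0 : p 0 0 = g2^-1 - g1^-1 by rewrite mxE.
  have p1 : p 0 1 = 1 - g2^-1 by rewrite mxE.
  have p2 : p 0 (1 + 1) = g1^-1 - 1 by rewrite mxE.
  have [c [c1 c2]] : exists c, g1 * y 0 1 = c * (1 - g2^-1) /\
                               g2 * y 0 (1 + 1) = c * (g1^-1 - 1).
    have [/eqP|g2N1] := boolP (g2 == 1).
      move=> g2E; have g1N1 : g1 - 1 != 0.
        by rewrite subr_eq0; apply/eqP => g1E; apply: gN1; rewrite g1E g2E.
      have y10 : y 0 1 = 0.
        by apply: (mulfI g1N1); rewrite mulr0 -[RHS]oppr0 -C3 g2E; ring.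
      exists (g1 * y 0 (1 + 1) / (1 - g1)); rewrite g2E y10 invr1; split; first by ring.
      by field; rewrite g10 -opprB oppr_eq0.
    have g2N0 : g2 - 1 != 0 by rewrite subr_eq0.
    exists (g1 * g2 * y 0 1 / (g2 - 1)); split; first by field; rewrite g20 g2N0.
    have -> : y 0 (1 + 1) = (1 - g1) * y 0 1 / (g2 - 1).
      apply: (mulfI g2N0); by rewrite -[LHS]addr0 -C3; field; exact: g2N0.
    by field; rewrite g10 g2N0.
  have xE : x = c *: p.
    apply/rowP => i; rewrite [RHS]mxE.
    have [->|->|->] : [\/ i = 0, i = 1 | i = 1 + 1].
      by case: i => -[|[|[|n]]] // ?;
        [constructor 1|constructor 2|constructor 3]; exact: val_inj.
    - by rewrite xE0 s0 c1 c2 p0; ring.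
    - by rewrite xE1 c1 p1.
    - by rewrite xE2 c2 p2.
  exists c; last by rewrite xE.
  by apply: contraNneq xN0 => c0; rewrite xE c0 scale0r.
case=> c /= c0 <-; split; last first.
  by apply/eqP; rewrite scaler_eq0 negb_or c0 inter_point_neq0.
split; first by rewrite /line /= sum3E !mxE /=; ring.
exists (\row_i [:: c * (g2^-1 - g1^-1); c * (1 - g2^-1) / g1;
                   c * (g1^-1 - 1) / g2]`_i).
  by rewrite /line /= sum3E !mxE /=; field; rewrite g10 g20.
apply/rowP => -[] [|[|[|n]]] // ?; rewrite !mxE /=.
- by rewrite mul1r.
- by field; rewrite ?g10 ?g20.
- by field; rewrite ?g10 ?g20.
Qed.

(* The height of C `&` gC, see [line_inter_translate]. *)
Definition inter_height (R : realType) (g : algC * algC) : R :=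
  height R (inter_point g).

Section Eta.
Variable R : realType.

(* Subsets of and functions on (R/2 pi Z)^2 are represented by 2 pi-periodic
   subsets of and functions on R^2. *)
Definition Dtor (a : int * int) (e : nat) : set (R * R) :=
  [set u | exists j : nat, [/\ (j < e)%N, coprime j e &
     exists k : int, a.1%:~R * u.1 + a.2%:~R * u.2
                     = 2 * pi * j%:R / e%:R + 2 * pi * k%:~R]].

Definition expi (t : R) : R[i] := (cos t +i* sin t)%C.

Definition logmax (u : R * R) : \bar R :=
  lne (Num.max (Normc.normc (expi u.2 - expi u.1))
            (Num.max (Normc.normc (expi u.2 - 1)) (Normc.normc (expi u.1 - 1))))%:E.

Definition vnorm (a : int * int) : R :=
  Num.sqrt (a.1%:~R ^+ 2 + a.2%:~R ^+ 2).

(* Parametrization with constant speed [vnorm a] of the j-th component of Dtor,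
   a closed geodesic, for a primitive and t in [0, 2 pi[. *)
Definition component (a : int * int) (e j : nat) (t : R) : R * R :=
  let c := 2 * pi * j%:R / (e%:R * vnorm a ^+ 2) in
  (c * a.1%:~R - t * a.2%:~R, c * a.2%:~R + t * a.1%:~R).

Lemma measurable_component a e j : measurable_fun setT (component a e j).
Proof.
apply: measurable_fun_pair => /=.
- apply: measurable_funB; first exact: measurable_cst.
  by apply: measurable_funM => //; exact: measurable_cst.
- apply: measurable_funD; first exact: measurable_cst.
  by apply: measurable_funM => //; exact: measurable_cst.
Qed.

Lemma vnorm_gt0 a : primitive_vec a -> 0 < vnorm a.
Proof.
case: a => a1 a2 pa; rewrite sqrtr_gt0 /= lt_def addr_ge0 ?sqr_ge0// andbT.
rewrite paddr_eq0 ?sqr_ge0// !sqrf_eq0 !intr_eq0.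
by apply/negP => /andP[/eqP E1 /eqP E2]; move: pa; rewrite E1 E2 /primitive_vec gcd0z.
Qed.

Lemma component_dot a e j t : primitive_vec a ->
  a.1%:~R * (component a e j t).1 + a.2%:~R * (component a e j t).2
  = 2 * pi * j%:R / e%:R.
Proof.
move=> /vnorm_gt0 va0; rewrite /component /= invfM.
have -> : (vnorm a ^+ 2) = a.1%:~R ^+ 2 + a.2%:~R ^+ 2.
  by rewrite sqr_sqrtr// addr_ge0 ?sqr_ge0.
have n0 : (a.1%:~R ^+ 2 + a.2%:~R ^+ 2 : R) != 0.
  by move: va0; rewrite sqrtr_gt0 => /lt0r_neq0.
by move: (e%:R^-1) => ei; field; exact: n0.
Qed.

(* Modulo 2 pi, [component] is a bijection from the disjoint union of the
   intervals [0, 2 pi[, for j in (Z/eZ)^x, onto Dtor. *)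
Lemma component_D a e j t : primitive_vec a -> (j < e)%N -> coprime j e ->
  Dtor a e (component a e j t).
Proof.
move=> pa je cje; exists j; split => //; exists 0.
by rewrite component_dot// mulr0 addr0.
Qed.

Lemma component_inj a e j j' t t' (k : int * int) :
  primitive_vec a -> (j < e)%N -> (j' < e)%N ->
  0 <= t < 2 * pi -> 0 <= t' < 2 * pi ->
  (component a e j t).1 = (component a e j' t').1 + 2 * pi * k.1%:~R ->
  (component a e j t).2 = (component a e j' t').2 + 2 * pi * k.2%:~R ->
  j = j' /\ t = t'.
Proof.
move=> pa je je' /andP[t0 t1] /andP[t0' t1'] E1 E2.
have pi0 : (pi : R) != 0 by rewrite gt_eqF// pi_gt0.
have e0 : (e%:R : R) != 0 by rewrite pnatr_eq0 -lt0n (leq_ltn_trans _ je).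
pose m := a.1 * k.1 + a.2 * k.2.
have E : 2 * pi * j'%:R / e%:R + 2 * pi * m%:~R = 2 * pi * j%:R / e%:R :> R.
  rewrite -(component_dot e j t pa) -(component_dot e j' t' pa) E1 E2.
  by rewrite /m intrD !intrM; ring.
have Ej : (j%:Z = j'%:Z + e%:Z * m)%R.
  apply/(@intr_inj R); rewrite intrD intrM -!pmulrn.
  apply: (mulfI (_ : 2 * pi / e%:R != 0)).
    by rewrite !mulf_neq0// ?invr_eq0// pnatr_eq0.
  transitivity (2 * pi * j%:R / e%:R : R); first by field.
  by rewrite -E; field.
have m0 : m = 0.
  by nia.
have jj' : j = j' by move: Ej; rewrite m0 mulr0 addr0 => -[].
split => //.
have [s [k1 k2]] : exists s : int, k.1 = - (s * a.2) /\ k.2 = s * a.1.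
  have [u [v uv]] : exists u v, u * a.1 + v * a.2 = 1.
    by have [u [v uvE]] := Bezoutz a.1 a.2; exists u, v; rewrite uvE.
  exists (u * k.2 - v * k.1); split.
    have : (u * a.1 + v * a.2) * k.1 = - ((u * k.2 - v * k.1) * a.2) + u * m.
      by rewrite /m; ring.
    by rewrite uv m0 mul1r mulr0 addr0.
  have : (u * a.1 + v * a.2) * k.2 = (u * k.2 - v * k.1) * a.1 + v * m.
    by rewrite /m; ring.
  by rewrite uv m0 mul1r mulr0 addr0.
have E3 : (t - t' - 2 * pi * s%:~R) * a.2%:~R = 0.
  by move: E1; rewrite /component /= jj' k1 intrN intrM => E1; lra.
have E4 : (t - t' - 2 * pi * s%:~R) * a.1%:~R = 0.
  by move: E2; rewrite /component /= jj' k2 intrM => E2; lra.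
have E5 : t - t' = 2 * pi * s%:~R.
  apply/eqP; rewrite -subr_eq0; apply/negPn/negP => n0.
  have := vnorm_gt0 pa; rewrite sqrtr_gt0.
  move/eqP: E3; rewrite mulf_eq0 (negbTE n0) /= => /eqP ->.
  by move/eqP: E4; rewrite mulf_eq0 (negbTE n0) /= => /eqP ->; rewrite expr0n addr0 ltxx.
have pi2 : 0 < 2 * pi :> R by rewrite mulr_gt0 ?pi_gt0.
have : `|s| < 1.
  rewrite -(@ltr_int R) intr_norm -(ltr_pM2l pi2) mulr1 -{1}(gtr0_norm pi2).
  by rewrite -normrM -E5 ltr_norml; apply/andP; split; lra.
move=> s1; have s0 : s = 0 by lia.
by apply/eqP; rewrite -subr_eq0 E5 s0 mulr0.
Qed.

Lemma component_surj a e (u : R * R) : primitive_vec a -> Dtor a e u ->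
  exists j t (k : int * int), [/\ (j < e)%N, coprime j e, 0 <= t < 2 * pi,
    u.1 = (component a e j t).1 + 2 * pi * k.1%:~R
  & u.2 = (component a e j t).2 + 2 * pi * k.2%:~R].
Proof.
case: a => a1 a2; case: u => u1 u2 pa [j [je cje [m /= um]]].
have pi2 : 0 < 2 * pi :> R by rewrite mulr_gt0 ?pi_gt0.
have e0 : (e%:R : R) != 0 by rewrite pnatr_eq0 -lt0n (leq_ltn_trans _ je).
have [b1 [b2 b12]] : exists u v, u * a1 + v * a2 = 1.
  by have [u [v uvE]] := Bezoutz a1 a2; exists u, v; rewrite uvE.
have /(congr1 (fun z : int => z%:~R : R)) := b12; rewrite intrD !intrM => bR.
have vE : vnorm (a1, a2) ^+ 2 = a1%:~R ^+ 2 + a2%:~R ^+ 2.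
  by rewrite sqr_sqrtr// addr_ge0 ?sqr_ge0.
have n0 : (a1%:~R ^+ 2 + a2%:~R ^+ 2 : R) != 0.
  by have := vnorm_gt0 pa; rewrite sqrtr_gt0 => /lt0r_neq0.
pose w1 := u1 - 2 * pi * (m * b1)%:~R; pose w2 := u2 - 2 * pi * (m * b2)%:~R.
pose t0 := (a1%:~R * w2 - a2%:~R * w1) / (a1%:~R ^+ 2 + a2%:~R ^+ 2).
pose n := Num.floor (t0 / (2 * pi)).
have w12 : a1%:~R * w1 + a2%:~R * w2 = 2 * pi * j%:R / e%:R.
  transitivity (a1%:~R * u1 + a2%:~R * u2 -
     2 * pi * m%:~R * (b1%:~R * a1%:~R + b2%:~R * a2%:~R)).
    by rewrite /w1 /w2 !intrM; ring.
  by rewrite um bR; ring.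
exists j, (t0 - 2 * pi * n%:~R), (m * b1 - n * a2, m * b2 + n * a1).
have cE : 2 * pi * j%:R / (e%:R * vnorm (a1, a2) ^+ 2) =
    (a1%:~R * w1 + a2%:~R * w2) / (a1%:~R ^+ 2 + a2%:~R ^+ 2).
  by rewrite w12 vE; field; rewrite e0 n0.
split => //.
- have /andP[f1 f2] := floor_itv (t0 / (2 * pi)).
  move: f1 f2; rewrite ler_pdivlMr// ltr_pdivrMr// -/n intrD => f1 f2.
  by apply/andP; split; lra.
- rewrite /component /= cE; rewrite intrB !intrM /t0.
  transitivity (w1 + 2 * pi * (m%:~R * b1%:~R)); first by rewrite /w1 intrM; ring.
  by field.
- rewrite /component /= cE; rewrite intrD !intrM /t0.
  transitivity (w2 + 2 * pi * (m%:~R * b2%:~R)); first by rewrite /w2 intrM; ring.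
  by field.
Qed.

Section ArcLength.
Variables (a : int * int) (e : nat).

Definition component_measure (j : nat) : set (R * R) -> \bar R :=
  pushforward (mrestr lebesgue_measure (measurable_itv `[0, 2 * pi[))
    (component a e j).

Let component_pushforward j : {measure set (R * R) -> \bar R} :=
  measure_function_pushforward__canonical__measure_function_Measure (mrestr lebesgue_measure (measurable_itv `[0, 2 * pi[))
    (measurable_component a e j).


Let component_measure0 j : component_measure j set0 = 0%E.
Proof. exact: (measure0 (component_pushforward j)). Qed.

Let component_measure_ge0 j A : (0 <= component_measure j A)%E.
Proof. exact: (measure_ge0 (component_pushforward j)). Qed.

Let component_measure_sigma_additive j :
  semi_sigma_additive (component_measure j).
Proof.
exact: (@measure_semi_sigma_additive _ _ _ (component_pushforward j)). Qed.

HB.instance Definition _ j := isMeasure.Build _ _ _ (component_measure j)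
  (component_measure0 j) (@component_measure_ge0 j)
  (@component_measure_sigma_additive j).

(* Arc length on the j-th component: its speed [vnorm a] is the density. *)
Definition component_length (j : nat) : {measure set (R * R) -> \bar R} :=
  mscale (NngNum (sqrtr_ge0 (a.1%:~R ^+ 2 + a.2%:~R ^+ 2)))
    (component_measure j).

Definition arc_length : set (R * R) -> \bar R :=
  msum (fun j => if coprime j e then component_length j else mzero) e.

HB.instance Definition _ := Measure.on arc_length.

Definition tau : probability (R * R)%type R :=
  mnormalize arc_length (dirac ((0, 0) : R * R)).

Definition eta : \bar R := (\int[tau]_(u in Dtor a e) logmax u)%E.

Lemma arc_length_setT :
  arc_length setT = ((totient e)%:R * (2 * pi * vnorm a))%:E.
Proof.
have lenE j : component_length j setT = (2 * pi * vnorm a)%:E.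
  rewrite /component_length /= /mscale /= /component_measure /pushforward.
  rewrite preimage_setT /mrestr setTI lebesgue_measure_itv /= lte_fin.
  by rewrite mulr_gt0 ?pi_gt0// oppr0 adde0 -EFinM mulrC.
rewrite /arc_length /msum totient_count_coprime big_mkord.
rewrite (eq_bigr (fun j : 'I_e => ((coprime e j)%:R * (2 * pi * vnorm a))%:E)).
  by rewrite sumEFin -mulr_suml natr_sum.
move=> j _; rewrite coprime_sym; case: ifP => _; last by rewrite mul0r.
by rewrite lenE mul1r.
Qed.

End ArcLength.
End Eta.

(* Main.v *)
(* For a torsion point g with coordinates in a number field K of degree n, the
   Archimedean part of the height of C `&` gC is the average of the function f
   over the n conjugates of g in the torus.  The non-Archimedean part is between
   - log N / phi(N) and 0, where N is the order of a coordinate of g, because the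
   product of the 1 - s over the primitive N-th roots of unity s divides N.

   Averages of a character over conjugates are averages over all primitive roots
   of unity of some order.  In a strict sequence this order tends to infinity for
   each character that is not a power of chi^a, so Weyl's criterion gives the
   convergence of the averages of Lipschitz functions to their tau_{a,e}-integral.
   The function f is singular at (1, 1), and is replaced by
   f_d = log max (exp f, d).  Choose b such that (a, b) is a basis of Z^2 and write
   y for the value of chi^b.  As |1 - y| is at most A exp f with A = |b_1| + |b_2|,
     f_d + log |1 - y| - log max (|1 - y|, A d) <= f <= f_d.
   The average of log |1 - y| over conjugates is between 0 and log N / phi(N), where
   N is the order of chi^b(g), and the integral of log max (|1 - y|, A d) tends to 0
   with d, since it is at most halved when d is halved. *)

From HB Require Import structures.
Require Import Defs.
From mathcomp Require Import all_boot all_order all_algebra all_field.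
From mathcomp Require Import cyclic complex zify ring lra.
From mathcomp Require Import all_classical all_reals all_analysis.
From mathcomp Require Import measurable_realfun.

Set Implicit Arguments.
Unset Strict Implicit.
Unset Printing Implicit Defensive.
Import Order.TTheory GRing.Theory Num.Theory.
Import numFieldNormedType.Exports.
Local Open Scope classical_set_scope.
Local Open Scope ring_scope.

(** * Absolute values *)

(** The height is built from bare absolute values and from completions given by Cauchy sequences, so
    its places must be determined before anything can be averaged. At the Archimedean place an exact
    description is required. The embeddings of K provide absolute values whose local degrees, 1 or
    2, already add up to [K : Q], and weak approximation bounds every such sum by [K : Q]; this
    leaves room neither for a further place nor for a larger degree. At a finite place the same
    inequality turns a bound at each w into a bound for the sum. On the analytic side the obstacle
    is that f is unbounded below at (1, 1), so that convergence on Lipschitz functions controls the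
    averages of f only from above. The conjugates must be kept from accumulating at (1, 1).
    Arithmetic does this: the product of the 1 - y over the primitive N-th roots y, for N > 1, is
    the nonzero integer Phi_N(1), and its logarithm is nonnegative. *)

Section AbsoluteValue.
Variables (R : realType) (F : fieldType) (w : F -> R).
Hypothesis Hw : absolute_value w.

Lemma abv_ge0 x : 0 <= w x. Proof. by case: Hw. Qed.
Lemma abvM x y : w (x * y) = w x * w y. Proof. by case: Hw. Qed.
Lemma abvD x y : w (x + y) <= w x + w y. Proof. by case: Hw. Qed.
Lemma abv0 : w 0 = 0. Proof. by case: Hw => _ /(_ 0)[_ ->]. Qed.

Lemma abv_eq0 x : (w x == 0) = (x == 0).
Proof. by case: Hw => _ H _ _; apply/eqP/eqP => /H. Qed.

Lemma abv_gt0 x : (0 < w x) = (x != 0).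
Proof. by rewrite lt_def abv_eq0 abv_ge0 andbT. Qed.

Lemma abv1 : w 1 = 1.
Proof.
have w1 : w 1 != 0 by rewrite abv_eq0 oner_eq0.
by apply: (mulfI w1); rewrite -abvM !mulr1.
Qed.

Lemma abvX x n : w (x ^+ n) = w x ^+ n.
Proof. by elim: n => [|n IH]; rewrite ?expr0 ?abv1// !exprS abvM IH. Qed.

Lemma abv_prod (I : Type) (r : seq I) (P : pred I) (f : I -> F) :
  w (\prod_(i <- r | P i) f i) = \prod_(i <- r | P i) w (f i).
Proof. by apply: (big_morph w abvM abv1). Qed.

Lemma abv_root1 x n : (0 < n)%N -> x ^+ n = 1 -> w x = 1.
Proof.
move=> n0 xn; apply/eqP; rewrite -(@pexpr_eq1 _ _ n) ?abv_ge0//.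
by rewrite -abvX xn abv1.
Qed.

Lemma abvN x : w (- x) = w x.
Proof.
by rewrite -mulN1r abvM (@abv_root1 (-1) 2) ?mul1r// sqrrN expr1n.
Qed.

Lemma abvB x y : w (x - y) <= w x + w y.
Proof. by rewrite -(abvN y) abvD. Qed.

Lemma abv_distC x y : w (x - y) = w (y - x).
Proof. by rewrite -abvN opprB. Qed.

Lemma abv_sub_le x y : w x - w y <= w (x - y).
Proof. by rewrite lerBlDr (le_trans _ (abvD _ _))// subrK. Qed.

Lemma abvV x : w x^-1 = (w x)^-1.
Proof.
have [->|x0] := eqVneq x 0; first by rewrite invr0 abv0 invr0.
have wx : w x != 0 by rewrite abv_eq0.
by apply: (mulfI wx); rewrite -abvM !divff// abv1.
Qed.

Lemma abvXz x (n : int) : w (x ^ n) = w x ^ n.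
Proof. by case: n => n; rewrite ?NegzE -?exprnN ?abvV ?abvX// !exprnP abvX. Qed.

Lemma abv_sum (I : Type) (r : seq I) (P : pred I) (f : I -> F) :
  w (\sum_(i <- r | P i) f i) <= \sum_(i <- r | P i) w (f i).
Proof.
elim/big_ind2: _ => [|a b c d ab cd|//]; first by rewrite abv0.
exact: le_trans (abvD _ _) (lerD ab cd).
Qed.

End AbsoluteValue.

(** * Weak approximation and the bound on sums of local degrees *)

Section WeakApproximation.
Variables (R : realType) (K : fieldExtType rat) (v : rat -> R).

(** Membership in [places_above], with an arbitrary function v on the rationals in place of
    [rat_abs]. *)
Definition extends (w : K -> R) :=
  absolute_value w /\ forall q : rat, w q%:A = v q.

Lemma extendsZ w q x : extends w -> w (q *: x) = v q * w x.
Proof. by case=> Hw wv; rewrite -mulr_algl (abvM Hw) wv. Qed.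

Hypothesis v_nontrivial : exists c : rat, 1 < v c.

Lemma archimedean_power (x y : R) : 1 < x ->
  \forall m \near \oo, y < x ^+ m.
Proof.
move=> x1; have x0 : 0 < x by lra.
have [N _ HN] : \forall m \near \oo, y / (x - 1) < m%:R.
  exact: nbhs_infty_gtr.
exists N => // m /= Nm; have := HN m Nm.
rewrite /= ltr_pdivrMr ?subr_gt0// => /lt_le_trans; apply.
have -> : x = 1 + (x - 1) by ring.
move: (x - 1) (subr_gt0 1 x) => z; rewrite x1 => z0.
have -> : 1 + z - 1 = z by ring.
elim: m {Nm} => [|m IH]; first by rewrite mul0r expr0.
rewrite exprS mulrDl mul1r -natr1 mulrDl mul1r.
apply: lerD => //.
rewrite -[leLHS]mulr1 ler_pM2l// exprn_ege1//; lra.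
Qed.

Lemma small_power (x y : R) : 0 <= x < 1 -> 0 < y ->
  \forall m \near \oo, x ^+ m < y.
Proof.
move=> /andP[x0 x1] y0.
have [->|xN0] := eqVneq x 0.
  by exists 1%N => // -[|m]//= _; rewrite expr0n.
have xp : 0 < x by rewrite lt_def xN0.
have := @archimedean_power x^-1 y^-1; rewrite invf_gt1// => /(_ x1)[N _ HN].
exists N => // m /HN /=; rewrite exprVn ltf_pV2 ?posrE//.
exact: exprn_gt0.
Qed.

(** On the logarithmic scale the interval from [a ^+ m] to [b ^+ m] is longer than [ln g] once m is
    large, so it contains a multiple of [ln g]. *)
Lemma power_between (g a b : R) : 1 < g -> 0 < a -> a < b ->
  exists (m : nat) (k : int), a ^+ m < g ^ k < b ^+ m.
Proof.
move=> g1 a0 ab; have b0 : 0 < b by exact: lt_trans ab.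
have g0 : 0 < g by lra.
have lg : 0 < ln g by rewrite ln_gt0.
have ba : 1 < b / a by rewrite ltr_pdivlMr// mul1r.
have [m _ /(_ m (leqnn m)) /= Hm] := archimedean_power g ba.
pose k := Num.floor (ln (a ^+ m) / ln g).
have am : 0 < a ^+ m by exact: exprn_gt0.
have gk j : 0 < g ^ j by rewrite exprz_gt0.
have lngk j : ln (g ^ j) = ln g * j%:~R.
  case: j => j; first by rewrite -exprnP lnXn// -mulr_natr.
  by rewrite NegzE -exprnN lnV ?posrE ?exprn_gt0// lnXn// rmorphN /= mulrN mulr_natr.
have /andP[f1 f2] := floor_itv (ln (a ^+ m) / ln g).
rewrite -/k in f1 f2.
exists m, (k + 1); apply/andP; split.
  by rewrite -ltr_ln ?posrE// lngk mulrC -ltr_pdivrMr.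
rewrite expfzDr ?gt_eqF//.
have : g ^ k <= a ^+ m.
  by rewrite -ler_ln ?posrE// lngk mulrC -ler_pdivlMr.
move=> h; apply: (@le_lt_trans _ _ (a ^+ m * g)); first by rewrite ler_pM2r.
by move: Hm; rewrite expr_div_n ltr_pdivlMr// mulrC.
Qed.

(** If [u x < u' x], some [v c ^ k] lies strictly between [u x ^+ m] and [u' x ^+ m]. Dividing
    [x ^+ m] by [c ^ k] scales both values by the same factor and puts 1 between them. *)
Lemma extends_separate w w' : extends w -> extends w' -> w <> w' ->
  exists y, 1 < w y /\ w' y < 1.
Proof.
have [c c1] := v_nontrivial.
have main u u' x : extends u -> extends u' -> u x < u' x ->
    exists y, u y < 1 /\ 1 < u' y.
  move=> [Hu uv] [Hu' uv'] uu'.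
  have x0 : x != 0.
    by apply: contraTneq uu' => ->; rewrite !abv0// ltxx.
  have ux : 0 < u x by rewrite abv_gt0.
  have [m [k /andP[k1 k2]]] := power_between c1 ux uu'.
  have gk : 0 < v c ^ k by rewrite exprz_gt0//; lra.
  exists (x ^+ m * ((c%:A) ^ k)^-1).
  rewrite (abvM Hu) (abvM Hu') (abvX Hu) (abvX Hu') (abvV Hu) (abvV Hu').
  rewrite (abvXz Hu) (abvXz Hu') uv uv'.
  by split; [rewrite ltr_pdivrMr// mul1r|rewrite ltr_pdivlMr// mul1r].
move=> ew ew' ww'.
have [x /eqP xx] : exists x, w x <> w' x.
  by apply: contrapT => /forallNP H; apply: ww'; apply/funext => x; apply: contrapT; exact: H.
have [xl|xl|E] := ltgtP (w x) (w' x); last by rewrite E eqxx in xx.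
  have [y [y1 y2]] := main _ _ _ ew ew' xl.
  have [Hw _] := ew; have [Hw' _] := ew'.
  have y0 : y != 0.
    by apply: contraTneq y2 => ->; rewrite abv0// -leNgt ler01.
  exists y^-1; rewrite !abvV// invf_lt1 ?invf_gt1 ?abv_gt0//.
by have [y [y1 y2]] := main _ _ _ ew' ew xl; exists y.
Qed.

(** The quotients y^m / (1 + y^m) act as a switch: they tend to 1 at the places where y is large and
    to 0 where it is small. *)
Lemma abv_ratio_near1 (w : K -> R) y (eps : R) : absolute_value w -> 0 < eps -> 1 < w y ->
  \forall m \near \oo, w (y ^+ m / (1 + y ^+ m) - 1) < eps.
Proof.
move=> Hw e0 y1.
have [N _ HN] := archimedean_power (1 + eps^-1) y1.
exists N => // m /HN /= H.
have wlow : eps^-1 < w (1 + y ^+ m).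
  have := abv_sub_le Hw (y ^+ m) (-1).
  rewrite (abvN Hw) (abv1 Hw) (abvX Hw) opprK addrC [_ + 1]addrC => h; lra.
have ei : 0 < eps^-1 by rewrite invr_gt0.
have n0 : 1 + y ^+ m != 0 by rewrite -(abv_gt0 Hw); lra.
have -> : y ^+ m / (1 + y ^+ m) - 1 = - (1 + y ^+ m)^-1 by field.
by rewrite abvN// abvV// -[eps]invrK ltf_pV2 ?posrE//; lra.
Qed.

Lemma abv_ratio_near0 (w : K -> R) y (eps : R) : absolute_value w -> 0 < eps -> w y < 1 ->
  \forall m \near \oo, w (y ^+ m / (1 + y ^+ m)) < eps.
Proof.
move=> Hw e0 y1.
have [N _ HN] : \forall m \near \oo, w y ^+ m < Num.min 2^-1 (eps / 2).
  by apply: small_power; rewrite ?abv_ge0// lt_min; apply/andP; split; lra.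
exists N => // m /HN /=; rewrite lt_min => /andP[h1 h2].
have wlow : 2^-1 < w (1 + y ^+ m).
  have := abv_sub_le Hw 1 (- y ^+ m).
  by rewrite (abvN Hw) (abv1 Hw) (abvX Hw) opprK => h; lra.
rewrite abvM// abvV// abvX// ltr_pdivrMr; last lra.
have : eps * 2^-1 < eps * w (1 + y ^+ m) by rewrite ltr_pM2l.
lra.
Qed.

Variables (r : nat) (w : 'I_r -> K -> R).
Hypotheses (w_ext : forall i, extends (w i)) (w_inj : injective w).

Let Hw i : absolute_value (w i). Proof. by have [] := w_ext i. Qed.

(** The last clause excludes the value 1, at which the switch need not converge. Dividing a high
    power of y by a rational c with [v c > 1] pushes the values at most 1 below 1 and leaves the
    others above 1. *)
Lemma separating_unit i j : i != j ->
  exists y, [/\ 1 < w i y, w j y < 1 & forall l, w l y != 1].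
Proof.
move=> ij; have [c c1] := v_nontrivial.
have [y [y1 y2]] : exists y, 1 < w i y /\ w j y < 1.
  by apply: extends_separate => // /w_inj /eqP; rewrite (negbTE ij).
have : \forall M \near \oo, forall l, 1 < w l y -> v c < w l y ^+ M.
  apply: filter_forall => l.
  have [yl|yl] := boolP (1 < w l y); last by near=> M.
  by have := archimedean_power (v c) yl; apply: filterS.
move=> [N _ /(_ N.+1 (leqnSn N)) /= HN].
have c0 : 0 < v c by lra.
have wE l : w l (y ^+ N.+1 * (c%:A)^-1) = w l y ^+ N.+1 / v c.
  by have [_ wv] := w_ext l; rewrite abvM// abvX// abvV// wv.
exists (y ^+ N.+1 * (c%:A)^-1); split.
- by rewrite wE ltr_pdivlMr// mul1r HN.
- rewrite wE ltr_pdivrMr// mul1r (le_lt_trans _ c1)//.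
  by rewrite exprn_ile1 ?abv_ge0// ltW.
- move=> l; rewrite wE; have [ly|ly] := ltP 1 (w l y).
    by rewrite gt_eqF// ltr_pdivlMr// mul1r HN.
  rewrite lt_eqF// ltr_pdivrMr// mul1r (le_lt_trans _ c1)//.
  by rewrite exprn_ile1 ?abv_ge0.
Unshelve. all: by end_near. Qed.

(** The bound 2 at all places is independent of eps, so several such elements can be multiplied
    without losing smallness. *)
Lemma pair_approximation i j (eps : R) : i != j -> 0 < eps ->
  exists e, [/\ w i (e - 1) < eps, w j e < eps & forall l, w l e <= 2].
Proof.
move=> ij e0; have [y [y1 y2 y3]] := separating_unit ij.
have : \forall m \near \oo, [/\ w i (y ^+ m / (1 + y ^+ m) - 1) < eps,
    w j (y ^+ m / (1 + y ^+ m)) < eps &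
    forall l, w l (y ^+ m / (1 + y ^+ m)) <= 2].
  near=> m; split; near: m.
  - exact: abv_ratio_near1.
  - exact: abv_ratio_near0.
  - apply: filter_forall => l.
    have [yl|yl|/eqP] := ltgtP (w l y) 1; last by rewrite (negbTE (y3 l)).
      by have := abv_ratio_near0 (Hw l) ltr01 yl; apply: filterS => m; lra.
    have := abv_ratio_near1 (Hw l) ltr01 yl; apply: filterS => m h.
    have := abvD (Hw l) (y ^+ m / (1 + y ^+ m) - 1) 1.
    by rewrite subrK abv1//; lra.
by move=> [N _ /(_ N (leqnn N)) /= HN]; exists (y ^+ N / (1 + y ^+ N)).
Unshelve. all: by end_near. Qed.

(** The element is a product with one factor from [pair_approximation] for each j other than i:
    every factor is near 1 at i, small at its own j and at most 2 elsewhere. *)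
Lemma weak_approximation i (eps : R) : 0 < eps ->
  exists e, w i (e - 1) < eps /\ forall j, j != i -> w j e < eps.
Proof.
move=> e0.
suff main (s : seq 'I_r) : i \notin s -> forall eps, 0 < eps -> exists e,
    [/\ w i (e - 1) < eps, forall j, j \in s -> w j e < eps
      & forall l, w l e <= 2 ^+ size s].
  have [|e [e1 e2 _]] := main [seq j <- enum 'I_r | j != i] _ eps e0.
    by rewrite mem_filter eqxx.
  by exists e; split => // j ji; apply: e2; rewrite mem_filter ji mem_enum.
elim: s => [_|j s IH /[!inE] /norP[ij is_]] {e0}eps e0.
  by exists 1; rewrite subrr abv0//; split => // l; rewrite abv1.
set B : R := 2 ^+ size s.
have B0 : 1 <= B by rewrite exprn_ege1//; lra.
(* The errors are at most [eta * B + eta] at i, [eta * B] at j and [2 * eta] at the places of s; all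
   of them are below eps. *)
pose eta := eps / (B + 2).
have eta0 : 0 < eta by rewrite divr_gt0//; lra.
have etaE : eta * B + eta * 2 = eps by rewrite /eta; field; lra.
have [e [e1 e2 e3]] := IH is_ eta eta0.
have [f [f1 f2 f3]] := pair_approximation ij eta0.
have wf l := abv_ge0 (Hw l) f; have we l := abv_ge0 (Hw l) e.
have etaB : 0 < eta * B by rewrite mulr_gt0//; lra.
exists (e * f); split.
- have -> : e * f - 1 = e * (f - 1) + (e - 1) by ring.
  apply: le_lt_trans (abvD (Hw _) _ _) _; rewrite abvM//.
  have := ler_pM (we i) (abv_ge0 (Hw i) (f - 1)) (e3 i) (ltW f1).
  rewrite mulrC [B * _]mulrC; lra.
- move=> l; rewrite inE abvM// => /predU1P[->|/e2 {}e2].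
    have := ler_pM (we j) (wf j) (e3 j) (ltW f2).
    rewrite [leRHS]mulrC -/B; lra.
  have := ler_pM (we l) (wf l) (ltW e2) (f3 l); lra.
- by move=> l; rewrite abvM// exprSr ler_pM.
Qed.

(* The weight of x in the l-th completion can only come from the l-th block of
   a rational relation between approximations of the given families. *)
Theorem sum_local_dim_le (d : 'I_r -> nat) (b : forall l, 'I_(d l) -> K)
    (delta : 'I_r -> R) :
  (forall l, 0 < delta l) ->
  (forall l (c : 'I_(d l) -> rat) i,
     delta l * v (c i) <= w l (\sum_i c i *: b l i)) ->
  (\sum_l d l <= \dim {:K})%N.
Proof.
move=> delta0 Hb.
have [r0|r0] := posnP r.
  by rewrite big1// => -[l Hl]; exfalso; move: Hl; rewrite r0.
pose T : finType := {l : 'I_r & 'I_(d l)}.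
have cardT : #|T| = (\sum_l d l)%N.
  by rewrite card_tagged sumnE big_map big_enum; apply: eq_bigr => l _; rewrite card_ord.
rewrite -cardT leqNgt; apply/negP => dimT.
pose B : R := 1 + \sum_(t : T) \sum_l w l (b (tag t) (tagged t)).
have wbge0 l x : 0 <= w l x by exact: abv_ge0.
have B0 : 0 < B by rewrite ltr_pwDl// !sumr_ge0// => ? _; exact: sumr_ge0.
have Bl (t : T) l : w l (b (tag t) (tagged t)) <= B.
  rewrite /B (bigD1 t)//= (bigD1 l)//=.
  set u := \sum_(_ | _) _; set u' := \sum_(_ | _) _.
  have : 0 <= u by apply: sumr_ge0.
  have : 0 <= u' by apply: sumr_ge0 => *; apply: sumr_ge0.
  lra.
(* Each term of the rational relation below is off by at most [eps * B] times the largest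
   coefficient; this choice keeps the total of [#|T|] errors below every [delta l]. *)
pose eps := \big[Num.min/1]_l delta l / (2 * B * (1 + #|T|%:R)).
have dmin0 : 0 < \big[Num.min/1]_l delta l.
  by elim/big_ind : _ => // x y x0 y0; rewrite lt_min x0.
have T0 : 0 < 1 + #|T|%:R :> R by rewrite ltr_pwDl.
have eps0 : 0 < eps by rewrite divr_gt0// mulr_gt0// mulr_gt0.
pose e l := sval (cid (weak_approximation l eps0)).
have e1 l : w l (e l - 1) < eps by rewrite /e; case: cid => ? [].
have e2 l j : j != l -> w j (e l) < eps by rewrite /e; case: cid => ? [] ?; apply.
(* The factor [e l] makes the l-th family visible at [w l] only. More than [\dim {:K}] such products
   satisfy a rational relation. *)
pose x (t : T) := e (tag t) * b (tag t) (tagged t).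
have dimx : ~~ free [tuple x (enum_val i) | i < #|T|].
  apply/negP => /eqP fr; move: dimT; rewrite ltnNge -[#|T|]card_ord.
  move: fr; rewrite size_tuple => fr.
  by rewrite card_ord -{1}fr dimvS ?subvf.
have [k [k0 [i ki]]] : exists k : 'I_#|T| -> rat,
    \sum_i k i *: x (enum_val i) = 0 /\ exists i, k i != 0.
  apply: contrapT => H; move/negP: dimx; apply; apply/freeP => k kE i.
  apply: contrapT => /eqP ki; apply: H; exists k; split; last by exists i.
  by rewrite -[RHS]kE; apply: eq_bigr => j _; rewrite -tnth_nth tnth_mktuple.
pose c t := k (enum_rank t).
have cE : \sum_(t : T) c t *: x t = 0.
  apply: etrans k0; rewrite (reindex (@enum_val T predT)) /=; last first.
    exact: (onW_bij _ (@enum_val_bij T)).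
  by apply: eq_bigr => j _; rewrite /c enum_valK.
have [l0 _] := w_ext (Ordinal r0); have [_ wv] := w_ext (Ordinal r0).
have v_ge0 q : 0 <= v q by rewrite -wv.
have v_gt0 q : q != 0 -> 0 < v q.
  by move=> q0; rewrite -wv (abv_gt0 l0) scaler_eq0 oner_eq0 orbF.
(* The contradiction arises at the place to which the largest coefficient belongs, because this
   coefficient bounds all the errors. *)
pose t0 := [arg max_(t > enum_val i) v (c t)]%O.
have [t0c t0max] : 0 < v (c t0) /\ forall t, v (c t) <= v (c t0).
  rewrite /t0; case: arg_maxP => //= t _ tmax; split; last by move=> u; exact: tmax.
  apply: lt_le_trans (tmax (enum_val i) isT).
  by rewrite /c enum_valK v_gt0.
set C := v (c t0) in t0c t0max.
set l := tag t0.
pose mk l' (i : 'I_(d l')) : T := Tagged (fun l => 'I_(d l)) i.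
have mkE t : mk (tag t) (tagged t) = t by case: t.
have := Hb l (fun i => c (mk l i)) (tagged t0).
rewrite mkE -/C => main.
have : w l (\sum_(t : T) c t *: x t - \sum_i c (mk l i) *: b l i)
   <= #|T|%:R * (C * (eps * B)).
  have -> : \sum_i c (mk l i) *: b l i =
      \sum_(t : T | tag t == l) c t *: b (tag t) (tagged t).
    have := @sig_big_dep _ 0 +%R _ (fun l => 'I_(d l) : finType) (pred1 l)
      (fun _ => xpredT) (fun l' i => c (mk l' i) *: b l' i).
    rewrite big_pred1_eq => ->.
    by apply: eq_big => [t|t _]; rewrite ?andbT ?mkE.
  rewrite [\sum_(t | tag t == l) _]big_mkcond /= -sumrB.
  apply: le_trans (abv_sum (Hw _) _ _ _) _.
  rewrite mulr_natl -sumr_const; apply: ler_sum => t _.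
  case: eqP => [tl|/eqP tl].
    rewrite -scalerBr (extendsZ _ _ (w_ext _)); apply: ler_pM => //.
    have -> : x t - b (tag t) (tagged t) = (e (tag t) - 1) * b (tag t) (tagged t).
      by rewrite /x; ring.
    by rewrite abvM// ler_pM// -tl ltW.
  rewrite subr0 (extendsZ _ _ (w_ext _)); apply: ler_pM => //.
  by rewrite abvM// ler_pM// ltW// e2// eq_sym.
rewrite cE sub0r abvN// => /(le_trans main).
have dl : \big[Num.min/1]_l delta l <= delta l.
  by rewrite (bigD1 l)//= ge_min lexx.
move=> /(le_trans (ler_wpM2r (ltW t0c) dl)).
rewrite [C * _]mulrC mulrA ler_pM2r// leNgt => /negP; apply.
have E : eps * B * (1 + #|T|%:R) * 2 = \big[Num.min/1]_l delta l.
  by rewrite /eps; field; rewrite !gt_eqF.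
have eB : 0 < eps * B by rewrite mulr_gt0.
have eBT : 0 <= eps * B * #|T|%:R by rewrite mulr_ge0// ltW.
rewrite -[ltRHS]E; nra.
Qed.

End WeakApproximation.

(** * From bases of a completion to elements of K *)

Lemma null_forP (R : realType) (F : Type) (u : F -> R) (x : nat -> F) :
  (forall y, 0 <= u y) ->
  null_for u x <-> forall eps, 0 < eps ->
    exists N, forall n, (N <= n)%N -> u (x n) < eps.
Proof.
move=> u0; rewrite /null_for; split.
  move=> /cvgrPdist_lt H eps /H [N _ HN]; exists N => n /HN /=.
  by rewrite sub0r normrN ger0_norm.
move=> H; apply/cvgrPdist_lt => eps /H [N HN]; exists N => // n /= /HN.
by rewrite sub0r normrN ger0_norm.
Qed.

Section NormEquivalence.
Variables (R : realType) (K : fieldExtType rat) (v : rat -> R) (w : K -> R).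
Hypothesis w_ext : extends v w.
Variables (d : nat) (b : 'I_d -> nat -> K).
Hypothesis b_cauchy : forall i, cauchy_for w (b i).
Hypothesis b_indep : forall c : 'I_d -> nat -> rat,
  (forall i, cauchy_for v (c i)) ->
  null_for w (fun n => \sum_i c i n *: b i n) -> forall i, null_for v (c i).

Let Hw : absolute_value w. Proof. by case: w_ext. Qed.
Let wv q : w q%:A = v q. Proof. by case: w_ext. Qed.
Let v0 q : 0 <= v q. Proof. by rewrite -wv abv_ge0. Qed.
Let vZ q x : w (q *: x) = v q * w x. Proof. exact: extendsZ. Qed.

Lemma extends_abv : absolute_value v.
Proof.
split=> [//|x|x y|x y].
- split=> [/eqP|->]; last by rewrite -wv scale0r abv0.
  by rewrite -wv abv_eq0// scaler_eq0 oner_eq0 orbF => /eqP.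
- by rewrite -!wv -abvM// -scalerAl mul1r scalerA.
- by rewrite -!wv scalerDl abvD.
Qed.

Let Hv := extends_abv.

Let b_near (eta : R) : 0 < eta -> exists N, forall m n i,
  (N <= m)%N -> (N <= n)%N -> w (b i m - b i n) < eta.
Proof.
move=> eta0; have N_ i := cid (b_cauchy i eta0).
exists (\max_i sval (N_ i)) => m n i Nm Nn.
have Ni : (sval (N_ i) <= \max_i sval (N_ i))%N by exact: leq_bigmax.
by apply: (svalP (N_ i)); [exact: leq_trans Nm|exact: leq_trans Nn].
Qed.

(** The bound is uniform in n because a single late stage [b i N] is to supply elements of K.
    Restricting the support of the coefficients to A permits induction on the size of A. *)
Let lower (A : {set 'I_d}) := exists (delta : R) N, 0 < delta /\
  forall n (c : 'I_d -> rat), (N <= n)%N -> (forall i, i \notin A -> c i = 0) ->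
  forall i, delta * v (c i) <= w (\sum_i c i *: b i n).

(* A family of combinations with i0-th coefficient 1 tending to 0 would have
   Cauchy coefficients by induction, contradicting independence. *)
Let dist_lower (A : {set 'I_d}) i0 : lower (A :\ i0) ->
  exists (delta : R) N, 0 < delta /\
  forall n (c : 'I_d -> rat), (N <= n)%N -> (forall i, i \notin A -> c i = 0) ->
  c i0 = 1 -> delta <= w (\sum_i c i *: b i n).
Proof.
move=> [delta [N0 [delta0 H]]]; apply: contrapT => Hn.
have {Hn} Hk k : exists nc : nat * ('I_d -> rat),
    [/\ (k <= nc.1)%N, forall i, i \notin A -> nc.2 i = 0, nc.2 i0 = 1
      & w (\sum_i nc.2 i *: b i nc.1) < k.+1%:R^-1].
  apply: contrapT => Hnc; apply: Hn; exists k.+1%:R^-1, k; split=> // n c kn cA c1.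
  by rewrite leNgt; apply/negP => wc; apply: Hnc; exists (n, c).
pose nn k := (sval (cid (Hk k))).1; pose c k := (sval (cid (Hk k))).2.
have nk k : (k <= nn k)%N by rewrite /nn; case: cid => ? [].
have cA k i : i \notin A -> c k i = 0 by rewrite /c; case: cid => ? [] ? + ? ?; apply.
have ci0 k : c k i0 = 1 by rewrite /c; case: cid => ? [].
have wc k : w (\sum_i c k i *: b i (nn k)) < k.+1%:R^-1.
  by rewrite /c /nn; case: cid => ? [].
have [N1 HN1] := b_near ltr01.
have [N [N0N N1N]] : exists N, (N0 <= N)%N /\ (N1 <= N)%N.
  by exists (maxn N0 N1); rewrite leq_maxl leq_maxr.
(* Removing the [i0]-th term leaves a combination of value at most [1 + w (b i0 (nn k))], and
   [b i0 (nn k)] is within 1 of [b i0 N1]; the bound for [A :\ i0] then controls the other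
   coefficients. *)
pose B := 1 + (2 + w (b i0 N1)) / delta.
have B0 : 0 < B.
  by rewrite ltr_pwDl// divr_ge0 ?(ltW delta0)// addr_ge0// abv_ge0.
have cB k i : (N <= k)%N -> v (c k i) <= B.
  move=> Nk; have [->|ii0] := eqVneq i i0.
    rewrite ci0 (abv1 Hv) lerDl divr_ge0 ?(ltW delta0)// addr_ge0// abv_ge0//.
  have := H (nn k) (fun i => if i == i0 then 0 else c k i) _ _ i.
  rewrite (negbTE ii0) => /(_ (leq_trans N0N (leq_trans Nk (nk k)))) h.
  have {h} : delta * v (c k i) <= w (\sum_i c k i *: b i (nn k) - b i0 (nn k)).
    apply: le_trans (h _) _.
      move=> j; rewrite !inE negb_and negbK; case: eqP => //= _; exact: cA.
    rewrite le_eqVlt; apply/orP; left; apply/eqP; congr w.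
    rewrite (bigD1 i0)//= eqxx scale0r add0r [in RHS](bigD1 i0)//= ci0 scale1r.
    rewrite addrAC subrr add0r; apply: eq_bigr => j ji0; by rewrite (negbTE ji0).
  move/le_trans => /(_ _ (abvB Hw _ _)).
  have := wc k; have := abvD Hw (b i0 (nn k) - b i0 N1) (b i0 N1).
  have := HN1 (nn k) N1 i0 (leq_trans N1N (leq_trans Nk (nk k))) (leqnn _).
  have : k.+1%:R^-1 <= 1 :> R by rewrite invf_le1// ler1n.
  rewrite subrK => h1 h2 h3 h4 h5.
  apply: (@le_trans _ _ ((2 + w (b i0 N1)) / delta)); last by rewrite /B lerDr.
  rewrite ler_pdivlMr// mulrC (le_trans h5)//.
  apply: le_trans (lerD (ltW h4) h3) _; rewrite addrA lerD2r.
  exact: le_trans (lerD h1 (ltW h2)) (lexx _).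
have small (eps : R) : 0 < eps -> exists M, (N <= M)%N /\
    forall k, (M <= k)%N -> k.+1%:R^-1 < eps /\
      forall m m', (M <= m)%N -> (M <= m')%N ->
      w (\sum_i c k i *: b i m - \sum_i c k i *: b i m') < eps.
  move=> eps0; pose eta := eps / (1 + d%:R * B).
  have dB : 0 <= d%:R * B by rewrite mulr_ge0// ltW.
  have dB1 : 0 < 1 + d%:R * B by lra.
  have eta0 : 0 < eta by rewrite divr_gt0.
  have [M1 HM1] := b_near eta0.
  have [M2 _ HM2] := near_infty_natSinv_lt (PosNum eps0).
  exists (maxn N (maxn M1 M2)); split=> [|k]; first exact: leq_maxl.
  rewrite !geq_max => /and3P[Nk M1k M2k]; split; first exact: HM2.
  move=> m m'; rewrite !geq_max => /and3P[_ M1m _] /and3P[_ M1m' _].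
  rewrite -sumrB; apply: le_lt_trans (abv_sum Hw _ _ _) _.
  apply: (@le_lt_trans _ _ (\sum_(i < d) B * eta)).
    apply: ler_sum => i _; rewrite -scalerBr vZ.
    apply: ler_pM; [exact: v0|exact: (abv_ge0 Hw)|idtac|]; first by apply: cB.
    by rewrite ltW// HM1.
  rewrite sumr_const card_ord -mulr_natl mulrA.
  have -> : eps = (1 + d%:R * B) * eta by rewrite /eta; field; rewrite gt_eqF.
  by rewrite ltr_pM2r// ltrDr ltr01.
(* The [i0]-th coefficients, all equal to 1, cancel in a difference, so the bound for [A :\ i0]
   applies to it. *)
have c_cauchy i : cauchy_for v (fun k => c k i).
  move=> eps eps0; have eps0' : 0 < delta * eps / 3.
    by rewrite divr_gt0// mulr_gt0.
  have [M [NM HM]] := small _ eps0'.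
  exists M => m n Mm Mn; have [m1 m2] := HM m Mm; have [n1 n2] := HM n Mn.
  have h : delta * v (c m i - c n i) <=
      w (\sum_i (c m i - c n i) *: b i (nn m)).
    apply: (H (nn m) (fun i => c m i - c n i)) => [|j].
      exact: leq_trans N0N (leq_trans NM (leq_trans Mm (nk m))).
    rewrite !inE negb_and negbK => /predU1P[->|jA]; first by rewrite !ci0 subrr.
    by rewrite !cA// subrr.
  have E : \sum_i (c m i - c n i) *: b i (nn m) =
      \sum_i c m i *: b i (nn m) - (\sum_i c n i *: b i (nn n) +
      (\sum_i c n i *: b i (nn m) - \sum_i c n i *: b i (nn n))).
    rewrite [X in _ - X]addrC subrK -sumrB.
    by apply: eq_bigr => j _; rewrite scalerBl.
  have := abvB Hw (\sum_i c m i *: b i (nn m)) (\sum_i c n i *: b i (nn n) +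
      (\sum_i c n i *: b i (nn m) - \sum_i c n i *: b i (nn n))).
  have := abvD Hw (\sum_i c n i *: b i (nn n))
      (\sum_i c n i *: b i (nn m) - \sum_i c n i *: b i (nn n)).
  rewrite -E => h1 h2.
  have := n2 (nn m) (nn n) (leq_trans Mm (nk m)) (leq_trans Mn (nk n)).
  have := wc m; have := wc n => h3 h4 h5.
  rewrite -(ltr_pM2l delta0); move: (lt_trans h3 n1) (lt_trans h4 m1) => *; lra.
have c_null : null_for w (fun k => \sum_i c k i *: b i k).
  apply/null_forP => [y|eps eps0]; first exact: abv_ge0.
  have eps0' : 0 < eps / 2 by lra.
  have [M [NM HM]] := small _ eps0'; exists M => k Mk.
  have [k1 k2] := HM k Mk; have := k2 k (nn k) Mk (leq_trans Mk (nk k)).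
  have := abvD Hw (\sum_i c k i *: b i k - \sum_i c k i *: b i (nn k))
    (\sum_i c k i *: b i (nn k)).
  have := lt_trans (wc k) k1; rewrite subrK; lra.
have := b_indep (c := fun i k => c k i) c_cauchy c_null i0.
move/(null_forP _ v0) => /(_ 1 ltr01)[M /(_ M (leqnn M))].
by rewrite ci0 (abv1 Hv) ltxx.
Qed.

(** This is the equivalence of norms on a finite dimensional space: dividing a combination by its
    i-th coefficient reduces the claim to coefficient 1, where [dist_lower] applies. *)
Lemma independent_lower_bound : exists (delta : R) (e : 'I_d -> K), 0 < delta /\
  forall (c : 'I_d -> rat) i, delta * v (c i) <= w (\sum_i c i *: e i).
Proof.
suff [delta [N [delta0 H]]] : lower [set: 'I_d]%SET.
  exists delta, (fun i => b i N); split => // c i.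
  by apply: H => // j; rewrite inE.
move: [set: 'I_d]%SET => A; move: {2}#|A| (leqnn #|A|) => n.
elim: n A => [|n IH] A.
  rewrite leqn0 cards_eq0 => /eqP ->; exists 1, 0%N; split => // m c _ c0 i.
  by rewrite c0 ?inE// (abv0 Hv) mulr0 abv_ge0.
move=> An.
have Hd i0 : exists deltaN : R * nat, i0 \in A -> 0 < deltaN.1 /\
    forall n (c : 'I_d -> rat), (deltaN.2 <= n)%N ->
    (forall i, i \notin A -> c i = 0) ->
    c i0 = 1 -> deltaN.1 <= w (\sum_i c i *: b i n).
  have [iA|iA] := boolP (i0 \in A); last by exists (0, 0%N).
  have [|delta [N [delta0 H]]] := @dist_lower A i0; last by exists (delta, N).
  by apply: IH; rewrite -ltnS (leq_trans _ An)// [X in (_ < X)%N](cardsD1 i0) iA.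
pose de i := (sval (cid (Hd i))).1; pose Nf i := (sval (cid (Hd i))).2.
have de0 i : i \in A -> 0 < de i by rewrite /de; case: cid => ? /= h /h[].
have HD i : i \in A -> forall n (c : 'I_d -> rat), (Nf i <= n)%N ->
    (forall i, i \notin A -> c i = 0) ->
    c i = 1 -> de i <= w (\sum_i c i *: b i n).
  by rewrite /de /Nf; case: cid => ? /= h /h[].
exists (\big[Num.min/1]_(i in A) de i), (\max_i Nf i); split.
  by elim/big_ind: _ => // x y x0 y0; rewrite lt_min x0.
move=> m c Nm cA i.
have [ci|ci] := eqVneq (c i) 0.
  by rewrite ci (abv0 Hv) mulr0 abv_ge0.
have iA : i \in A by apply: contraR ci => /cA ->.
have vi : 0 < v (c i) by rewrite (abv_gt0 Hv).
apply: (@le_trans _ _ (de i * v (c i))).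
  by rewrite ler_pM2r// (bigD1 i)//= ge_min lexx.
have -> : \sum_i c i *: b i m = c i *: \sum_j (c j / c i) *: b j m.
  by rewrite scaler_sumr; apply: eq_bigr => j _; rewrite scalerA; congr (_ *: _); field.
rewrite vZ mulrC ler_pM2l//; apply: (HD _ iA) => [|j /cA ->|].
- by apply: leq_trans Nm; exact: leq_bigmax.
- by rewrite mul0r.
- by rewrite divff.
Qed.

End NormEquivalence.

(* d elements of K that stay independent over Q_v in the completion at w *)
Definition locally_free (R : realType) (K : fieldExtType rat) (v : rat -> R)
    (w : K -> R) (d : nat) :=
  exists (delta : R) (e : 'I_d -> K), 0 < delta /\
  forall (c : 'I_d -> rat) i, delta * v (c i) <= w (\sum_i c i *: e i).

Lemma completion_basis_locally_free (R : realType) (K : fieldExtType rat)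
    (v : rat -> R) (w : K -> R) (d : nat) (b : 'I_d -> nat -> K) :
  extends v w -> completion_basis v w b -> locally_free v w d.
Proof. by move=> wv [b1 _ b2]; exact: independent_lower_bound b1 b2. Qed.

(** Where [local_degree] takes its default value 0 the claim concerns an empty family; otherwise the
    elements come from the basis that defines the degree. *)
Lemma local_degree_locally_free (R : realType) (K : fieldExtType rat)
    (v : rat -> R) (w : K -> R) : extends v w ->
  locally_free v w (local_degree v w).
Proof.
move=> wv; rewrite /local_degree.
case: xgetP => [d _ [b]|_]; first exact: completion_basis_locally_free.
by exists 1, (fun=> 0); split => // c [].
Qed.

Lemma sum_locally_free_le (R : realType) (K : fieldExtType rat)
    (v : rat -> R) (T : finType) (w : T -> K -> R) (d : T -> nat) :
  (exists c : rat, 1 < v c) -> (forall t, extends v (w t)) -> injective w ->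
  (forall t, locally_free v (w t) (d t)) -> (\sum_t d t <= \dim {:K})%N.
Proof.
move=> v1 wv winj H.
pose delta t := sval (cid (H t)); pose e t := sval (cid (svalP (cid (H t)))).
rewrite (reindex (@enum_val T predT)) /=; last exact: (onW_bij _ (@enum_val_bij T)).
have := @sum_local_dim_le R K v v1 _ (fun i => w (enum_val i)) _ _
  (fun i => d (enum_val i)) (fun i => e (enum_val i)) (fun i => delta (enum_val i)).
apply=> [i|i j|i|i c j]; first exact: wv.
- by move=> /winj/enum_val_inj.
- by rewrite /delta; case: cid => /= ? h; have [? []] := h.
- by rewrite /e /delta; case: (cid (H _)) => /= ? h; case: cid => /= ? [].
Qed.

(** * Primitive roots of unity and cyclotomic polynomials *)

Definition primitive_powers (F : fieldType) (z : F) n : seq F :=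
  [seq z ^+ k | k <- iota 0 n & coprime k n].

Lemma cyclotomicE (F : fieldType) (z : F) n :
  cyclotomic z n = \prod_(x <- primitive_powers z n) ('X - x%:P).
Proof.
rewrite /cyclotomic big_map big_filter.
rewrite -(big_mkord (fun k => coprime k n) (fun k => 'X - (z ^+ k)%:P)).
by rewrite /index_iota subn0.
Qed.

Lemma primitive_powers_uniq (F : fieldType) (z : F) n :
  n.-primitive_root z -> uniq (primitive_powers z n).
Proof.
move=> zn; rewrite map_inj_in_uniq ?filter_uniq ?iota_uniq// => i j.
rewrite !mem_filter !mem_iota !add0n /= => /andP[_ i_n] /andP[_ j_n] /eqP.
by rewrite (eq_prim_root_expr zn) !modn_small// => /eqP.
Qed.

Lemma size_primitive_powers (F : fieldType) (z : F) n :
  size (primitive_powers z n) = totient n.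
Proof.
have := size_cyclotomic z n.
by rewrite cyclotomicE size_prod_XsubC => -[].
Qed.

Lemma mem_primitive_powers (F : fieldType) (z x : F) n :
  n.-primitive_root z -> (x \in primitive_powers z n) = n.-primitive_root x.
Proof.
by move=> zn; rewrite -(root_cyclotomic zn) cyclotomicE root_prod_XsubC.
Qed.

(** A primitive n-th root x is a root of some factor ['Phi_d] of X^n - 1; then x^d = 1 and d = n.
    These roots are as many as the degree, which fixes the monic polynomial. The field is general
    since both [algC] and [R[i]] occur. *)
Lemma Cyclotomic_primitive (F : fieldType) n (z : F) :
  n.-primitive_root z -> map_poly intr 'Phi_n = cyclotomic z n.
Proof.
move=> zn; have n0 := prim_order_gt0 zn.
have Phi_root (x : F) : n.-primitive_root x -> root (map_poly intr 'Phi_n) x.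
  move=> xn; have := congr1 (fun p : {poly int} => (map_poly intr p : {poly F}).[x])
    (prod_Cyclotomic n0).
  rewrite rmorphB /= map_polyXn rmorph1 !hornerE (prim_expr_order xn) subrr.
  rewrite rmorph_prod horner_prod /= => /eqP; rewrite prodf_seq_eq0.
  move=> /hasP[d]; rewrite -dvdn_divisors// => dn /= xd.
  have d0 : (0 < d)%N by exact: dvdn_gt0 dn.
  suff -> : n = d by [].
  apply/eqP; rewrite eqn_dvd dn andbT (prim_order_dvd xn) -subr_eq0.
  have := congr1 (fun p : {poly int} => (map_poly intr p : {poly F}).[x])
    (prod_Cyclotomic d0).
  rewrite rmorphB /= map_polyXn rmorph1 !hornerE => <-.
  rewrite rmorph_prod horner_prod /= prodf_seq_eq0; apply/hasP; exists d => //.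
  by rewrite -dvdn_divisors.
rewrite [LHS](@all_roots_prod_XsubC _ _ (primitive_powers z n)).
- rewrite -cyclotomicE lead_coef_map_eq; last first.
    by rewrite (monicP (Cyclotomic_monic n)) oner_eq0.
  by rewrite /= (monicP (Cyclotomic_monic n)) mulr1z scale1r.
- rewrite size_map_poly_id0 ?size_Cyclotomic ?size_primitive_powers//.
  by rewrite (monicP (Cyclotomic_monic n)) rmorph1 oner_eq0.
- by apply/allP => x; rewrite mem_primitive_powers//; exact: Phi_root.
- by rewrite uniq_rootsE primitive_powers_uniq.
Qed.

Lemma dvdp_Cyclotomic_rat n (q : {poly rat}) (z : algC) : n.-primitive_root z ->
  root (map_poly ratr q) z -> map_poly intr 'Phi_n %| q.
Proof.
move=> zn; have [p [pE pm] pP] := minCpolyP z; rewrite pP => pq.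
suff -> : map_poly intr 'Phi_n = p by [].
apply: (map_poly_inj (ratr : {rmorphism rat -> algC})).
rewrite -pE (minCpoly_cyclotomic zn) -(Cyclotomic_primitive zn).
rewrite -map_poly_comp; apply: eq_map_poly => i /=; exact: ratr_int.
Qed.

(** A nonconstant divisor has a root in [algC], necessarily a primitive n-th root, whose minimal
    polynomial is the cyclotomic one. *)
Lemma irreducible_Cyclotomic n : (0 < n)%N ->
  irreducible_poly (map_poly intr 'Phi_n : {poly rat}).
Proof.
move=> n0; split.
  rewrite size_map_poly_id0 ?size_Cyclotomic ?ltnS ?totient_gt0//.
  by rewrite (monicP (Cyclotomic_monic n)) rmorph1 oner_eq0.
move=> q sq qP; have [w wn] := C_prim_root_exists n0.
have [z qz] : exists z : algC, root (map_poly ratr q) z.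
  by apply/closed_rootP; rewrite size_map_poly.
have zn : n.-primitive_root z.
  rewrite -(root_cyclotomic wn) -(Cyclotomic_primitive wn).
  have := qP; rewrite -(dvdp_map (ratr : {rmorphism rat -> algC})) => /dvdpP[u].
  rewrite -map_poly_comp (@eq_map_poly _ _ _ intr) => [|i /=]; last exact: ratr_int.
  by move=> ->; rewrite rootM qz orbT.
by rewrite /eqp qP (dvdp_Cyclotomic_rat zn).
Qed.

(** As long as q has a root, it shares it with the irreducible ['Phi_n] and is divisible by it; the
    quotient inherits the hypothesis. For the characteristic polynomial of a root of unity this
    means that its conjugates take each primitive value equally often. *)
Lemma rat_poly_primitive_roots (C : numClosedFieldType) n (z : C) (q : {poly rat}) :
  n.-primitive_root z -> q \is monic ->
  (forall x : C, root (map_poly ratr q) x -> n.-primitive_root x) ->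
  exists m, map_poly ratr q = cyclotomic z n ^+ m.
Proof.
move=> zn; have n0 := prim_order_gt0 zn.
have PhiE : map_poly ratr (map_poly intr 'Phi_n : {poly rat}) = cyclotomic z n.
  rewrite -(Cyclotomic_primitive zn) -map_poly_comp.
  apply: eq_map_poly => i /=; exact: ratr_int.
have Phim : (map_poly intr 'Phi_n : {poly rat}) \is monic.
  by rewrite monic_map// Cyclotomic_monic.
have [] := irreducible_Cyclotomic n0.
move: (map_poly intr 'Phi_n : {poly rat}) PhiE Phim => Phi PhiE Phim sP irr.
move: {2}(size q) (leqnn (size q)) => s; elim: s q => [|s IH] q.
  by rewrite leqn0 size_poly_eq0 => /eqP -> /monic_neq0; rewrite eqxx.
move=> qs qm qr.
have [q1|q1] := eqVneq (size q) 1%N.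
  exists 0%N; move: q1 => /eqP/size_poly1P[c c0 qE]; move: qm.
  by rewrite qE monicE lead_coefC => /eqP ->; rewrite rmorph1 expr0.
have [x qx] : exists x : C, root (map_poly ratr q) x.
  by apply/closed_rootP; rewrite size_map_poly.
have xn := qr x qx.
have Pq : Phi %| q.
  have g1 : size (gcdp Phi q) != 1%N.
    have -> : size (gcdp Phi q) = size (map_poly (ratr : rat -> C) (gcdp Phi q)).
      by rewrite size_map_poly.
    rewrite gcdp_map PhiE; apply/negP => /closed_rootP; apply; exists x.
    by rewrite root_gcd root_cyclotomic// xn.
  have := irr _ g1 (dvdp_gcdl _ _) => /eqp_dvdl <-; exact: dvdp_gcdr.
have [u qE] := dvdpP _ _ Pq.
have um : u \is monic by move: qm; rewrite qE monicMr.
have us : (size u <= s)%N.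
  move: qs; rewrite qE size_proper_mul; last first.
    by rewrite (monicP um) (monicP Phim) mulr1 oner_eq0.
  by move: (size Phi) (size u) sP => k l; lia.
have [x' ux|m um'] := IH u us um.
  by apply: qr; rewrite qE rmorphM rootM ux.
by exists m.+1; rewrite qE rmorphM /= um' PhiE exprSr.
Qed.

(** * Embeddings of a number field and characteristic polynomials *)

Section Embeddings.
Variables (K : fieldExtType rat) (C : numClosedFieldType).
Let n := \dim {:K}.

Lemma primitive_element_rat : exists theta : K, <<1; theta>>%VS = fullv.
Proof.
exists (separable_generator 1%AS {:K}%AS).
rewrite -eq_adjoin_separable_generator ?sub1v//.
by apply/separableP => y _; apply: pcharf0_separable => p; rewrite pchar_lalg pchar_num.
Qed.

Lemma rat_horner_generates (theta x : K) : <<1; theta>>%VS = fullv ->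
  exists q : {poly rat}, (map_poly (in_alg K) q).[theta] = x /\ (size q <= n)%N.
Proof.
move=> gen; have /polyOver1P[q qE] := Fadjoin_polyOver 1 theta x.
exists q; split; first by rewrite -qE Fadjoin_poly_eq// gen memvf.
rewrite -(size_map_poly (in_alg K)) -qE.
by rewrite /n -gen dim_Fadjoin dimv1 muln1 size_Fadjoin_poly.
Qed.

(** The map sends q(theta) to q(alpha); it is well defined because a polynomial vanishing at theta
    is a multiple of P. *)
Lemma embedding_of_root (theta : K) (P : {poly rat}) (alpha : C) :
  <<1; theta>>%VS = fullv -> map_poly (in_alg K) P = minPoly 1 theta ->
  root (map_poly ratr P) alpha ->
  exists sigma : {rmorphism K -> C}, sigma theta = alpha.
Proof.
move=> gen PE Pa.
have gen_ x := rat_horner_generates x gen.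
pose pq x := sval (cid (gen_ x)).
have pqE x : (map_poly (in_alg K) (pq x)).[theta] = x.
  by rewrite /pq; case: cid => ? [].
have key q : (map_poly (in_alg K) q).[theta] = 0 -> (map_poly ratr q).[alpha] = 0.
  move=> q0; have Pq : P %| q.
    rewrite -(dvdp_map (in_alg K)) PE minPoly_dvdp//; last exact/rootP.
    by apply/polyOver1P; exists q.
  have [u ->] := dvdpP _ _ Pq.
  by rewrite rmorphM /= hornerM (rootP Pa) mulr0.
have key2 q r : (map_poly (in_alg K) q).[theta] = (map_poly (in_alg K) r).[theta] ->
    (map_poly ratr q).[alpha] = (map_poly ratr r).[alpha].
  move=> qr; apply/eqP; rewrite -subr_eq0 -hornerN -hornerD -rmorphB /=.
  by rewrite key// rmorphB /= hornerD hornerN qr subrr.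
pose f x := (map_poly ratr (pq x)).[alpha].
have fB : {morph f : x y / x - y}.
  move=> x y; rewrite /f -hornerN -hornerD -rmorphB /=; apply: key2.
  by rewrite pqE rmorphB /= hornerD hornerN !pqE.
have fM : monoid_morphism f.
  split=> [|x y]; rewrite /f.
    have -> : (map_poly ratr (pq 1)).[alpha] = (map_poly ratr 1).[alpha].
      by apply: key2; rewrite pqE rmorph1 hornerC.
    by rewrite rmorph1 hornerC.
  rewrite -hornerM -rmorphM /=; apply: key2.
  by rewrite pqE rmorphM /= hornerM !pqE.
pose sigma : {rmorphism K -> C} := HB.pack f
  (GRing.isZmodMorphism.Build K C f fB) (GRing.isMonoidMorphism.Build K C f fM).
exists sigma; rewrite /= /f.
have -> : (map_poly ratr (pq theta)).[alpha] = (map_poly ratr 'X).[alpha].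
  by apply: key2; rewrite pqE map_polyX hornerX.
by rewrite map_polyX hornerX.
Qed.

(** In the last clause q is the characteristic polynomial of multiplication by x on the powers of
    theta. The Vandermonde matrix of the distinct values [sigma i theta] diagonalises this
    multiplication, with eigenvalues [sigma i x]. *)
Theorem number_field_embeddings :
  exists (theta : K) (sigma : 'I_n -> {rmorphism K -> C}),
  [/\ injective (fun i => sigma i theta),
      forall x, exists q : {poly rat},
        (map_poly (in_alg K) q).[theta] = x /\ (size q <= n)%N
    & forall x, exists2 q : {poly rat}, q \is monic &
        map_poly ratr q = \prod_i ('X - (sigma i x)%:P)].
Proof.
have [theta gen] := primitive_element_rat.
have /polyOver1P[P PE] := minPolyOver 1 theta.
have sP : size P = n.+1.
  rewrite -(size_map_poly (in_alg K)) -PE size_minPoly.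
  by rewrite /n -gen dim_Fadjoin dimv1 muln1.
have Psep : separable_poly P.
  rewrite -(separable_map (in_alg K)) -PE.
  by apply: pcharf0_separable => p; rewrite pchar_lalg pchar_num.
have [rs rsE] := closed_field_poly_normal (map_poly (ratr : rat -> C) P).
have P0 : P != 0 by rewrite -size_poly_eq0 sP.
have lc0 : lead_coef (map_poly (ratr : rat -> C) P) != 0.
  by rewrite lead_coef_eq0 map_poly_eq0.
have srs : size rs = n.
  have : size (map_poly (ratr : rat -> C) P) = n.+1 by rewrite size_map_poly.
  by rewrite rsE size_scale// size_prod_XsubC => -[].
have urs : uniq rs.
  rewrite -separable_prod_XsubC -(@eqp_separable _ (map_poly ratr P)).
    by rewrite separable_map.
  by rewrite {1}rsE; exact: eqp_scale.
have Hroot (i : 'I_n) : root (map_poly ratr P) rs`_i.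
  by rewrite rsE rootZ// root_prod_XsubC mem_nth// srs.
pose sigma i := sval (cid (embedding_of_root gen (esym PE) (Hroot i))).
have sigmaE i : sigma i theta = rs`_i by rewrite /sigma; case: cid.
have inj : injective (fun i => sigma i theta).
  move=> i j; rewrite !sigmaE => /eqP; rewrite nth_uniq ?srs//.
  by move=> /eqP/val_inj.
exists theta, sigma; split => // [x|x]; first exact: rat_horner_generates.
pose qp i := sval (cid (rat_horner_generates (x * theta ^+ i) gen)).
have qpE i : (map_poly (in_alg K) (qp i)).[theta] = x * theta ^+ i.
  by rewrite /qp; case: cid => ? [].
have qps i : (size (qp i) <= n)%N by rewrite /qp; case: cid => ? [].
pose M : 'M[rat]_n := \matrix_(i, j) (qp i)`_j.
exists (char_poly M); first exact: char_poly_monic.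
rewrite map_char_poly.
pose V := Vandermonde n (\row_j sigma j theta).
pose D := diag_mx (\row_j sigma j x).
have MV : map_mx ratr M *m V = V *m D.
  apply/matrixP => i j; rewrite mul_mx_diag !mxE.
  transitivity (sigma j (x * theta ^+ i)); last by rewrite rmorphM rmorphXn mulrC.
  rewrite -qpE (horner_coef_wide _ (n := n)) ?size_map_poly//.
  rewrite rmorph_sum; apply: eq_bigr => k _; rewrite !mxE coef_map rmorphM rmorphXn /=.
  by rewrite rmorphZ_num rmorph1 mulr1.
have detV : \det V != 0.
  rewrite det_Vandermonde; apply/prodf_neq0 => i _; apply/prodf_neq0 => j ij.
  by rewrite !mxE subr_eq0; apply: contraTneq ij => /inj ->; rewrite ltnn.
have -> : \prod_i ('X - (sigma i x)%:P) = char_poly D.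
  rewrite char_poly_trig; last exact/diag_mx_is_trig.
  by apply: eq_bigr => i _; rewrite !mxE eqxx mulr1n.
have VP0 : \det (map_mx polyC V) != 0 by rewrite det_map_mx polyC_eq0.
apply: (mulIf VP0); rewrite /char_poly -det_mulmx mulrC -det_mulmx; congr (\det _).
rewrite /char_poly_mx mulmxBl mulmxBr scalar_mxC; congr (_ - _).
by rewrite -!map_mxM MV.
Qed.

End Embeddings.
(** The polynomial q is an m-th power of the cyclotomic one, so the conjugates of x form m copies of
    the list of primitive n-th roots, and [\dim {:K} = m * totient n]. *)
Lemma sum_embeddings_primitive_root (R : numDomainType) (K : fieldExtType rat)
    (C : numClosedFieldType) (sigma : 'I_(\dim {:K}) -> {rmorphism K -> C})
    (x : K) (z : C) n (G : C -> R) :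
  (exists2 q : {poly rat}, q \is monic &
     map_poly ratr q = \prod_i ('X - (sigma i x)%:P)) ->
  n.-primitive_root x -> n.-primitive_root z ->
  (totient n)%:R * \sum_i G (sigma i x) =
  (\dim {:K})%:R * \sum_(y <- primitive_powers z n) G y.
Proof.
move=> [q qm qE] xn zn.
have [y|m mE] := rat_poly_primitive_roots zn qm.
  rewrite qE rootE horner_prod => /prodf_eq0[i _].
  rewrite hornerXsubC subr_eq0 => /eqP ->.
  by rewrite fmorph_primitive_root.
have /prod_XsubC_eq pe : \prod_(y <- [seq sigma i x | i <- enum 'I_(\dim {:K})])
    ('X - y%:P) = \prod_(y <- flatten (nseq m (primitive_powers z n))) ('X - y%:P).
  rewrite big_map big_enum /= -qE mE cyclotomicE.
  by elim: m {mE} => [|m IH]; rewrite ?big_nil ?expr0//= big_cat exprS IH.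
have szE : (\dim {:K} = m * totient n)%N.
  have := perm_size pe; rewrite size_map -cardE card_ord => ->.
  elim: m {mE pe} => [|m IH] //=; by rewrite size_cat IH size_primitive_powers mulSn.
have -> : \sum_i G (sigma i x) = m%:R * \sum_(y <- primitive_powers z n) G y.
  transitivity (\sum_(y <- [seq sigma i x | i <- enum 'I_(\dim {:K})]) G y).
    by rewrite big_map big_enum.
  rewrite (perm_big _ pe) /=.
  elim: m {mE pe szE} => [|m IH]; first by rewrite big_nil mul0r.
  by rewrite /= big_cat /= IH -natr1 mulrDl mul1r addrC.
by rewrite mulrA -natrM szE mulnC.
Qed.

(** * The complex absolute value and rational approximation *)

Lemma normc_absolute_value (R : realType) : absolute_value (@Normc.normc R).
Proof.
split=> [[a b]|x|x y|x y]; first exact: sqrtr_ge0.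
- by split=> [/Normc.eq0_normc//|->]; rewrite Normc.normc0.
- exact: Normc.normcM.
- exact: le_normcD.
Qed.

Lemma absolute_value_comp (R : realType) (E F : fieldType) (w : F -> R)
    (f : {rmorphism E -> F}) : absolute_value w -> absolute_value (w \o f).
Proof.
move=> Hw; split=> [x|x|x y|x y] /=; first exact: abv_ge0.
- split=> [/eqP|->]; last by rewrite rmorph0 abv0.
  by rewrite abv_eq0// fmorph_eq0 => /eqP.
- by rewrite rmorphM abvM.
- by rewrite rmorphD abvD.
Qed.

Section NormC.
Variable R : realType.
Implicit Types z : R[i].
Local Notation normc := (@Normc.normc R).

Lemma sqr_normc_ReIm z : normc z ^+ 2 = complex.Re z ^+ 2 + complex.Im z ^+ 2.
Proof. by case: z => a b; rewrite /= sqr_sqrtr// addr_ge0// sqr_ge0. Qed.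

Lemma normc_real (x : R) : normc x%:C%C = `|x|.
Proof. by rewrite /= expr0n addr0 sqrtr_sqr. Qed.

Lemma normc_ge_Re z : `|complex.Re z| <= normc z.
Proof.
rewrite -(ler_pXn2r (_ : 0 < 2)%N)//; last first.
  by rewrite nnegrE (abv_ge0 (@normc_absolute_value R)).
by rewrite sqr_normc_ReIm -normrX ger0_norm ?sqr_ge0// lerDl sqr_ge0.
Qed.

Lemma normc_ge_Im z : `|complex.Im z| <= normc z.
Proof.
rewrite -(ler_pXn2r (_ : 0 < 2)%N)//; last first.
  by rewrite nnegrE (abv_ge0 (@normc_absolute_value R)).
by rewrite sqr_normc_ReIm -normrX ger0_norm ?sqr_ge0// lerDr sqr_ge0.
Qed.

Lemma normc_conj z : normc z^*%C = normc z.
Proof. by case: z => a b; rewrite /= sqrrN. Qed.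

Lemma ratr_complex (q : rat) : ratr q = (ratr q : R)%:C%C :> R[i].
Proof. exact/esym/(fmorph_eq_rat (real_complex R \o ratr)). Qed.

Lemma normc_ratr (q : rat) : normc (ratr q) = `|ratr q|.
Proof. by rewrite ratr_complex normc_real. Qed.

Lemma embedding_extends (K : fieldExtType rat) (f : {rmorphism K -> R[i]}) :
  extends (rat_abs R None) (normc \o f).
Proof.
split; first exact/absolute_value_comp/normc_absolute_value.
move=> q; rewrite /= rmorphZ_num rmorph1 mulr1 normc_ratr.
by rewrite /rat_abs ratr_norm.
Qed.

End NormC.
Lemma rat_abs_None (R : realType) (q : rat) : rat_abs R None q = `|ratr q|.
Proof. by rewrite /rat_abs ratr_norm. Qed.

(** Coordinates of a Cauchy sequence of K are real numbers, while a basis of a completion asks for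
    Cauchy sequences of rationals; the error 1 / (n + 1) disappears in the limit. *)
Lemma cauchy_rat_approximation (R : realType) (s : nat -> R) :
  (forall eps, 0 < eps -> exists N, forall m n, (N <= m)%N -> (N <= n)%N ->
     `|s m - s n| < eps) ->
  exists c : nat -> rat, (forall n, `|s n - ratr (c n)| < n.+1%:R^-1) /\
    cauchy_for (rat_abs R None) c.
Proof.
move=> sc.
have Hq n : exists q : rat, `|s n - ratr q| < n.+1%:R^-1.
  have /rat_in_itvoo[q] : s n < s n + n.+1%:R^-1 by rewrite ltrDl invr_gt0.
  rewrite in_itv /= => /andP[q1 q2]; exists q.
  by rewrite distrC gtr0_norm ?subr_gt0// ltrBlDl.
exists (fun n => sval (cid (Hq n))); split=> [n|eps eps0]; first by case: cid.
have e3 : 0 < eps / 3 by lra.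
have [N HN] := sc _ e3.
have [M _ HM] := near_infty_natSinv_lt (PosNum e3).
exists (maxn N M) => m n; rewrite !geq_max => /andP[Nm Mm] /andP[Nn Mn].
rewrite rat_abs_None; case: cid => q1 /= h1; case: cid => q2 /= h2.
have := HN m n Nm Nn; have := lt_trans h1 (HM m Mm); have := lt_trans h2 (HM n Mn).
rewrite /= => k1 k2 k3; rewrite rmorphB /=.
have -> : ratr q1 - ratr q2 = - (s m - ratr q1) + (s m - s n) + (s n - ratr q2) :> R.
  by ring.
apply: le_lt_trans (ler_normD _ _) _.
have := ler_normD (- (s m - ratr q1)) (s m - s n); rewrite normrN; lra.
Qed.

Lemma locally_free_completion_basis (R : realType) (K : fieldExtType rat)
    (v : rat -> R) (w : K -> R) (d : nat) (delta : R) (e : 'I_d -> K) :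
  extends v w -> 0 < delta ->
  (forall (c : 'I_d -> rat) i, delta * v (c i) <= w (\sum_i c i *: e i)) ->
  (forall x, cauchy_for w x ->
     exists2 c : 'I_d -> nat -> rat, forall i, cauchy_for v (c i) &
       null_for w (fun n => x n - \sum_i c i n *: e i)) ->
  completion_basis v w (fun i _ => e i).
Proof.
move=> wv delta0 He spanning; have [Hw _] := wv; have Hv := extends_abv wv.
split=> [i eps eps0|//|c _ c0 i].
  by exists 0%N => m n _ _; rewrite subrr abv0.
apply/null_forP => [q|eps eps0]; first exact: abv_ge0.
have [|N HN] := (null_forP _ (abv_ge0 Hw)).1 c0 (delta * eps).
  by rewrite mulr_gt0.
exists N => n /HN h; rewrite -(ltr_pM2l delta0).
exact: le_lt_trans (He (fun i => c i n) i) h.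
Qed.

(** * Archimedean places *)

Section ArchimedeanPlaces.
Variables (R : realType) (K : fieldExtType rat).
Let n := \dim {:K}.
Variables (theta : K) (sigma : 'I_n -> {rmorphism K -> R[i]}).
Hypotheses (sigma_inj : injective (fun i => sigma i theta))
  (theta_gen : forall x, exists q : {poly rat},
     (map_poly (in_alg K) q).[theta] = x /\ (size q <= n)%N)
  (sigma_rat : forall x, exists2 q : {poly rat}, q \is monic &
     map_poly ratr q = \prod_i ('X - (sigma i x)%:P)).

Local Notation normc := (@Normc.normc R).
Local Notation vinf := (rat_abs R None).

Definition arch_abs (i : 'I_n) : K -> R := normc \o sigma i.

(** As theta generates K, the embedding is real exactly when the image of theta is real. *)
Definition arch_deg (i : 'I_n) : nat :=
  if complex.Im (sigma i theta) == 0 then 1%N else 2%N.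

Lemma arch_abs_extends i : extends vinf (arch_abs i).
Proof. exact: embedding_extends. Qed.

Let normcP : absolute_value normc := normc_absolute_value R.
Let Hw i : absolute_value (arch_abs i). Proof. by have [] := arch_abs_extends i. Qed.

Lemma embedding_ext (f g : {rmorphism K -> R[i]}) : f theta = g theta -> f =1 g.
Proof.
move=> fg x; have [q [<- _]] := theta_gen x.
have E (h : {rmorphism K -> R[i]}) :
    h (map_poly (in_alg K) q).[theta] = (map_poly ratr q).[h theta].
  rewrite -horner_map -map_poly_comp; congr (_.[_]); apply: eq_map_poly => a /=.
  by rewrite rmorphZ_num rmorph1 mulr1.
by rewrite !E fg.
Qed.

(** The absolute values of z and z - 1 determine the real part of z, and the imaginary part up to
    sign. *)
Lemma arch_abs_eq i j : arch_abs i = arch_abs j ->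
  sigma j theta = sigma i theta \/ sigma j theta = (sigma i theta)^*%C.
Proof.
move=> E.
have E0 : arch_abs i theta ^+ 2 = arch_abs j theta ^+ 2 by rewrite E.
have E1 : arch_abs i (theta - 1) ^+ 2 = arch_abs j (theta - 1) ^+ 2 by rewrite E.
move: E0 E1; rewrite /arch_abs /= !rmorphB !rmorph1 !sqr_normc_ReIm.
case: (sigma i theta) => a b; case: (sigma j theta) => c d.
rewrite /= => E0 E1.
have ac : a = c by rewrite !oppr0 !addr0 in E1; nra.
subst c.
have /eqP : (d - b) * (d + b) = 0 by nra.
rewrite mulf_eq0 subr_eq0 addr_eq0 => /orP[]/eqP ->; first by left.
by right.
Qed.

Lemma conj_embedding i : exists j, sigma j theta = (sigma i theta)^*%C.
Proof.
have [q _ qE] := sigma_rat theta.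
have : root (map_poly ratr q) (sigma i theta)^*%C.
  have -> : map_poly ratr q = map_poly conjc (map_poly ratr q) :> {poly R[i]}.
    rewrite -map_poly_comp; apply: eq_map_poly => a /=.
    by rewrite ratr_complex conjc_real.
  rewrite fmorph_root qE rootE horner_prod; apply/prodf_eq0; exists i => //.
  by rewrite hornerXsubC subrr.
rewrite qE rootE horner_prod => /prodf_eq0[j _].
by rewrite hornerXsubC subr_eq0 => /eqP ->; exists j.
Qed.

Lemma arch_abs_conj i j : sigma j theta = (sigma i theta)^*%C ->
  arch_abs j = arch_abs i.
Proof.
move=> E; apply/funext => x; rewrite /arch_abs /=.
have -> : sigma j x = (conjc \o sigma i) x by exact: embedding_ext.
by rewrite /= normc_conj.
Qed.

Lemma card_arch_abs_fiber i : #|[pred j | arch_abs j == arch_abs i]| = arch_deg i.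
Proof.
rewrite /arch_deg; case: eqP => [Im0|/eqP Im0].
  rewrite -(card1 i); apply: eq_card => j; rewrite !inE.
  apply/eqP/eqP => [/esym/arch_abs_eq|->//].
  suff -> : (sigma i theta)^*%C = sigma i theta by case=> /sigma_inj.
  by move: Im0; case: (sigma i theta) => a b /= ->; rewrite oppr0.
have [k kE] := conj_embedding i.
have ki : k != i.
  apply: contraNneq Im0 => ki; move: kE; rewrite ki.
  by case: (sigma i theta) => a b /= [] /eqP; rewrite -addr_eq0 -mulr2n mulrn_eq0.
have := card2 k i; rewrite ki => <-; apply: eq_card => j.
rewrite !inE; apply/eqP/orP => [/esym/arch_abs_eq[]|[]/eqP ->//].
- by move/sigma_inj => ->; right.
- by rewrite -kE => /sigma_inj ->; left.
- exact: arch_abs_conj.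
Qed.

Let lf_spanning i (d : nat) (delta : R) (e : 'I_d -> K) :=
  [/\ 0 < delta,
  forall (c : 'I_d -> rat) j, delta * vinf (c j) <= arch_abs i (\sum_j c j *: e j) &
  forall x, cauchy_for (arch_abs i) x ->
     exists2 c : 'I_d -> nat -> rat, forall j, cauchy_for vinf (c j) &
       null_for (arch_abs i) (fun k => x k - \sum_j c j k *: e j)].

Lemma cauchy_real (x : nat -> K) (i : 'I_n) (f : R[i] -> R) (B : R) : 0 < B ->
  (forall y z, `|f y - f z| <= B * normc (y - z)) ->
  cauchy_for (arch_abs i) x ->
  forall eps, 0 < eps -> exists N, forall m k, (N <= m)%N -> (N <= k)%N ->
     `|f (sigma i (x m)) - f (sigma i (x k))| < eps.
Proof.
move=> B0 fB xc eps eps0; have [|N HN] := xc (eps / B); first by rewrite divr_gt0.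
exists N => m k Nm Nk; apply: le_lt_trans (fB _ _) _.
have := HN m k Nm Nk; rewrite /arch_abs /= rmorphB ltr_pdivlMr// mulrC.
by [].
Qed.

Let real_basis i : complex.Im (sigma i theta) = 0 ->
  @lf_spanning i 1%N 1 (fun=> 1).
Proof.
move=> Im0.
have Imx x : complex.Im (sigma i x) = 0.
  have : (conjc \o sigma i) x = sigma i x.
    apply: embedding_ext => /=.
    by move: Im0; case: (sigma i theta) => a b /= ->; rewrite oppr0.
  rewrite /=; case: (sigma i x) => a b /= [] E.
  by apply/eqP; move: E => /eqP; rewrite eq_sym -addr_eq0 -mulr2n mulrn_eq0.
have absE x : arch_abs i x = `|complex.Re (sigma i x)|.
  have := Imx x; rewrite /arch_abs /=; case: (sigma i x) => a b /= ->.
  by rewrite expr0n addr0 sqrtr_sqr.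
split=> // [c j|x xc].
  rewrite big_ord1 (extendsZ _ _ (arch_abs_extends i)) (abv1 (Hw i)).
  by rewrite mul1r mulr1 (ord1 j).
have [|c [c1 c2]] := @cauchy_rat_approximation R (fun k => complex.Re (sigma i (x k))).
  apply: (cauchy_real (f := @complex.Re R) (B := 1)) xc => // y z.
  rewrite mul1r; apply: le_trans (normc_ge_Re _).
  by case: y z => [? ?] [].
exists (fun _ => c) => //; apply/null_forP => [y|eps eps0]; first exact: abv_ge0.
have [M _ HM] := near_infty_natSinv_lt (PosNum eps0).
exists M => k /HM /= kM; apply: le_lt_trans kM; rewrite absE big_ord1.
apply: le_trans (ltW (c1 k)); rewrite rmorphB rmorphZ_num rmorph1 mulr1.
by rewrite ratr_complex; case: (sigma i (x k)).
Qed.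

(** The image a + ib of theta is not real, so 1 and theta span the complex numbers over the reals.
    The coordinates of z are [f1] = Im z / b and [f0] = Re z - a Im z / b, both Lipschitz. *)
Let complex_basis i : complex.Im (sigma i theta) != 0 ->
  exists delta, @lf_spanning i 2 delta (fun j => theta ^+ j).
Proof.
move=> Im0.
pose a := complex.Re (sigma i theta); pose b := complex.Im (sigma i theta).
have tE : sigma i theta = (a +i* b)%C by rewrite /a /b; case: (sigma i theta).
have b0 : 0 < `|b| by rewrite normr_gt0.
have sE (q0 q1 : rat) : sigma i (q0 *: theta ^+ 0 + q1 *: theta ^+ 1) =
    ((ratr q0 + ratr q1 * a) +i* (ratr q1 * b))%C.
  rewrite expr0 expr1 rmorphD !rmorphZ_num rmorph1 mulr1 tE !ratr_complex /=.
  by apply/eqP; rewrite eq_complex /=; apply/andP; split; apply/eqP; ring.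
have sum2 (c : 'I_2 -> rat) : \sum_j c j *: theta ^+ j =
    c 0 *: theta ^+ 0 + c 1 *: theta ^+ 1.
  by rewrite big_ord_recl big_ord1; congr (_ + c _ *: _); exact: val_inj.
(* For y = r0 + r1 theta of absolute value N, the imaginary part gives |r1| <= N / |b| and the real
   part |r0| <= N + |a| N / |b|; B N dominates both. *)
pose B := 1 + (1 + `|a|) / `|b|.
have B0 : 1 <= B by rewrite lerDl divr_ge0// addr_ge0.
have bound (q0 q1 : rat) y : y = sigma i (q0 *: theta ^+ 0 + q1 *: theta ^+ 1) ->
    `|ratr q0| <= B * normc y /\ `|ratr q1| <= B * normc y.
  move=> yE; have := normc_ge_Re y; have := normc_ge_Im y.
  rewrite yE sE [complex.Re _]/= [complex.Im _]/= -sE -yE.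
  rewrite normrM; move: (ratr q0) (ratr q1) => r0 r1 h1 h2; set N := normc y in h1 h2 *.
  have h1' : `|r1| <= N / `|b| by rewrite ler_pdivlMr.
  have N0 : 0 <= N by exact: abv_ge0.
  have BN : B * N = N + N / `|b| + `|a| * (N / `|b|).
    by rewrite /B; field; rewrite gt_eqF.
  have Nb : 0 <= N / `|b| by rewrite divr_ge0.
  have aNb : 0 <= `|a| * (N / `|b|) by rewrite mulr_ge0.
  split; last by rewrite BN; lra.
  have := ler_normB (r0 + r1 * a) (r1 * a); rewrite addrK normrM.
  have : `|r1| * `|a| <= `|a| * (N / `|b|) by rewrite mulrC ler_wpM2l.
  rewrite BN; lra.
exists B^-1; split=> [|c j|x xc].
- by rewrite invr_gt0; lra.
- rewrite rat_abs_None mulrC ler_pdivrMr; last lra.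
  rewrite mulrC sum2; have [] := bound (c 0) (c 1) _ erefl.
  have [->|->] : j = 0 \/ j = 1.
    by case: j => -[|[|]]//= ?; [left|right]; exact: val_inj.
  + by [].
  + by [].
have bB : 1 / `|b| <= B.
  have : 0 <= `|a| / `|b| by rewrite divr_ge0.
  by rewrite /B mulrDl; lra.
pose f1 (z : R[i]) := complex.Im z / b; pose f0 z := complex.Re z - f1 z * a.
have f1B y z : `|f1 y - f1 z| <= B * normc (y - z).
  rewrite /f1 -mulrBl normrM normfV mulrC ler_pM ?invr_ge0//.
    by rewrite -[leLHS]mul1r.
  by apply: le_trans (normc_ge_Im _); case: y z => [? ?] [].
have f0B y z : `|f0 y - f0 z| <= (1 + B * `|a|) * normc (y - z).
  rewrite /f0; set u := f1 y; set u' := f1 z.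
  have -> : complex.Re y - u * a - (complex.Re z - u' * a) =
    (complex.Re y - complex.Re z) - (u - u') * a by ring.
  apply: (@le_trans _ _ (`|complex.Re y - complex.Re z| + `|(u - u') * a|)).
    exact: ler_normB.
  rewrite [leRHS]mulrDl mul1r lerD//.
    by apply: le_trans (normc_ge_Re _); case: y z {u u'} => [? ?] [].
  by rewrite normrM mulrAC ler_wpM2r// f1B.
have B0' : 0 < B by lra.
have Ba : 0 < 1 + B * `|a| by rewrite ltr_pwDl// mulr_ge0// ltW.
have [c0 [c01 c02]] := cauchy_rat_approximation (cauchy_real Ba f0B xc).
have [c1 [c11 c12]] := cauchy_rat_approximation (cauchy_real B0' f1B xc).
exists (fun j : 'I_2 => if j == 0 then c0 else c1) => [j|].
  by case: ifP.
apply/null_forP => [y|eps eps0]; first exact: abv_ge0.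
pose D := 1 + normc (sigma i theta).
have D0 : 0 < D by rewrite ltr_pwDl// abv_ge0.
have eps0' : 0 < eps / D by rewrite divr_gt0.
have [M _ HM] := near_infty_natSinv_lt (PosNum eps0').
exists M => k /HM /= kM; rewrite sum2 /=.
have -> : arch_abs i (x k - (c0 k *: theta ^+ 0 + c1 k *: theta ^+ 1)) =
  normc ((f0 (sigma i (x k)) - ratr (c0 k))%:C%C +
         (f1 (sigma i (x k)) - ratr (c1 k))%:C%C * sigma i theta).
  rewrite /arch_abs /= rmorphB sE tE /f0 /f1; congr normc.
  case: (sigma i (x k)) => u u'; apply/eqP; rewrite eq_complex /=.
  by apply/andP; split; apply/eqP; field.
apply: le_lt_trans (abvD normcP _ _) _; rewrite (abvM normcP) !normc_real.
have h0 := lt_trans (c01 k) kM; have h1 := lt_trans (c11 k) kM.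
have -> : eps = eps / D + eps / D * normc (sigma i theta).
  by rewrite -[X in X + _]mulr1 -mulrDr -/D divfK// gt_eqF.
by apply: ltr_leD => //; rewrite ler_wpM2r ?abv_ge0// ltW.
Qed.

Lemma arch_locally_free i : locally_free vinf (arch_abs i) (arch_deg i).
Proof.
rewrite /arch_deg; case: eqP => [/real_basis[]|/eqP/complex_basis[delta []]].
  by move=> d0 H _; exists 1, (fun=> 1).
by move=> d0 H _; exists delta, (fun j => theta ^+ j).
Qed.

Lemma arch_completion_basis i : exists b, @completion_basis R K vinf
  (arch_abs i) (arch_deg i) b.
Proof.
rewrite /arch_deg; case: eqP => [/real_basis[]|/eqP/complex_basis[delta []]].
  move=> d0 H1 H2; exists (fun _ _ => 1).
  exact: locally_free_completion_basis (arch_abs_extends i) d0 H1 H2.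
move=> d0 H1 H2; exists (fun j _ => theta ^+ j).
exact: locally_free_completion_basis (arch_abs_extends i) d0 H1 H2.
Qed.

(** Conjugate embeddings define the same place; the one with the smaller index represents it. *)
Definition arch_rep (i : 'I_n) : bool :=
  [forall j : 'I_n, (j < i)%N ==> (arch_abs j != arch_abs i)].

Lemma arch_rep_inj i j : arch_rep i -> arch_rep j ->
  arch_abs i = arch_abs j -> i = j.
Proof.
move=> /forallP ri /forallP rj E; apply: val_inj.
have [ij|ji|//] := ltngtP (val i) (val j).
  by have := rj i; rewrite ij E eqxx.
by have := ri j; rewrite ji E eqxx.
Qed.

Lemma arch_rep_exists i : exists2 j, arch_rep j & arch_abs j = arch_abs i.
Proof.
have [j /eqP ji jmin] := @arg_minnP _ i (fun j => arch_abs j == arch_abs i)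
  (@nat_of_ord n) (eqxx _).
exists j => //; apply/forallP => k; apply/implyP => kj.
by apply: contraL kj => /eqP E; rewrite -leqNgt jmin// E ji.
Qed.

(** The degree of a place is the number of embeddings inducing it, so a sum over places weighted by
    degrees is a plain sum over embeddings. *)
Lemma sum_arch_rep (V : nmodType) (F : (K -> R) -> V) :
  \sum_(i | arch_rep i) F (arch_abs i) *+ arch_deg i = \sum_i F (arch_abs i).
Proof.
pose p i := sval (cid2 (arch_rep_exists i)).
have pr i : arch_rep (p i) by rewrite /p; case: cid2.
have pE i : arch_abs (p i) = arch_abs i by rewrite /p; case: cid2.
rewrite [RHS](partition_big p arch_rep)/=; last by move=> *; exact: pr.
apply: eq_bigr => i ri; rewrite -card_arch_abs_fiber -sumr_const.
have pi j : (p j == i) = (arch_abs j == arch_abs i).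
  apply/eqP/eqP => [<-|E]; first by rewrite pE.
  by apply: arch_rep_inj => //; rewrite pE E.
rewrite [RHS](eq_bigl (fun j => arch_abs j == arch_abs i)); last by move=> j; rewrite pi.
by apply: eq_big => [j|j /eqP ->//]; rewrite ?inE.
Qed.

Lemma sum_arch_deg : (\sum_(i | arch_rep i) arch_deg i = n)%N.
Proof.
transitivity (\sum_(i | arch_rep i) (1%N : nat) *+ arch_deg i).
  by apply: eq_bigr => i _; rewrite natn.
rewrite (sum_arch_rep (fun=> 1%N)) sumr_const card_ord; exact: natn.
Qed.

Let vinf_nontrivial : exists c : rat, 1 < vinf c.
Proof. by exists 2%:R; rewrite rat_abs_None ratr_nat normr_nat ltr1n. Qed.

Let T : finType := {i : 'I_n | arch_rep i}.

Let sum_T (F : 'I_n -> nat) : (\sum_(t : T) F (val t) = \sum_(i | arch_rep i) F i)%N.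
Proof.
rewrite (reindex_omap (fun t : T => val t) insub) /=; last first.
  by move=> i ri; rewrite insubT.
by apply: eq_bigl => t; rewrite valK eqxx andbT; case: t.
Qed.

(* A further place would contribute a further dimension to K (x) R. *)
Lemma archimedean_places w : extends vinf w -> exists i, w = arch_abs i.
Proof.
move=> ew; apply: contrapT => wN.
have := @sum_locally_free_le R K vinf (option T)
  (fun t => if t is Some i then arch_abs (val i) else w)
  (fun t => if t is Some i then arch_deg (val i) else 1%N) vinf_nontrivial.
rewrite (bigD1 None)//= (reindex_omap Some id) /=; last by case.
rewrite (eq_bigl xpredT); last by move=> t; rewrite eqxx.
rewrite (sum_T arch_deg) sum_arch_deg ltnn => H; suff : false by [].
apply: H => [[t|]|[s|] [t|]|[t|]] //=.
- exact: arch_abs_extends.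
- by move=> /(arch_rep_inj (valP s) (valP t)) E; congr Some; apply: val_inj.
- by move=> E; exfalso; apply: wN; exists (val s).
- by move=> E; exfalso; apply: wN; exists (val t).
- exact: arch_locally_free.
- exists 1, (fun=> 1); split => // c i.
  rewrite big_ord1 (extendsZ _ _ ew); have [Hw' _] := ew.
  by rewrite abv1// mul1r mulr1 (ord1 i).
Qed.

(** The degrees of the places already fill [\dim {:K}], which leaves no room for a larger
    independent family at one of them. *)
Let completion_basis_dim_le i (d : nat) (b : 'I_d -> nat -> K) : arch_rep i ->
  completion_basis vinf (arch_abs i) b -> (d <= arch_deg i)%N.
Proof.
move=> ri bb.
have := @sum_locally_free_le R K vinf T (fun t => arch_abs (val t))
  (fun t => if val t == i then d else arch_deg (val t)) vinf_nontrivial.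
rewrite (sum_T (fun j => if j == i then d else arch_deg j)) (bigD1 i)//= eqxx.
rewrite (eq_bigr arch_deg); last by move=> j /andP[_ /negbTE ->].
move=> H; have := sum_arch_deg; rewrite (bigD1 i)//= => nE.
rewrite -(leq_add2r (\sum_(j | arch_rep j && (j != i)) arch_deg j)) nE.
apply: H => [t|s t|t]; first exact: arch_abs_extends.
- by move=> /(arch_rep_inj (valP s) (valP t)) E; apply: val_inj.
- case: eqP => [->|_]; last exact: arch_locally_free.
  exact: completion_basis_locally_free (arch_abs_extends i) bb.
Qed.

(** An empty basis would make 1 null. A single y at a complex place would give 1 near q y and theta
    near q' y, and q' - q theta = q' (1 - q y) - q (theta - q' y) would be too small for the
    independence of 1 and theta. *)
Let completion_basis_dim_ge i (d : nat) (b : 'I_d -> nat -> K) :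
  completion_basis vinf (arch_abs i) b -> (arch_deg i <= d)%N.
Proof.
case=> b1 b2 b3; rewrite leqNgt; apply/negP => dlt.
have cst y : cauchy_for (arch_abs i) (fun=> y).
  by move=> eps eps0; exists 0%N => *; rewrite subrr abv0.
have aZ q x := extendsZ q x (arch_abs_extends i).
case: d b b1 b2 b3 dlt => [|[|d]] b b1 b2 b3 dlt.
- have [c _ /(null_forP _ (abv_ge0 (Hw i)))] := b2 _ (cst 1).
  move=> /(_ 1 ltr01)[N /(_ N (leqnn N))].
  by rewrite big_ord0 subr0 (abv1 (Hw i)) ltxx.
- have Im0 : complex.Im (sigma i theta) != 0.
    by apply: contraTneq dlt => E; rewrite /arch_deg E eqxx.
  have [delta [d0 H _]] := complex_basis Im0.
  have [c c1 /(null_forP _ (abv_ge0 (Hw i))) c2] := b2 _ (cst 1).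
  have [c' c1' /(null_forP _ (abv_ge0 (Hw i))) c2'] := b2 _ (cst theta).
  (* Errors below [delta / 2] are compatible with the two lower bounds only if q = 0; the error
     below 1 then excludes q = 0. *)
  pose eps := Num.min 1 (delta / 2).
  have eps0 : 0 < eps by rewrite lt_min ltr01; lra.
  have [N1 HN1] := c2 _ eps0; have [N2 HN2] := c2' _ eps0.
  pose k := maxn N1 N2.
  have := HN1 k (leq_maxl _ _); have := HN2 k (leq_maxr _ _).
  rewrite !big_ord1 !lt_min; set y := b ord0 k; set q := c ord0 k; set q' := c' ord0 k.
  move=> /andP[_ h2] /andP[h3 h1].
  have := H (fun j => if j == 0 then q' else - q).
  rewrite big_ord_recl big_ord1 /= expr0 expr1 => low.
  have v0 r : 0 <= vinf r by rewrite rat_abs_None.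
  have up : arch_abs i (q' *: 1 + - q *: theta) <=
      vinf q' * arch_abs i (1 - q *: y) + vinf q * arch_abs i (theta - q' *: y).
    rewrite -!aZ; have -> : q' *: 1 + - q *: theta =
        q' *: (1 - q *: y) - q *: (theta - q' *: y).
      rewrite !scalerBr !scalerA [q * q']mulrC scaleNr.
      by rewrite opprB addrA subrK.
    exact: abvB.
  have l0 : delta * vinf q' <= _ := low 0.
  have l1 : delta * vinf (- q) <= _ := low 1.
  have vN : vinf (- q) = vinf q by rewrite !rat_abs_None rmorphN normrN.
  rewrite vN in l1.
  have vq : vinf q = 0.
    apply/eqP; rewrite eq_le v0 andbT.
    have := ler_wpM2l (v0 q') (ltW h1); have := ler_wpM2l (v0 q) (ltW h2).
    have := le_trans l0 up; have := le_trans l1 up => k1 k2 k3 k4.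
    have : delta * vinf q <= 0 by have := v0 q'; nra.
    by rewrite pmulr_rle0.
  move: h3.
  have q0 : q = 0.
    move: vq; rewrite rat_abs_None => /eqP; rewrite normr_eq0 fmorph_eq0.
    by move/eqP.
  by rewrite q0 scale0r subr0 (abv1 (Hw i)) ltxx.
- by move: dlt; rewrite /arch_deg; case: ifP.
Qed.

Lemma local_degree_arch i : arch_rep i ->
  local_degree vinf (arch_abs i) = arch_deg i.
Proof.
move=> ri; rewrite /local_degree; have [b bb] := arch_completion_basis i.
case: xgetP => [d _ [b' bb']|/(_ (arch_deg i))]; last by case; exists b.
apply/eqP; rewrite eqn_leq (completion_basis_dim_le ri bb').
exact: completion_basis_dim_ge bb'.
Qed.

Lemma sum_archimedean_places (F : (K -> R) -> R) :
  \sum_(w \in @places_above R K None) (local_degree vinf w)%:R / n%:R * F w =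
  n%:R^-1 * \sum_i F (arch_abs i).
Proof.
pose s := [seq arch_abs i | i <- enum 'I_n & arch_rep i].
have us : uniq s.
  rewrite map_inj_in_uniq => [|i j]; first by apply: filter_uniq; exact: enum_uniq.
  by rewrite !mem_filter => /andP[ri _] /andP[rj _]; exact: arch_rep_inj.
have -> : @places_above R K None = [set` s].
  apply/seteqP; split => w /=.
    move=> /archimedean_places[i ->]; have [j rj <-] := arch_rep_exists i.
    by apply/mapP; exists j => //; rewrite mem_filter rj mem_enum.
  by move=> /mapP[i _ ->]; exact: arch_abs_extends.
rewrite -fsbig_seq// big_map big_filter big_enum_cond /= -sum_arch_rep mulr_sumr.
apply: eq_bigr => i ri; rewrite local_degree_arch// -mulr_natr; ring.
Qed.

End ArchimedeanPlaces.

(** * Finite places and the non-Archimedean part of the height *)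

(** A sum over a set is by definition a sum over its finite support, so bounds valid for every
    duplicate-free sequence of places carry over to the sum over all places above p. *)
Lemma fsbig_as_seq (T : choiceType) (V : nmodType) (A : set T) (F : T -> V) :
  exists s : seq T, [/\ uniq s, forall t, t \in s -> A t &
    \sum_(t \in A) F t = \sum_(t <- s) F t].
Proof.
exists (finite_support 0 A F); split => //.
  by move=> t; case: finite_supportP => // X XA _ _ Xt; exact: XA.
Qed.

Lemma sum_local_degree_le (R : realType) (K : fieldExtType rat) (v : rat -> R)
    (s : seq (K -> R)) : (exists c : rat, 1 < v c) -> uniq s ->
  (forall w, w \in s -> extends v w) ->
  (\sum_(w <- s) local_degree v w <= \dim {:K})%N.
Proof.
move=> v1 us sv; rewrite (big_nth (fun=> 0)) big_mkord.
have ext (i : 'I_(size s)) : extends v s`_i by apply: sv; exact: mem_nth.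
apply: (sum_locally_free_le v1 ext) => [i j|i].
  by move=> /eqP; rewrite nth_uniq// => /eqP/val_inj.
exact: local_degree_locally_free.
Qed.

(** Both sides are the value of (X^n - 1) / (X - 1) at 1. *)
Lemma prod_1_sub_primitive (F : fieldType) n (s : F) : n.-primitive_root s ->
  \prod_(1 <= k < n) (1 - s ^+ k) = n%:R.
Proof.
move=> sn; have n0 := prim_order_gt0 sn.
have X0 : 'X - 1 != 0 :> {poly F} by rewrite -size_poly_eq0 size_XsubC.
have E : \prod_(1 <= k < n) ('X - (s ^+ k)%:P) = \sum_(i < n) 'X^i.
  apply: (mulfI X0); rewrite -subrX1 -(factor_Xn_sub_1 sn).
  by rewrite [in RHS]big_ltn// expr0.
have := congr1 (fun p => p.[1]) E; rewrite horner_prod horner_sum.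
under eq_bigr do rewrite hornerXsubC.
by move=> ->; under eq_bigr do rewrite hornerXn expr1n; rewrite sumr_const card_ord.
Qed.

Lemma padic_abs_nat (R : realType) p m : (0 < m)%N ->
  padic_abs R p m%:R = (p ^ logn p m)%:R^-1.
Proof.
move=> m0; rewrite /padic_abs pnatr_eq0 -[m == 0%N]negbK -lt0n m0 /=.
have -> : (m%:R : rat) = m%:~R by [].
rewrite numq_int denq_int /= logn1 sub0r natrX.
by rewrite -exprnN.
Qed.

Lemma padic_abs_inv_gt1 (R : realType) p : prime p -> 1 < padic_abs R p p%:R^-1.
Proof.
move=> pp; have p0 := prime_gt0 pp.
have pE : (p%:R^-1 : rat) = 1%:~R / p%:~R by rewrite mul1r.
rewrite /padic_abs invr_eq0 pnatr_eq0 gtn_eqF//= pE.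
rewrite coprimeq_num ?coprimeq_den ?coprime1n//.
have -> : (p%:Z == 0) = false by rewrite gt_eqF// ltz_nat.
have -> : absz (Num.norm p%:Z) = p by rewrite ger0_norm.
rewrite mulr1 gtr0_sg ?ltz_nat// logn_prime// eqxx.
by rewrite logn1 subr0 -exprnP expr1 ltr1n prime_gt1.
Qed.

Section FinitePlace.
Variables (R : realType) (K : fieldExtType rat) (p : nat) (w : K -> R).
Hypotheses (p_prime : prime p) (w_ext : extends (rat_abs R (Some p)) w).

Let Hw : absolute_value w. Proof. by case: w_ext. Qed.

Lemma finite_abs_nat_le1 m : w m%:R <= 1.
Proof.
have [->|m0] := posnP m; first by rewrite abv0.
have -> : m%:R = m%:R%:A :> K by rewrite scaler_nat.
have [_ ->] := w_ext; rewrite /= padic_abs_nat//.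
by rewrite invf_le1 ?ler1n ?ltr0n ?expn_gt0 ?prime_gt0.
Qed.

(** An absolute value is only assumed to satisfy the triangle inequality. Since integers have value
    at most 1, the binomial expansion bounds [w (x + y) ^+ m] by m + 1, which excludes exponential
    growth. *)
Lemma finite_absD_le1 x y : w x <= 1 -> w y <= 1 -> w (x + y) <= 1.
Proof.
move=> x1 y1; rewrite leNgt; apply/negP => xy1.
have bound m : w (x + y) ^+ m <= m.+1%:R.
  rewrite -abvX// exprDn; apply: le_trans (abv_sum Hw _ _ _) _.
  have -> : m.+1%:R = \sum_(i < m.+1) 1 :> R by rewrite sumr_const card_ord.
  apply: ler_sum => i _.
  rewrite -mulr_natl (abvM Hw) (abvM Hw) !(abvX Hw).
  by rewrite mulr_ile1 ?mulr_ge0 ?exprn_ge0 ?abv_ge0 ?finite_abs_nat_le1//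
    mulr_ile1 ?exprn_ge0 ?exprn_ile1 ?abv_ge0.
(* The exponent will be k^2: from [4 < w (x + y) ^+ k] its power is at least 4^k, which exceeds k^2
   + 1. *)
have [k _ /(_ k (leqnn k)) /= Hk] := archimedean_power 4 xy1.
have k4 : (k ^ 2).+1%:R < 4 ^+ k :> R.
  have k0 : (0 < k)%N.
    by rewrite lt0n; apply: contraTneq Hk => ->; rewrite expr0 -leNgt ler1n.
  have : (k < 2 ^ k)%N by exact: ltn_expl.
  rewrite -natrX ltr_nat -[4%N]/(2 ^ 2)%N -expnM mulnC expnM -!mulnn.
  by move: (2 ^ k)%N => l; nia.
have := bound (k ^ 2)%N; rewrite leNgt => /negP; apply; apply: lt_le_trans k4 _.
rewrite expnS expn1 exprM; apply: lerXn2r; rewrite ?nnegrE//; last exact: ltW.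
exact/exprn_ge0/abv_ge0.
Qed.

Lemma finite_absB_le1 x y : w x <= 1 -> w y <= 1 -> w (x - y) <= 1.
Proof. by move=> *; apply: finite_absD_le1; rewrite ?abvN. Qed.

(** The product of the 1 - s^k for 0 < k < n is n. Each factor is a multiple of 1 - s by a sum of
    roots of unity, hence at most |1 - s|; this is used for the phi(n) exponents coprime to n, and
    the bound 1 for the others. *)
Lemma finite_abs_primitive n (s : K) : (1 < n)%N -> n.-primitive_root s ->
  (p ^ logn p n)%:R^-1 <= w (1 - s) ^+ totient n.
Proof.
move=> n1 sn; have n0 : (0 < n)%N by exact: ltnW.
have ws : w s = 1 by apply: (abv_root1 Hw n0); exact: prim_expr_order.
have wsk k : w (s ^+ k) = 1 by rewrite abvX// ws expr1n.
have w1 : w (1 - s) <= 1 by apply: finite_absB_le1; rewrite ?ws ?abv1.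
have wk k : w (1 - s ^+ k) <= w (1 - s).
  have -> : 1 - s ^+ k = (1 - s) * \sum_(i < k) s ^+ i.
    by apply: oppr_inj; rewrite -mulNr !opprB subrX1.
  rewrite abvM// ler_piMr ?abv_ge0//.
  elim/big_ind: _ => [|x y|i _]; [by rewrite abv0|exact: finite_absD_le1|].
  by rewrite wsk.
have -> : (p ^ logn p n)%:R^-1 = w n%:R.
  have -> : n%:R = n%:R%:A :> K by rewrite scaler_nat.
  by have [_ ->] := w_ext; rewrite /= padic_abs_nat.
rewrite -(prod_1_sub_primitive sn) abv_prod//.
have -> : totient n = (\sum_(1 <= k < n) (coprime n k : nat))%N.
  by rewrite totient_count_coprime big_ltn// /coprime gcdn0 gtn_eqF.
rewrite -prodrXr; apply: ler_prod => k _; rewrite abv_ge0//=.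
by case: (coprime n k); rewrite /= ?expr1 ?expr0// (le_trans (wk k)).
Qed.

End FinitePlace.

Lemma sum_local_degree_frac_le1 (R : realType) (K : fieldExtType rat) (v : rat -> R)
    (s : seq (K -> R)) : (exists c : rat, 1 < v c) -> uniq s ->
  (forall w, w \in s -> extends v w) ->
  \sum_(w <- s) (local_degree v w)%:R / (\dim {:K})%:R <= 1 :> R.
Proof.
move=> v1 us sv; rewrite -mulr_suml -natr_sum.
have n0 : (0 < \dim {:K})%N by rewrite adim_gt0.
rewrite ler_pdivrMr ?ltr0n// mul1r ler_nat; exact: sum_local_degree_le.
Qed.

(* Every finite place v | p contributes at most log |n|_p / phi(n). *)
Lemma height_over_torsion (R : realType) (K : fieldExtType rat) m
    (y : 'rV[K]_m.+1) n (s : K) i0 :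
  (1 < n)%N -> n.-primitive_root s ->
  (forall p w, prime p -> extends (rat_abs R (Some p)) w -> w (y 0 i0) = w (1 - s)) ->
  (forall p w, prime p -> extends (rat_abs R (Some p)) w -> forall i, w (y 0 i) <= 1) ->
  exists T : R, - (ln n%:R / (totient n)%:R) <= T <= 0 /\
    height_over R y = \sum_(w \in @places_above R K None)
      (local_degree (rat_abs R None) w)%:R / (\dim {:K})%:R
      * ln (\big[Num.max/0]_(i < m.+1) w (y 0 i)) + T.
Proof.
move=> n1 sn yi0 y1; have n0 : (0 < n)%N by exact: ltnW.
have s1 : 1 - s != 0.
  rewrite subr_eq0; apply: contraTneq n1 => s1.
  by have := prim_order_dvd sn 1; rewrite expr1 -s1 eqxx dvdn1 => /eqP ->.
have phi0 : 0 < (totient n)%:R :> R by rewrite ltr0n totient_gt0.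
pose F v := \sum_(w \in @places_above R K v)
      (local_degree (rat_abs R v) w)%:R / (\dim {:K})%:R
      * ln (\big[Num.max/0]_(i < m.+1) w (y 0 i)).
have Fp p : prime p ->
    - (ln ((p ^ logn p n)%:R : R) / (totient n)%:R) <= F (Some p) <= 0.
  move=> pp; have pn0 : (0 < p ^ logn p n)%N by rewrite expn_gt0 prime_gt0.
  rewrite /F; have [S [uS SA ->]] := fsbig_as_seq (@places_above R K (Some p))
    (fun w => (local_degree (rat_abs R (Some p)) w)%:R / (\dim {:K})%:R
      * ln (\big[Num.max/0]_(i < m.+1) w (y 0 i))).
  have nt : exists c : rat, 1 < rat_abs R (Some p) c.
    by exists p%:R^-1; exact: padic_abs_inv_gt1.
  set L := ln _ / _.
  have L0 : 0 <= L.
    by rewrite divr_ge0 ?(ltW phi0)// ln_ge0// ler1n.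
  have lnb w : w \in S -> - L <= ln (\big[Num.max/0]_(i < m.+1) w (y 0 i)) <= 0.
    move=> /SA ew; have [Hw _] := ew.
    have w0 : 0 < w (1 - s) by rewrite (abv_gt0 Hw).
    have low : w (1 - s) <= \big[Num.max/0]_(i < m.+1) w (y 0 i).
      by rewrite (bigD1 i0)//= (yi0 p)// le_max lexx.
    have up : \big[Num.max/0]_(i < m.+1) w (y 0 i) <= 1.
      elim/big_ind: _ => [|a b a1 b1|i _]; first exact: ler01.
        by rewrite ge_max a1.
      exact: y1 pp ew i.
    rewrite ln_le0// andbT; apply: (@le_trans _ _ (ln (w (1 - s)))); last first.
      by rewrite ler_ln ?posrE// (lt_le_trans w0).
    rewrite /L -mulNr ler_pdivrMr// -lnV ?posrE ?ltr0n// mulr_natr -lnXn//.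
    rewrite ler_ln ?posrE ?invr_gt0 ?ltr0n ?exprn_gt0//.
    exact: finite_abs_primitive pp ew _ _ n1 sn.
  have d0 w : 0 <= (local_degree (rat_abs R (Some p)) w)%:R / (\dim {:K})%:R :> R.
    by rewrite divr_ge0.
  apply/andP; split; last first.
    rewrite big_seq; apply: sumr_le0 => w /lnb/andP[_ h].
    by rewrite mulr_ge0_le0.
  apply: (@le_trans _ _ (\sum_(w <- S)
      (local_degree (rat_abs R (Some p)) w)%:R / (\dim {:K})%:R * - L)).
    rewrite -mulr_suml mulrN lerN2 ler_piMl//.
    exact: sum_local_degree_frac_le1.
  rewrite big_seq [leRHS]big_seq; apply: ler_sum => w /lnb/andP[h _].
  exact: ler_wpM2l.
(* The local bound is 0 at a prime not dividing n, so the sum over all places of the rationals has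
   finite support. *)
have F0 p : prime p -> p \notin primes n -> F (Some p) = 0.
  move=> pp; rewrite mem_primes pp n0 /= => pn; apply/eqP.
  have := Fp p pp; rewrite lognE pp n0 (negbTE pn) expn0 ln1 mul0r oppr0.
  by rewrite eq_le andbC.
exists (\sum_(p <- primes n) F (Some p)); split.
  apply/andP; split; last first.
    rewrite big_seq; apply: sumr_le0 => p; rewrite mem_primes => /andP[pp _].
    by have /andP[] := Fp p pp.
  have -> : ln (n%:R : R) = \sum_(p <- primes n) ln ((p ^ logn p n)%:R : R).
    rewrite [in LHS](prod_prime_decomp n0) prime_decompE big_map /=.
    rewrite natr_prod; have : all prime (primes n).
      by apply/allP => p; rewrite mem_primes => /andP[].
    elim: (primes n) => [|p l IH] /=; first by rewrite !big_nil ln1.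
    move=> /andP[pp al]; rewrite !big_cons lnM ?IH// posrE ?ltr0n ?expn_gt0 ?prime_gt0//.
    rewrite big_seq; apply: prodr_gt0 => q ql; rewrite ltr0n expn_gt0 prime_gt0//.
    exact: (allP al).
  rewrite mulr_suml -sumrN big_seq [leRHS]big_seq; apply: ler_sum => p.
  by rewrite mem_primes => /andP[pp _]; have /andP[] := Fp p pp.
rewrite /height_over -/(F None).
transitivity (\sum_(v <- None :: map Some (primes n)) F v); last first.
  by rewrite big_cons big_map.
rewrite [RHS]fsbig_seq; last first.
  rewrite /= map_inj_uniq ?primes_uniq ?andbT; last by move=> a b [].
  by apply/negP => /mapP[].
rewrite (fsbig_widen [set` None :: map Some (primes n)] places_rat)//.
  move=> v; rewrite /= inE => /predU1P[->//|/mapP[p pn ->]] /=.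
  by move: pn; rewrite mem_primes => /andP[].
move=> [p|] /= [pp]; last by rewrite inE eqxx.
rewrite inE /= => H; apply: F0 => //; apply: contra_notN H => pn.
by apply/mapP; exists p.
Qed.

(** * Growth of the totient *)

(** The power of the least prime p is split off. An odd p satisfies p^k <= phi(p^k)^2; for p = 2 a
    factor 2 is lost, but only once, because the cofactor is then odd. Hence the distinction by
    parity. *)
Lemma totient_sqr_ge n : (0 < n)%N ->
  (n <= (if odd n then 1 else 2) * totient n ^ 2)%N.
Proof.
elim/ltn_ind: n => n IH n0.
have [n1|n1] := leqP n 1%N; first by have -> : n = 1%N by lia.
set p := pdiv n; have pp : prime p by exact: pdiv_prime.
have pn : (p %| n)%N by exact: pdiv_dvd.
pose k := logn p n; have k0 : (0 < k)%N by rewrite logn_gt0 mem_primes pp n0.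
have [M pM nE] := pfactor_coprime pp n0; rewrite -/k in nE.
have M0 : (0 < M)%N by move: n0; rewrite nE; case: (M).
have pk : (1 < p ^ k)%N by rewrite -{1}(expn0 p) ltn_exp2l ?prime_gt1.
have Mn : (M < n)%N by rewrite nE -[ltnLHS]muln1 ltn_mul2l M0.
have tE : totient n = (totient M * ((p.-1) * p ^ k.-1))%N.
  by rewrite nE totient_coprime ?totient_pfactor// coprime_sym coprimeXl.
have kE : (p ^ k = p * p ^ k.-1)%N by rewrite -expnS prednK.
have q0 : (0 < p ^ k.-1)%N by rewrite expn_gt0 prime_gt0.
have HM := IH M Mn M0; rewrite tE [leqLHS]nE kE; move: HM.
have [p2|p2] := eqVneq p 2%N.
  have -> : odd n = false by rewrite nE p2 oddM oddX (gtn_eqF k0) andbF.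
  have -> : odd M by move: pM; rewrite p2 coprime2n.
  rewrite p2 /= in q0 *; move: (totient M) (2 ^ k.-1)%N q0 => t q q0.
  rewrite mul1n -!mulnn => Mt.
  have : (M * q <= t * t * (q * q))%N by rewrite leq_mul// leq_pmulr.
  nia.
have oddp : odd p by have := even_prime pp => -[/eqP|//]; rewrite (negbTE p2).
have oddn : odd n.
  apply: contraT => en; have : (p <= 2)%N by rewrite /p pdiv_min_dvd// dvdn2.
  by move: p2 (prime_gt1 pp); lia.
have -> : odd M by move: oddn; rewrite nE oddM => /andP[].
rewrite oddn !mul1n; have : (2 < p)%N by move: p2 (prime_gt1 pp); lia.
move: (totient M) (p ^ k.-1)%N q0 => t q q0.
case: (p) => [|[|r]] // r0 Mt.
have h : (r.+2 * q <= (r.+1 * q) ^ 2)%N by rewrite expnMn -!mulnn; nia.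
by rewrite expnMn leq_mul.
Qed.

Lemma totient_sqr_ge2 n : (0 < n)%N -> (n <= 2 * totient n ^ 2)%N.
Proof.
move=> n0; apply: leq_trans (totient_sqr_ge n0) _.
by rewrite leq_mul2r; case: ifP; rewrite ?orbT.
Qed.

Lemma ln_totient_small (R : realType) (eps : R) : 0 < eps -> exists M : nat,
  forall n, (M < n)%N -> [/\ ln n%:R / (totient n)%:R < eps :> R
                          & (totient n)%:R^-1 < eps].
Proof.
move=> eps0.
have [A _ /(_ A (leqnn A)) /= HA] : \forall m \near \oo, (5 / eps) ^+ 2 < m%:R.
  exact: nbhs_infty_gtr.
pose A' := maxn A 1.
exists (2 * A' ^ 2)%N => n Mn.
have n0 : (0 < n)%N by case: (n) Mn.
have An : (A' < totient n)%N.
  by have := totient_sqr_ge2 n0; rewrite ltnNge; apply: contraL; nia.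
have t0 : (0 < totient n)%N by exact: leq_ltn_trans An.
set f : R := (totient n)%:R; have f0 : 0 < f by rewrite ltr0n.
have Af : (5 / eps) ^+ 2 < f.
  apply: lt_le_trans HA _; rewrite ler_nat (leq_trans _ (ltnW An))//.
  exact: leq_maxl.
have f1 : 1 <= f by rewrite ler1n.
set g := Num.sqrt f; have g2 : g ^+ 2 = f by rewrite sqr_sqrtr// ltW.
have g0 : 0 < g by rewrite sqrtr_gt0.
have g1 : 1 <= g by rewrite -(@ler_pXn2r _ 2)// ?nnegrE ?(ltW g0)// expr1n g2.
have ge : 5 < g * eps.
  rewrite -ltr_pdivrMr// -(@ltr_pXn2r _ 2)// ?nnegrE ?(ltW g0)//.
    by rewrite g2.
  by rewrite divr_ge0// ltW.
(* With g^2 = phi(n) and n <= 2 g^4, ln n <= ln 2 + 4 ln g <= 1 + 4 g <= 5 g. This is the origin of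
   the 5 in the choice of A. *)
have lnle : ln n%:R <= 5 * g.
  have h1 : (n%:R : R) <= 2 * g ^+ 2 ^+ 2.
    by rewrite g2 -natrX -natrM ler_nat; exact: totient_sqr_ge2.
  have n0' : 0 < n%:R :> R by rewrite ltr0n.
  have g4 : 0 < g ^+ 2 ^+ 2 by rewrite !exprn_gt0.
  apply: (@le_trans _ _ (ln (2 * g ^+ 2 ^+ 2))).
    by rewrite ler_ln ?posrE// mulr_gt0.
  rewrite lnM ?posrE// -exprM lnXn//.
  have := @ln_sublinear R g g0.
  have : ln 2 <= 1 :> R.
    have -> : (2:R) = 1 + 1 by []. 
    exact: le_ln1Dx.
  rewrite -mulr_natr; lra.
rewrite -/f; split.
  rewrite ltr_pdivrMr// -g2; apply: le_lt_trans lnle _.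
  by rewrite expr2 mulrA ltr_pM2r// mulrC.
rewrite -div1r ltr_pdivrMr// -g2; nra.
Qed.

(** * Sums and products over primitive roots of unity *)

Section PrimitiveSums.
Variable F : fieldType.
Implicit Types z : F.

Lemma big_primitive_powers (V : nmodType) z n (G : F -> V) :
  \sum_(y <- primitive_powers z n) G y =
  \sum_(0 <= k < n | coprime k n) G (z ^+ k).
Proof. by rewrite big_map big_filter /index_iota subn0. Qed.

(* The index set is invariant under k |-> k + m, which multiplies the sum by
   z ^ m <> 1. *)
Lemma sum_coprime_powers_eq0 z n m : n.-primitive_root z -> (m %| n)%N ->
  (m < n)%N -> \sum_(0 <= k < n | coprime k m) z ^+ k = 0.
Proof.
move=> zn mn mltn; have n0 := prim_order_gt0 zn.
have m0 : (0 < m)%N by exact: dvdn_gt0 mn.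
rewrite big_mkcond /=; pose f k := if coprime k m then z ^+ k else 0.
rewrite -[LHS]/(\sum_(0 <= k < n) f k).
have cD k d : (m %| d)%N -> coprime (k + d) m = coprime k m.
  by move=> /dvdnP[q ->]; rewrite ![coprime _ m]coprime_sym /coprime addnC gcdnMDl.
have fn k : f (k + n)%N = f k.
  by rewrite /f cD// exprD (prim_expr_order zn) mulr1.
have fm k : f (k + m)%N = z ^+ m * f k.
  by rewrite /f cD// exprD mulrC; case: ifP => // _; rewrite mulr0.
have E : \sum_(0 <= k < n) f (k + m)%N = \sum_(0 <= k < n) f k.
  have -> : \sum_(0 <= k < n) f (k + m)%N = \sum_(m <= k < n + m) f k.
    by rewrite -{2}[m]add0n big_addn addnK.
  rewrite (big_cat_nat (n := n)) ?leq_addr//=; last exact: ltnW.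
  rewrite [RHS](big_cat_nat (n := m))//=; last exact: ltnW.
  rewrite addrC; congr (_ + _).
  rewrite -{1}[n]add0n [(n + m)%N]addnC big_addn addnK.
  by apply: eq_bigr => k _; rewrite fn.
have : (z ^+ m - 1) * \sum_(0 <= k < n) f k = 0.
  rewrite mulrBl mul1r mulr_sumr -[X in _ - X]E -sumrB big1// => k _.
  by rewrite fm subrr.
move/eqP; rewrite mulf_eq0 subr_eq0 => /orP[|/eqP//].
by rewrite -(prim_order_dvd zn) gtnNdvd.
Qed.

(** The sum is the Moebius function of n. Let n = M p with p prime. The powers with exponent coprime
    to M sum to 0. If p divides M they are the primitive n-th roots; otherwise they also contain the
    primitive M-th roots, and the sign changes. The sum thus stays bounded while phi(n) grows. *)
Lemma sum_primitive_roots z n : n.-primitive_root z ->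
  let S := \sum_(y <- primitive_powers z n) y in [\/ S = 0, S = 1 | S = -1].
Proof.
elim/ltn_ind: n z => n IH z zn /=; have n0 := prim_order_gt0 zn.
rewrite big_primitive_powers.
have [n1|n1] := leqP n 1%N.
  have -> : n = 1%N by lia.
  by constructor 2; rewrite big_mkcond big_nat1.
set p := pdiv n; have pp : prime p by exact: pdiv_prime.
have pn : (p %| n)%N by exact: pdiv_dvd.
pose M := (n %/ p)%N; have nE : n = (M * p)%N by rewrite divnK.
have M0 : (0 < M)%N by rewrite divn_gt0 ?prime_gt0// dvdn_leq.
have Mn : (M < n)%N by rewrite nE ltn_Pmulr// prime_gt1.
have Mdn : (M %| n)%N by rewrite nE dvdn_mulr.
have T0 := sum_coprime_powers_eq0 zn Mdn Mn.
have cE k : coprime k n = coprime k M && ~~ (p %| k)%N.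
  by rewrite [in LHS]nE coprimeMr [coprime k p]coprime_sym (prime_coprime _ pp).
have [pM|pM] := boolP (p %| M)%N.
  constructor 1; rewrite -[RHS]T0; apply: eq_bigl => k; rewrite cE.
  case: (boolP (coprime k M)) => //= kM; rewrite -prime_coprime// coprime_sym.
  exact: coprime_dvdr pM kM.
have zp : M.-primitive_root (z ^+ p).
  have := dvdn_prim_root zn Mdn.
  by rewrite [X in (X %/ M)%N]nE mulKn.
have -> : \sum_(0 <= k < n | coprime k n) z ^+ k =
    - \sum_(y <- primitive_powers (z ^+ p) M) y.
  apply/eqP; rewrite -addr_eq0 -[eqbRHS]T0; apply/eqP.
  rewrite [RHS](bigID (fun k => (p %| k)%N)) /= addrC; congr (_ + _).
    by apply: eq_bigl => k; rewrite cE.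
  rewrite big_primitive_powers nE mulnC mulnC big_mkcond /= [RHS]big_mkcond /=.
  rewrite big_nat_mul; apply: eq_bigr => j _.
  have p0 := prime_gt0 pp.
  have jp : (j * p < j.+1 * p)%N by rewrite ltn_pmul2r.
  rewrite (big_ltn jp) [X in _ = _ + X]big_nat_cond [X in _ = _ + X]big1; last first.
    move=> k /andP[/andP[k1 k2] _]; case: ifP => // /andP[_ /dvdnP[l lk]].
    by move: k1 k2; rewrite lk !ltn_pmul2r//; lia.
  rewrite addr0 dvdn_mull// andbT -exprM mulnC coprimeMl.
  by rewrite (prime_coprime _ pp) pM andbT.
by have [->|->|->] := IH M Mn _ zp; rewrite ?oppr0 ?opprK;
  [constructor 1|constructor 3|constructor 2].
Qed.

End PrimitiveSums.

(** The values at 1 of the ['Phi_d], for the divisors d > 1 of n, are integers with product n. *)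
Lemma Cyclotomic_horner1 n : (1 < n)%N ->
  ('Phi_n).[1] != 0 /\ (`|('Phi_n).[1]| <= n)%N.
Proof.
move=> n1; have n0 : (0 < n)%N by exact: ltnW.
have P1 : 'Phi_1 = 'X - 1.
  by have := @prod_Cyclotomic 1 isT; rewrite big_cons big_nil mulr1 expr1.
have X0 : 'X - 1 != 0 :> {poly int} by rewrite -size_poly_eq0 size_XsubC.
have d1 : 1%N \in divisors n by rewrite -dvdn_divisors.
have E : \prod_(d <- rem 1%N (divisors n)) 'Phi_d = \sum_(i < n) 'X^i.
  apply: (mulfI X0); rewrite -subrX1 -(prod_Cyclotomic n0).
  by rewrite [in RHS](big_rem 1%N d1)/= P1.
have nd : n \in rem 1%N (divisors n).
  by rewrite (mem_rem_uniq _ (divisors_uniq n)) !inE gtn_eqF//= -dvdn_divisors.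
have := congr1 (fun p : {poly int} => p.[1]) E; rewrite horner_prod horner_sum.
rewrite (big_rem n nd) /=; set a := ('Phi_n).[1]; set b := \prod_(_ <- _) _.
have -> : \sum_(i < n) ('X^i).[1] = n%:Z :> int.
  under eq_bigr do rewrite hornerXn expr1n.
  by rewrite sumr_const card_ord natz.
move=> abn; have a0 : a != 0.
  by apply: contra_eq_neq abn => ->; rewrite mul0r eq_sym eqz_nat -lt0n.
split=> //; have : (`|a| %| n)%N by apply/dvdnP; exists `|b|%N; rewrite mulnC -abszM abn.
exact: dvdn_leq.
Qed.

(** The sum is the logarithm of |Phi_n(1)|, a positive integer at most n. *)
Lemma sum_ln_primitive_roots (R : realType) (z : R[i]) n : (1 < n)%N ->
  n.-primitive_root z ->
  0 <= \sum_(y <- primitive_powers z n) ln (Normc.normc (1 - y)) <= ln n%:R.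
Proof.
move=> n1 zn; have [a0 an] := Cyclotomic_horner1 n1.
have normcP := normc_absolute_value R.
have y1 y : y \in primitive_powers z n -> 0 < Normc.normc (1 - y).
  rewrite mem_primitive_powers// => yn; rewrite (abv_gt0 normcP) subr_eq0.
  apply: contraTneq n1 => y1; have := prim_order_dvd yn 1.
  by rewrite expr1 -y1 eqxx dvdn1 => /eqP ->.
have -> : \sum_(y <- primitive_powers z n) ln (Normc.normc (1 - y)) =
    ln (Normc.normc (\prod_(y <- primitive_powers z n) (1 - y))).
  rewrite (abv_prod normcP); move: y1; elim: (primitive_powers z n) => [|y l IH] H.
    by rewrite !big_nil ln1.
  rewrite !big_cons IH; last by move=> x xl; apply: H; rewrite inE xl orbT.
  rewrite lnM// posrE; first by apply: H; rewrite mem_head.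
  by rewrite big_seq; apply: prodr_gt0 => x xl; apply: H; rewrite inE xl orbT.
have -> : \prod_(y <- primitive_powers z n) (1 - y) = (('Phi_n).[1])%:~R.
  transitivity (map_poly intr 'Phi_n).[1 : R[i]].
    rewrite (Cyclotomic_primitive zn) cyclotomicE horner_prod.
    by apply: eq_bigr => y _; rewrite hornerXsubC.
  by rewrite -[1 in LHS](rmorph1 intr) horner_map.
have -> : Normc.normc (('Phi_n).[1]%:~R : R[i]) = `|('Phi_n).[1]|%:R.
  move: ('Phi_n).[1] => a; rewrite -[a%:~R](ratr_int _ a) normc_ratr ratr_int.
  by rewrite -intr_norm natr_absz.
have a1 : (0 < `|('Phi_n).[1]|)%N by rewrite absz_gt0.
rewrite ln_ge0 ?ler1n//= ler_ln ?posrE ?ltr0n ?ler_nat//; lia.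
Qed.
(** * Equidistribution on the torus *)

Section Torus.
Variable R : realType.
Local Notation C := R[i].
Local Notation normc := (@Normc.normc R).
Let normcP : absolute_value normc := normc_absolute_value R.

Definition on_torus (z : C * C) := normc z.1 = 1 /\ normc z.2 = 1.

Definition monomial (b : int * int) (z : C * C) : C := z.1 ^ b.1 * z.2 ^ b.2.

Lemma normc1_neq0 (z : C) : normc z = 1 -> z != 0.
Proof. by move=> z1; rewrite -(abv_gt0 normcP) z1. Qed.

Lemma normc1X (z : C) (n : nat) : normc z = 1 -> normc (z ^+ n) = 1.
Proof. by move=> z1; rewrite (abvX normcP) z1 expr1n. Qed.

Lemma normc1Xz (z : C) (n : int) : normc z = 1 -> normc (z ^ n) = 1.
Proof. by move=> z1; rewrite (abvXz normcP) z1 exp1rz. Qed.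

Lemma normc_monomial b z : on_torus z -> normc (monomial b z) = 1.
Proof. by move=> [z1 z2]; rewrite (abvM normcP) !normc1Xz ?mul1r. Qed.

Lemma normc1_invE (z : C) : normc z = 1 -> z^-1 = z^*%C.
Proof.
move=> z1; have z0 := normc1_neq0 z1; apply: (mulfI z0); rewrite divff//.
have := sqr_normc z; rewrite -[`|z|]/((normc z)%:C%C) z1 expr1n => /esym; exact.
Qed.

Lemma normc_subX_le (z w : C) (n : nat) : normc z = 1 -> normc w = 1 ->
  normc (z ^+ n - w ^+ n) <= n%:R * normc (z - w).
Proof.
move=> z1 w1; elim: n => [|n IH]; first by rewrite subrr (abv0 normcP) mul0r.
have -> : z ^+ n.+1 - w ^+ n.+1 = z * (z ^+ n - w ^+ n) + (z - w) * w ^+ n.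
  by rewrite !exprS; ring.
apply: le_trans (abvD normcP _ _) _; rewrite !(abvM normcP) z1 normc1X// mul1r mulr1.
by rewrite -natr1 mulrDl mul1r lerD2r.
Qed.

Lemma normc_subXz_le (z w : C) (n : int) : normc z = 1 -> normc w = 1 ->
  normc (z ^ n - w ^ n) <= `|n|%N%:R * normc (z - w).
Proof.
move=> z1 w1; case: n => n; first exact: normc_subX_le.
rewrite NegzE -!exprnN abszN /=.
have zn := normc1X n.+1 z1; have wn := normc1X n.+1 w1.
have -> : (z ^+ n.+1)^-1 - (w ^+ n.+1)^-1 =
    - ((z ^+ n.+1 - w ^+ n.+1) / (z ^+ n.+1 * w ^+ n.+1)).
  by field; rewrite !expf_neq0 ?normc1_neq0.
rewrite (abvN normcP) (abvM normcP) (abvV normcP) (abvM normcP) zn wn mulr1 invr1 mulr1.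
exact: normc_subX_le.
Qed.

Lemma normc_monomial_sub_le b z w : on_torus z -> on_torus w ->
  normc (monomial b z - monomial b w) <=
  `|b.1|%N%:R * normc (z.1 - w.1) + `|b.2|%N%:R * normc (z.2 - w.2).
Proof.
move=> [z1 z2] [w1 w2].
have -> : monomial b z - monomial b w =
   (z.1 ^ b.1 - w.1 ^ b.1) * z.2 ^ b.2 + w.1 ^ b.1 * (z.2 ^ b.2 - w.2 ^ b.2).
  by rewrite /monomial; ring.
apply: le_trans (abvD normcP _ _) _; rewrite !(abvM normcP) !normc1Xz// mulr1 mul1r.
by rewrite lerD// normc_subXz_le.
Qed.

(** Lipschitz functions serve as test functions because a kernel with small first moment
    approximates them uniformly with an explicit error. *)
Definition torus_lipschitz (h : C * C -> R) := exists2 L, 0 <= L &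
  forall z w, on_torus z -> on_torus w ->
  `|h z - h w| <= L * (normc (z.1 - w.1) + normc (z.2 - w.2)).

Lemma torus_lipschitz_cst c : torus_lipschitz (fun=> c).
Proof. by exists 0 => // z w _ _; rewrite subrr normr0 mul0r. Qed.

Lemma torus_lipschitzD g h : torus_lipschitz g -> torus_lipschitz h ->
  torus_lipschitz (fun z => g z + h z).
Proof.
move=> [L L0 gL] [L' L'0 hL]; exists (L + L'); first exact: addr_ge0.
move=> z w zt wt; rewrite opprD addrACA mulrDl.
by apply: le_trans (ler_normD _ _) _; rewrite lerD ?gL ?hL.
Qed.

Lemma torus_lipschitzZ c h : torus_lipschitz h ->
  torus_lipschitz (fun z => c * h z).
Proof.
move=> [L L0 hL]; exists (`|c| * L) => [|z w zt wt]; first exact: mulr_ge0.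
by rewrite -mulrBr normrM -mulrA ler_wpM2l// hL.
Qed.

Lemma torus_lipschitz_sum (I : Type) (s : seq I) (h : I -> C * C -> R) :
  (forall i, torus_lipschitz (h i)) -> torus_lipschitz (fun z => \sum_(i <- s) h i z).
Proof.
move=> H; elim: s => [|i s IH].
  by under eq_fun do rewrite big_nil; exact: torus_lipschitz_cst.
by under eq_fun do rewrite big_cons; exact: torus_lipschitzD.
Qed.

Lemma torus_lipschitz_monomial c b :
  torus_lipschitz (fun z => complex.Re (c * monomial b z)).
Proof.
exists (normc c * (`|b.1|%N%:R + `|b.2|%N%:R)).
  by rewrite mulr_ge0 ?addr_ge0 ?(abv_ge0 normcP).
move=> z w zt wt.
have -> : complex.Re (c * monomial b z) - complex.Re (c * monomial b w) =
    complex.Re (c * (monomial b z - monomial b w)).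
  rewrite mulrBr; by case: (c * monomial b z) (c * monomial b w) => [? ?] [].
apply: le_trans (normc_ge_Re _) _; rewrite (abvM normcP) -mulrA ler_wpM2l ?(abv_ge0 normcP)//.
apply: le_trans (normc_monomial_sub_le b zt wt) _.
rewrite mulrDl !mulrDr; have H n x : 0 <= (n%:R : R) * normc x.
  by rewrite mulr_ge0 ?(abv_ge0 normcP).
have := H `|b.1|%N (z.2 - w.2); have := H `|b.2|%N (z.1 - w.1); lra.
Qed.

(** Averages over conjugates, integrals against [tau] and their images under a character are all
    means, so that one criterion of Weyl type covers them. *)
Definition mean (I : (C * C -> R) -> R) :=
  [/\ forall g h, torus_lipschitz g -> torus_lipschitz h ->
        I (fun z => g z + h z) = I g + I h,
      forall c h, torus_lipschitz h -> I (fun z => c * h z) = c * I h,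
      forall g h, torus_lipschitz g -> torus_lipschitz h ->
        (forall z, on_torus z -> g z <= h z) -> I g <= I h
    & I (fun=> 1) = 1].

Lemma mean_cst I c : mean I -> I (fun=> c) = c.
Proof.
move=> [_ IZ _ I1]; transitivity (c * I (fun=> 1)); last by rewrite I1 mulr1.
rewrite -IZ; last exact: torus_lipschitz_cst.
by congr I; apply/funext => z; rewrite mulr1.
Qed.

Lemma mean_sum I (J : Type) (s : seq J) (h : J -> C * C -> R) : mean I ->
  (forall i, torus_lipschitz (h i)) ->
  I (fun z => \sum_(i <- s) h i z) = \sum_(i <- s) I (h i).
Proof.
move=> Im H; elim: s => [|i s IH].
  by rewrite big_nil -[RHS](mean_cst 0 Im); congr I; apply/funext => z; rewrite big_nil.
have [ID _ _ _] := Im.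
rewrite big_cons -IH -ID//; last exact: torus_lipschitz_sum.
by congr I; apply/funext => z; rewrite big_cons.
Qed.

Lemma mean_dist_le I g h eps : mean I -> torus_lipschitz g -> torus_lipschitz h ->
  (forall z, on_torus z -> `|g z - h z| <= eps) -> `|I g - I h| <= eps.
Proof.
move=> Im gl hl gh; have [ID _ IM _] := Im.
have el := torus_lipschitz_cst eps.
rewrite ler_norml; apply/andP; split.
  rewrite -subr_ge0 opprK addrAC subr_ge0 -[eps](mean_cst _ Im) -ID//.
  apply: IM => //; first exact: torus_lipschitzD.
  by move=> z /gh; rewrite ler_norml => /andP[]; lra.
rewrite lerBlDl -[eps](mean_cst _ Im) -ID//.
apply: IM => //; first exact: torus_lipschitzD.
by move=> z /gh; rewrite ler_norml => /andP[]; lra.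
Qed.

(* de la Vallee Poussin kernel *)
Definition vp_kernel (m : nat) (u : C) : R := normc (1 + u) ^+ (2 * m) / 'C(2 * m, m)%:R.

Lemma bin_mid_gt0 m : 0 < 'C(2 * m, m)%:R :> R.
Proof. by rewrite ltr0n bin_gt0 leq_pmull. Qed.

Lemma vp_kernel_ge0 m u : 0 <= vp_kernel m u.
Proof. by rewrite divr_ge0 ?exprn_ge0 ?(abv_ge0 normcP)// ltW// bin_mid_gt0. Qed.

Definition vp_coef (m k : nat) : R := 'C(2 * m, k)%:R / 'C(2 * m, m)%:R.

(** On the unit circle |1 + u|^2 = (1 + u)^2 / u, so the kernel is a Laurent polynomial with
    frequencies from -m to m and constant coefficient 1. *)
Lemma vp_kernelE m u : normc u = 1 -> (vp_kernel m u)%:C%C =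
  \sum_(k < (2 * m).+1) (vp_coef m k)%:C%C * u ^ (k%:Z - m%:Z).
Proof.
move=> u1; have u0 := normc1_neq0 u1.
have sq : ((normc (1 + u)) ^+ 2)%:C%C = (1 + u) ^+ 2 * u^-1.
  rewrite rmorphXn /=.
  have := sqr_normc (1 + u); rewrite -[`|1 + u|]/((normc (1 + u))%:C%C) => ->.
  by rewrite rmorphD rmorph1 /= -normc1_invE//; field.
have -> : (vp_kernel m u)%:C%C =
    ('C(2 * m, m)%:R^-1)%:C%C * ((1 + u) ^+ (2 * m) * u ^- m).
  rewrite /vp_kernel mulrC rmorphM /= exprM [in LHS]rmorphXn /= sq exprMn -exprM.
  by rewrite exprVn.
rewrite exprDn mulr_suml mulr_sumr; apply: eq_bigr => k _.
rewrite expr1n mul1r /vp_coef [in RHS]mulrC rmorphM /= mulrA.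
have -> : u ^ (k%:Z - m%:Z) = u ^+ k * u ^- m.
  by rewrite expfzDr// -exprnP exprnN.
rewrite -mulr_natr rmorph_nat; ring.
Qed.

Lemma vp_coef_mid m : vp_coef m m = 1.
Proof. by rewrite /vp_coef divff// gt_eqF// bin_mid_gt0. Qed.

Variables (M : nat) (zeta : C).
Hypothesis zetaM : M.-primitive_root zeta.

Lemma normc_prim_root : normc zeta = 1.
Proof. exact: (abv_root1 normcP (prim_order_gt0 zetaM) (prim_expr_order zetaM)). Qed.

Let normcX r : normc (zeta ^+ r) = 1.
Proof. exact/normc1X/normc_prim_root. Qed.

Lemma sum_prim_root_powers (j : int) : (`|j| < M)%N ->
  \sum_(r < M) (zeta ^ j) ^+ r = (if j == 0 then M%:R else 0) :> C.
Proof.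
move=> jM; have [->|j0] := eqVneq j 0.
  by rewrite expr0z; under eq_bigr do rewrite expr1n; rewrite sumr_const card_ord.
have zj : zeta ^ j - 1 != 0.
  rewrite subr_eq0; have [i iE] : exists i : nat, (j = i%:Z \/ j = - i%:Z) /\ (0 < i < M)%N.
    exists `|j|%N; split; last by rewrite jM absz_gt0 j0.
    by case: j {jM j0} => j; [left|right]; rewrite ?NegzE ?abszN.
  case: iE => iE /andP[i0 iM].
  have zi : zeta ^+ i != 1.
    by rewrite -(prim_order_dvd zetaM) gtnNdvd.
  case: iE => ->; first by rewrite -exprnP.
  by rewrite -exprnN invr_eq1.
apply: (mulfI zj); rewrite mulr0 -subrX1.
have -> : (zeta ^ j) ^+ M = (zeta ^+ M) ^ j by rewrite [LHS]exprnP exprz_exp mulrC -exprz_exp.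
by rewrite (prim_expr_order zetaM) exp1rz subrr.
Qed.

(** As M exceeds every frequency, summation over the M-th roots of unity retains only the constant
    coefficient. *)
Lemma sum_vp_kernel m (z : C) : (m < M)%N -> normc z = 1 ->
  \sum_(r < M) vp_kernel m (z / zeta ^+ r) = M%:R.
Proof.
move=> mM z1; apply: complexI; rewrite rmorph_sum rmorph_nat /=.
have zr (r : nat) : normc (z / zeta ^+ r) = 1.
  by rewrite (abvM normcP) (abvV normcP) z1 normcX invr1 mulr1.
under eq_bigr => r _ do rewrite vp_kernelE//.
rewrite exchange_big /=.
have mm : (m < (2 * m).+1)%N by rewrite ltnS leq_pmull.
have z0 := normc1_neq0 z1; have zeta0 := normc1_neq0 normc_prim_root.
have inner (k : 'I_(2 * m).+1) :
    \sum_(r < M) (vp_coef m k)%:C%C * (z / zeta ^+ r) ^ (k%:Z - m%:Z) =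
    (vp_coef m k)%:C%C * z ^ (k%:Z - m%:Z) * (if k == Ordinal mm then M%:R else 0).
  have -> : (k == Ordinal mm) = (m%:Z - k%:Z == 0).
    by rewrite subr_eq0 eqz_nat eq_sym.
  rewrite -sum_prim_root_powers; last by have := ltn_ord k; lia.
  rewrite mulr_sumr; apply: eq_bigr => r _.
  rewrite -mulrA; congr (_ * _); rewrite expfzMl; congr (_ * _).
  rewrite exprnN [RHS]exprnP !exprz_exp; congr (_ ^ _); ring.
under eq_bigr do rewrite inner.
rewrite (bigD1 (Ordinal mm))//= eqxx big1 ?addr0.
  by rewrite subrr expr0z vp_coef_mid rmorph1 !mul1r.
by move=> k /negbTE ->; rewrite mulr0.
Qed.

Lemma normc_parallelogram (u : C) : normc u = 1 ->
  normc (1 - u) ^+ 2 = 4 - normc (1 + u) ^+ 2.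
Proof.
move=> u1; have := sqr_normc_ReIm u; rewrite u1 !sqr_normc_ReIm.
case: u {u1} => a b /= E; have : a ^+ 2 + b ^+ 2 = 1 by rewrite -E expr1n.
nra.
Qed.

(** By |1 - u|^2 = 4 - |1 + u|^2 the second moment combines the kernels of index m and m + 1; their
    normalising binomial coefficients have ratio 4 - 2 / (m + 1). *)
Lemma sum_vp_kernel_dist2 m (z : C) : (m.+1 < M)%N -> normc z = 1 ->
  \sum_(r < M) normc (z - zeta ^+ r) ^+ 2 * vp_kernel m (z / zeta ^+ r)
  = M%:R * (2 / m.+1%:R).
Proof.
move=> mM z1.
have binE : 'C(2 * m.+1, m.+1)%:R / 'C(2 * m, m)%:R = 4 - 2 / m.+1%:R :> R.
  have E : (m.+1 * 'C(2 * m.+1, m.+1) = 2 * (2 * m).+1 * 'C(2 * m, m))%N.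
    have e1 := mul_bin_diag (2 * m).+2 m; have e2 := mul_bin_diag (2 * m).+1 m.
    have e3 : 'C((2 * m).+1, m) = 'C((2 * m).+1, m.+1).
      have -> : m.+1 = ((2 * m).+1 - m)%N by lia.
      by rewrite bin_sub//; lia.
    have -> : (2 * m.+1 = (2 * m).+2)%N by lia.
    rewrite -e1 /= e3; have -> : ((2 * m).+2 = 2 * m.+1)%N by lia.
    by rewrite -mulnA -e2 /= mulnA.
  have c0 := bin_mid_gt0 m; have m0 : 0 < m.+1%:R :> R by rewrite ltr0n.
  have ER : m.+1%:R * 'C(2 * m.+1, m.+1)%:R = 2 * (2 * m%:R + 1) * 'C(2 * m, m)%:R :> R.
    have -> : 2 * m%:R + 1 = (2 * m).+1%:R :> R by rewrite -[in RHS]natr1 natrM.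
    by rewrite -!natrM E.
  have mE : m%:R = m.+1%:R - 1 :> R by rewrite -[in RHS]natr1 addrK.
  apply: (mulfI (lt0r_neq0 m0)); rewrite mulrA ER mE.
  move: (m.+1%:R) m0 ('C(2 * m, m)%:R) c0 => q q0 c c0.
  by field; rewrite !gt_eqF.
have term (r : nat) : normc (z - zeta ^+ r) ^+ 2 * vp_kernel m (z / zeta ^+ r) =
    4 * vp_kernel m (z / zeta ^+ r) -
    (4 - 2 / m.+1%:R) * vp_kernel m.+1 (z / zeta ^+ r).
  set u := z / _.
  have zr0 : zeta ^+ r != 0 by rewrite normc1_neq0.
  have u1 : normc u = 1 by rewrite (abvM normcP) (abvV normcP) z1 normcX invr1 mulr1.
  have -> : z - zeta ^+ r = - zeta ^+ r * (1 - u) by rewrite /u; field.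
  rewrite (abvM normcP) (abvN normcP) normcX mul1r normc_parallelogram// -binE.
  rewrite /vp_kernel; have -> : (2 * m.+1 = 2 + 2 * m)%N by lia.
  rewrite exprD; field; rewrite !gt_eqF ?bin_mid_gt0//.
  by have := bin_mid_gt0 m.+1; have -> : (2 * m.+1 = 2 + 2 * m)%N by lia.
under eq_bigr do rewrite term.
by rewrite sumrB -!mulr_sumr !sum_vp_kernel//; [ring|exact: ltnW].
Qed.

(** The first moment is bounded by the second through d <= eps + d^2 / (4 eps). *)
Lemma sum_vp_kernel_dist m (z : C) (eps : R) : (m.+1 < M)%N -> normc z = 1 ->
  0 < eps -> \sum_(r < M) normc (z - zeta ^+ r) * vp_kernel m (z / zeta ^+ r)
  <= M%:R * (eps + (2 * eps * m.+1%:R)^-1).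
Proof.
move=> mM z1 eps0; have m0 : 0 < m.+1%:R :> R by rewrite ltr0n.
have -> : M%:R * (eps + (2 * eps * m.+1%:R)^-1) =
   eps * \sum_(r < M) vp_kernel m (z / zeta ^+ r) + (4 * eps)^-1 *
   \sum_(r < M) normc (z - zeta ^+ r) ^+ 2 * vp_kernel m (z / zeta ^+ r).
  rewrite sum_vp_kernel ?sum_vp_kernel_dist2//; last exact: ltnW.
  by move: m0; set q : R := m.+1%:R; move=> m0; field; rewrite !gt_eqF.
rewrite !mulr_sumr -big_split /=; apply: ler_sum => r _.
rewrite [X in _ <= _ + X]mulrA -mulrDl ler_wpM2r ?vp_kernel_ge0//.
set d := normc _.
have : 0 <= (2 * eps - d) ^+ 2 by exact: sqr_ge0.
have -> : eps + (4 * eps)^-1 * d ^+ 2 = d + (4 * eps)^-1 * (2 * eps - d) ^+ 2.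
  by field; rewrite gt_eqF.
by move=> h; rewrite lerDl mulr_ge0// invr_ge0; lra.
Qed.

(* the convolution of h with the kernel, discretized at the M-th roots of unity *)
Definition vp_sum (m : nat) (h : C * C -> R) (z : C * C) : R :=
  M%:R ^- 2 * \sum_(r < M) \sum_(s < M) h (zeta ^+ r, zeta ^+ s) *
    (vp_kernel m (z.1 / zeta ^+ r) * vp_kernel m (z.2 / zeta ^+ s)).

Lemma vp_sum_dist m h L z (eps : R) : (m.+1 < M)%N -> on_torus z -> 0 < eps -> 0 <= L ->
  (forall z w, on_torus z -> on_torus w ->
  `|h z - h w| <= L * (normc (z.1 - w.1) + normc (z.2 - w.2))) ->
  `|h z - vp_sum m h z| <= 2 * L * (eps + (2 * eps * m.+1%:R)^-1).
Proof.
move=> mM zt eps0 L0 hL; have [z1 z2] := zt.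
have M0 : 0 < M%:R :> R by rewrite ltr0n (prim_order_gt0 zetaM).
have mM' : (m < M)%N by exact: ltnW.
set B := eps + _; pose k1 r := vp_kernel m (z.1 / zeta ^+ r).
pose k2 r := vp_kernel m (z.2 / zeta ^+ r).
have kk r s : 0 <= k1 r * k2 s by apply: mulr_ge0; exact: vp_kernel_ge0.
have s1 : \sum_(r < M) k1 r = M%:R by exact: sum_vp_kernel.
have s2 : \sum_(r < M) k2 r = M%:R by exact: sum_vp_kernel.
have hE : h z = M%:R ^- 2 * \sum_(r < M) \sum_(s < M) h z * (k1 r * k2 s).
  under eq_bigr do rewrite -mulr_sumr -mulr_sumr s2.
  rewrite -mulr_sumr -mulr_suml s1; field; exact: lt0r_neq0.
rewrite {1}hE /vp_sum -mulrBr -sumrB normrM ger0_norm ?invr_ge0 ?exprn_ge0 ?ler0n//.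
rewrite ler_pdivrMl ?exprn_gt0//.
apply: le_trans (ler_norm_sum _ _ _) _.
apply: (@le_trans _ _ (\sum_(r < M) \sum_(s < M)
   (L * (normc (z.1 - zeta ^+ r) + normc (z.2 - zeta ^+ s)) * (k1 r * k2 s)))).
  apply: ler_sum => r _; rewrite -sumrB; apply: le_trans (ler_norm_sum _ _ _) _.
  apply: ler_sum => s _; rewrite -/(k1 r) -/(k2 s) -mulrBl normrM.
  rewrite [X in _ * X]ger0_norm// ler_wpM2r//.
  by apply: hL => //; split => /=; exact: normcX.
have d1 := sum_vp_kernel_dist mM z1 eps0; have d2 := sum_vp_kernel_dist mM z2 eps0.
have -> : \sum_(r < M) \sum_(s < M)
   (L * (normc (z.1 - zeta ^+ r) + normc (z.2 - zeta ^+ s)) * (k1 r * k2 s)) =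
   L * ((\sum_(r < M) normc (z.1 - zeta ^+ r) * k1 r) * \sum_(s < M) k2 s +
        (\sum_(r < M) k1 r) * \sum_(s < M) normc (z.2 - zeta ^+ s) * k2 s).
  rewrite !mulr_suml -big_split /= mulr_sumr; apply: eq_bigr => r _.
  rewrite !mulr_sumr -big_split /= mulr_sumr; apply: eq_bigr => s _; ring.
rewrite s1 s2.
have -> : M%:R ^+ 2 * (2 * L * B) = L * (M%:R * B * M%:R + M%:R * (M%:R * B)) by ring.
rewrite ler_wpM2l// lerD// ?ler_wpM2r ?ler_wpM2l// ltW//.
Qed.

Definition vp_index (m : nat) : finType := ('I_(2 * m).+1 * 'I_(2 * m).+1)%type.

Definition vp_freq m (kl : vp_index m) : int * int :=
  (kl.1%:Z - m%:Z, kl.2%:Z - m%:Z).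

Definition vp_sum_coef m (h : C * C -> R) (kl : vp_index m) : C :=
  (M%:R ^- 2 * (vp_coef m kl.1 * vp_coef m kl.2))%:C%C *
  \sum_(r < M) \sum_(s < M) (h (zeta ^+ r, zeta ^+ s))%:C%C *
    monomial (vp_freq kl) ((zeta ^+ r)^-1, (zeta ^+ s)^-1).

Lemma vp_sumE m h z : on_torus z -> vp_sum m h z =
  \sum_(kl : vp_index m) complex.Re (vp_sum_coef h kl * monomial (vp_freq kl) z).
Proof.
move=> [z1 z2]; have -> : \sum_(kl : vp_index m)
    complex.Re (vp_sum_coef h kl * monomial (vp_freq kl) z) =
    complex.Re (\sum_(kl : vp_index m) vp_sum_coef h kl * monomial (vp_freq kl) z).
  by elim/big_rec2: _ => // kl a b _ ->; case: (_ * _) a => [? ?] [].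
suff -> : \sum_(kl : vp_index m) vp_sum_coef h kl * monomial (vp_freq kl) z =
  (vp_sum m h z)%:C%C by [].
have term (r s : nat) : (h (zeta ^+ r, zeta ^+ s) *
    (vp_kernel m (z.1 / zeta ^+ r) * vp_kernel m (z.2 / zeta ^+ s)))%:C%C =
  \sum_(kl : vp_index m) (h (zeta ^+ r, zeta ^+ s))%:C%C *
    ((vp_coef m kl.1)%:C%C * (z.1 / zeta ^+ r) ^ (kl.1%:Z - m%:Z) *
    ((vp_coef m kl.2)%:C%C * (z.2 / zeta ^+ s) ^ (kl.2%:Z - m%:Z))).
  rewrite rmorphM /= rmorphM /= !vp_kernelE.
  - by rewrite big_distrlr /= pair_big /= mulr_sumr.
  - by rewrite (abvM normcP) (abvV normcP) z2 normcX invr1 mulr1.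
  - by rewrite (abvM normcP) (abvV normcP) z1 normcX invr1 mulr1.
apply/esym; rewrite /vp_sum rmorphM /= rmorph_sum /=.
under eq_bigr => r _.
  rewrite rmorph_sum /=.
  under eq_bigr do rewrite term.
  rewrite exchange_big /=.
  over.
rewrite exchange_big /= mulr_sumr; apply: eq_bigr => -[k l] _ /=.
rewrite /vp_sum_coef !mulr_sumr mulr_suml; apply: eq_bigr => r _.
rewrite !mulr_sumr mulr_suml; apply: eq_bigr => s _ /=.
rewrite /monomial /= !expfzMl !rmorphM /=; ring.
Qed.

End Torus.

(** * Weyl's criterion *)

Lemma primitive_root_exists (F : numClosedFieldType) n : (0 < n)%N ->
  exists z : F, n.-primitive_root z.
Proof.
move=> n0; pose p : {poly F} := 'X^n - 1.
have [rs rsE] := closed_field_poly_normal p.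
have sp : size p = n.+1 by rewrite size_XnsubC.
have lp : lead_coef p = 1 by rewrite lead_coefXnsubC.
rewrite lp scale1r in rsE.
have srs : size rs = n by have := sp; rewrite rsE size_prod_XsubC => -[].
have urs : uniq rs.
  rewrite -separable_prod_XsubC -rsE separable_Xn_sub_1//.
  by rewrite pnatr_eq0 -lt0n.
have : has n.-primitive_root rs.
  apply: has_prim_root; rewrite ?srs//.
  apply/allP => x xs; rewrite unity_rootE -subr_eq0.
  have : root p x by rewrite rsE root_prod_XsubC.
  by rewrite rootE !hornerE.
by move=> /hasP[z _ zn]; exists z.
Qed.

Section Weyl.
Variable R : realType.
Local Notation C := R[i].
Local Notation normc := (@Normc.normc R).

Lemma trigonometric_approximation (h : C * C -> R) (eps : R) :
  torus_lipschitz h -> 0 < eps ->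
  exists (T : finType) (c : T -> C) (b : T -> int * int),
    forall z, on_torus z ->
    `|h z - \sum_t complex.Re (c t * monomial (b t) z)| <= eps.
Proof.
move=> [L L0 hL] eps0.
have L1 : 0 < L + 1 by lra.
(* The kernel estimate will give 2 L (e + e) = 4 L e; the summand 1 allows for L = 0. *)
have [e [e0 eE]] : exists e, 0 < e /\ eps = 4 * (L + 1) * e.
  exists (eps / (4 * (L + 1))); split; first by rewrite divr_gt0// mulr_gt0.
  by field; rewrite gt_eqF.
have [m _ /(_ m (leqnn m)) /= Hm] : \forall m \near \oo, (2 * e ^+ 2)^-1 < m%:R.
  exact: nbhs_infty_gtr.
(* The second moment involves the kernel of index m + 1, which requires more than m + 1 nodes. *)
have [zeta zM] := @primitive_root_exists C m.+2 isT.
exists (vp_index m), (vp_sum_coef m.+2 zeta h), (@vp_freq m) => z zt.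
rewrite -(vp_sumE zM)//; have := vp_sum_dist zM (leqnn _) zt e0 L0 hL.
move/le_trans; apply.
have m0 : 0 < m.+1%:R :> R by rewrite ltr0n.
have : (2 * e * m.+1%:R)^-1 <= e.
  rewrite -[leLHS]div1r ler_pdivrMr ?mulr_gt0//.
  have e2 : 0 < 2 * e ^+ 2 by rewrite mulr_gt0// exprn_gt0.
  have : 1 <= 2 * e ^+ 2 * m.+1%:R.
    rewrite mulrC -ler_pdivrMr// div1r (le_trans (ltW Hm))// ler_nat//.
  by move: (m.+1%:R) => q; rewrite expr2; lra.
rewrite eE.
move: (_^-1) => q qe; have : L * q <= L * e by rewrite ler_wpM2l.
have : 0 <= L * e by rewrite mulr_ge0// ltW.
lra.
Qed.

(** Means do not increase uniform distances on the torus, so convergence passes from trigonometric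
    polynomials to their uniform limits. *)
Theorem weyl_criterion (I_ : nat -> (C * C -> R) -> R) (I : (C * C -> R) -> R) :
  (forall l, mean (I_ l)) -> mean I ->
  (forall c b, I_ l (fun z => complex.Re (c * monomial b z)) @[l --> \oo] -->
     I (fun z => complex.Re (c * monomial b z))) ->
  forall h, torus_lipschitz h -> I_ l h @[l --> \oo] --> I h.
Proof.
move=> Im_ Im Hmono h hl; apply/cvgrPdist_le => eps eps0.
have e4 : 0 < eps / 4 by lra.
have [T [c [b Hb]]] := trigonometric_approximation hl e4.
pose g z := \sum_(t : T) complex.Re (c t * monomial (b t) z).
have tl t : torus_lipschitz (fun z => complex.Re (c t * monomial (b t) z)).
  exact: torus_lipschitz_monomial.
have gl : torus_lipschitz g by exact: torus_lipschitz_sum.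
have : I_ l g @[l --> \oo] --> I g.
  rewrite (mean_sum _ Im)//.
  under eq_fun do rewrite (mean_sum _ (Im_ _))//.
  by apply: cvg_big => [|t _]; [exact: add_continuous|exact: Hmono].
move=> /cvgrPdist_le /(_ _ e4)[N _ HN]; exists N => // l /HN /=.
have := mean_dist_le Im hl gl Hb; have := mean_dist_le (Im_ l) hl gl Hb.
move=> h1 h2 h3.
have -> : I h - I_ l h = (I h - I g) + ((I g - I_ l g) - (I_ l h - I_ l g)) by ring.
apply: le_trans (ler_normD _ _) _; apply: le_trans (lerD h2 (ler_normB _ _)) _.
by apply: le_trans (lerD (lexx _) (lerD h3 h1)) _; lra.
Qed.

End Weyl.

(** * Strict sequences and orders of character values *)

Section Strict.
Implicit Types (a b : int * int) (g : algC * algC).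

Definition chi_kernel b : set (algC * algC) := torus `&` [set g | chi b g = 1].

Lemma exprz_pos_neg_parts (c : int) : exists m n : nat,
  forall y : algC, y != 0 -> y ^ c = y ^+ m / y ^+ n.
Proof.
case: c => c.
  by exists c, 0%N => y _; rewrite expr0 divr1.
by exists 0%N, c.+1 => y _; rewrite expr0 mul1r NegzE -exprnN.
Qed.

(** Moving the negative exponents to the other side turns chi^b = 1 into a polynomial equation
    between two monomials. *)
Lemma chi_kernel_subgroup b : algebraic_subgroup (chi_kernel b).
Proof.
split.
- have [m1 [n1 E1]] := exprz_pos_neg_parts b.1.
  have [m2 [n2 E2]] := exprz_pos_neg_parts b.2.
  exists [set 'X^m1 * ('X^m2)%:P - 'X^n1 * ('X^n2)%:P].
  have key g : torus g -> chi b g = 1 <->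
      ('X^m1 * ('X^m2)%:P - 'X^n1 * ('X^n2)%:P).[g.1, g.2] = 0.
    move=> [g1 g2]; rewrite /chi E1// E2// !hornerE /=.
    have d0 : g.1 ^+ n1 * g.2 ^+ n2 != 0 by rewrite mulf_neq0// expf_neq0.
    have -> : g.1 ^+ m1 / g.1 ^+ n1 * g.2 ^+ m2 / g.2 ^+ n2 =
      g.1 ^+ m1 * g.2 ^+ m2 / (g.1 ^+ n1 * g.2 ^+ n2).
      by rewrite invfM; ring.
    split=> [E|/eqP].
      apply/eqP; rewrite subr_eq0; apply/eqP.
      by rewrite -[LHS](divfK d0) E mul1r.
    by rewrite subr_eq0 => /eqP ->; rewrite divff.
  apply/seteqP; split => g /= [gt] H; split => //.
    by move=> p /= ->; apply/key.
  by apply/key => //; exact: H.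
- by split; [split; exact: oner_neq0|rewrite /= /chi !exp1rz mulr1].
- move=> g h [[g1 g2] gb] [[h1 h2] hb]; split; first by split; exact: mulf_neq0.
  rewrite /= /chi /= !expfzMl mulrACA; move: gb hb; rewrite /= /chi => -> ->.
  by rewrite mulr1.
- move=> g [[g1 g2] gb]; split; first by split; rewrite /= invr_eq0.
  by move: gb; rewrite /= /chi /= !exprz_inv -!invr_expz -invfM => ->; rewrite invr1.
Qed.

Lemma expr2z_eq1 (k : int) : (2 : algC) ^ k = 1 -> k = 0.
Proof.
have pos n : (2 : algC) ^+ n = 1 -> n = 0%N.
  by case: n => // n /eqP; rewrite gt_eqF// exprn_egt1// ltr1n.
case: k => k; first by rewrite -exprnP => /pos ->.
by rewrite NegzE -exprnN => /eqP; rewrite invr_eq1 => /eqP/pos.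
Qed.

(** A point of infinite order is the witness: with u a_1 + v a_2 = 1, chi^a takes the value eps at
    (eps^u 2^(-a_2), eps^v 2^(a_1)), while chi^b has absolute value 2 to the power det(a, b). *)
Lemma Vtor_not_sub_kernel a e b : primitive_vec a -> (0 < e)%N ->
  a.1 * b.2 - a.2 * b.1 != 0 -> ~ (Vtor a e `<=` chi_kernel b).
Proof.
move=> pa e0 ab0 sub; have [eps epsP] := C_prim_root_exists e0.
have [u [v uv]] := Bezoutz a.1 a.2; rewrite [gcdz _ _]pa in uv.
have n0 : (2 : algC) != 0 by rewrite pnatr_eq0.
have eps0 : eps != 0.
  apply/eqP => E; have := prim_expr_order epsP.
  by rewrite E expr0n gtn_eqF// => /eqP; rewrite eq_sym oner_eq0.
pose g : algC * algC := (eps ^ u * 2 ^ (- a.2), eps ^ v * 2 ^ a.1).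
have chiE c : chi c g = eps ^ (u * c.1 + v * c.2) * 2 ^ (a.1 * c.2 - a.2 * c.1).
  rewrite /chi /g /= !expfzMl !exprz_exp mulrACA -!expfzDr//.
  congr (_ * _ ^ _); ring.
have : Vtor a e g.
  split; first by split; rewrite /= mulf_neq0// expfz_neq0.
  rewrite /=; have -> : chi a g = eps.
    by rewrite chiE uv [a.2 * _]mulrC subrr expr0z mulr1.
  by rewrite (Cintr_Cyclotomic epsP) root_cyclotomic.
move=> /sub[_] /=; rewrite chiE => /(congr1 Num.norm).
have ne : `|eps| = 1.
  by apply/eqP; rewrite -(@pexpr_eq1 _ _ e)// -normrX (prim_expr_order epsP) normr1.
rewrite normr1 normrM.
have nz (x : algC) (c : int) : `|x ^ c| = `|x| ^ c.
  by case: c => c; rewrite ?NegzE -?exprnP ?normrX// -!exprnN normfV normrX.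
rewrite !nz ne exp1rz mul1r ger0_norm// => /expr2z_eq1.
by apply/eqP.
Qed.

(** Every order at most M divides M!, so strictness is applied to the kernel of the character with
    exponent M! b. *)
Lemma strict_order a e b omega : primitive_vec a -> (0 < e)%N ->
  strict_in (Vtor a e) omega -> a.1 * b.2 - a.2 * b.1 != 0 ->
  forall M, exists l0, forall l, (l0 <= l)%N ->
  forall n, n.-primitive_root (chi b (omega l)) -> (M < n)%N.
Proof.
move=> pa e0 [omV st] ab0 M.
pose f : int := M`!%:Z; pose fb := (f * b.1, f * b.2).
have f0 : f != 0 by rewrite eqz_nat -lt0n fact_gt0.
have [||l0 Hl0] := st (chi_kernel fb); first exact: chi_kernel_subgroup.
  apply: Vtor_not_sub_kernel => //=.
  rewrite (_ : _ - _ = f * (a.1 * b.2 - a.2 * b.1)); last by ring.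
  by rewrite mulf_neq0.
exists l0 => l /Hl0 Hl n pn; rewrite ltnNge; apply/negP => nM; apply: Hl.
have [[g1 g2] _] := omV l; split => //=.
have n0 := prim_order_gt0 pn.
rewrite /chi /= ![f * _]mulrC -!exprz_exp -expfzMl -exprnP.
by apply/eqP; rewrite -(prim_order_dvd pn) dvdn_fact// n0.
Qed.

End Strict.
(** * Arc length on the coset *)

Section Expi.
Variable R : realType.
Implicit Types s t : R.

Lemma expiD s t : expi (s + t) = expi s * expi t.
Proof.
rewrite /expi cosD sinD; apply/eqP; rewrite eq_complex /=.
by apply/andP; split; apply/eqP; ring.
Qed.

Lemma expi0 : expi 0 = 1 :> R[i].
Proof. by rewrite /expi cos0 sin0. Qed.

Lemma normc_expi t : Normc.normc (expi t) = 1.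
Proof. by rewrite /expi /= cos2Dsin2 sqrtr1. Qed.

Lemma expiN t : expi (- t) = (expi t)^-1.
Proof.
have e0 : expi t != 0 by rewrite normc1_neq0// normc_expi.
by apply: (mulfI e0); rewrite -expiD subrr expi0 divff.
Qed.

Lemma expiXn t (n : nat) : expi (n%:R * t) = expi t ^+ n.
Proof.
elim: n => [|n IH]; first by rewrite mul0r expi0 expr0.
by rewrite -natr1 mulrDl mul1r expiD IH exprSr.
Qed.

Lemma expiXz t (k : int) : expi (k%:~R * t) = expi t ^ k.
Proof.
case: k => k; first by rewrite -exprnP -expiXn pmulrn.
by rewrite NegzE -exprnN -expiXn -expiN -mulNr rmorphN pmulrn.
Qed.

Lemma expi_2pi : expi (2 * pi) = 1 :> R[i].
Proof. by rewrite mulr_natl /expi cos2pi sin2pi. Qed.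

Lemma expi_neq1 t : 0 < t < 2 * pi -> expi t != 1.
Proof.
move=> /andP[t0 t2]; apply/eqP => /(congr1 (@complex.Re R)) /=.
have : 0 < sin (t / 2) by rewrite sin_gt0_pi//; apply/andP; split; lra.
have := cos_mulr2n (t / 2); have -> : t / 2 *+ 2 = t by rewrite -mulr_natr; field.
have := cos2Dsin2 (t / 2) => c2 -> s0 E.
have : 0 < sin (t / 2) ^+ 2 by rewrite exprn_gt0.
rewrite -mulr_natr in E; lra.
Qed.

Lemma expi_primitive n : (0 < n)%N -> n.-primitive_root (expi (2 * pi / n%:R : R)).
Proof.
move=> n0; have n0' : n%:R != 0 :> R by rewrite pnatr_eq0 -lt0n.
have en : expi (2 * pi / n%:R : R) ^+ n = 1.
  by rewrite -expiXn mulrC divfK// expi_2pi.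
apply/andP; split => //; apply/forallP => k.
rewrite unity_rootE; apply/eqP; have [kn|kn] := eqVneq k.+1 n.
  by rewrite kn en eqxx.
apply/negbTE; rewrite -expiXn; apply: expi_neq1.
have kn' : (k.+1 < n)%N by rewrite ltn_neqAle kn ltn_ord.
have pi0 := @pi_gt0 R; have np : 0 < n%:R :> R by rewrite ltr0n.
rewrite !mulr_gt0 ?invr_gt0//= mulrA ltr_pdivrMr// mulrC.
by rewrite ltr_pM2l ?ltr_nat// mulr_gt0.
Qed.

End Expi.

Section Tau.
Local Open Scope ereal_scope.
Variable R : realType.
Variables (a : int * int) (e : nat).
Hypotheses (a_prim : primitive_vec a) (e_gt0 : (0 < e)%N).

Lemma measurable_Dtor : measurable (Dtor a e : set (R * R)).
Proof.
pose L (p : nat * int) : set (R * R) := (fun u : R * R =>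
    a.1%:~R * u.1 + a.2%:~R * u.2)%R @^-1`
    [set (2 * pi * p.1%:R / e%:R + 2 * pi * p.2%:~R)%R].
have -> : Dtor a e = \bigcup_(p in [set p : nat * int | (p.1 < e)%N && coprime p.1 e]) L p.
  apply/seteqP; split=> u /=.
    by move=> [j [je cj [k uk]]]; exists (j, k) => //=; rewrite je cj.
  by move=> [[j k] /= /andP[je cj] uk]; exists j; split => //; exists k.
rewrite bigcup_mkcond; apply: countable_bigcupT_measurable => [|[j k]].
  exact: countableP.
case: ifP => // _; rewrite -[X in measurable X]setTI.
have mL : measurable_fun setT (fun u : R * R => a.1%:~R * u.1 + a.2%:~R * u.2)%R.
  by apply: measurable_funD; apply: measurable_funM => //; exact: measurable_cst.
by apply: mL.
Qed.

Lemma ge0_integral_mrestr d (T : measurableType d) (mu : {measure set T -> \bar R})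
    (D : set T) (mD : measurable D) (f : T -> \bar R) :
  measurable_fun setT f -> (forall x, 0 <= f x) ->
  \int[mrestr mu mD]_x f x = \int[mu]_(x in D) f x.
Proof.
move=> mf f0.
have mC : measurable (~` D) by exact: measurableC.
rewrite -(setUv D) ge0_integral_setU//; last 2 first.
- by rewrite setUv.
- by rewrite disj_set2E setICr.
rewrite [X in _ + X]null_set_integral ?adde0//.
- apply: eq_measure_integral => A mA AD; rewrite /= /mrestr.
  by rewrite setIidl.
- exact: measurable_funTS.
- by rewrite /= /mrestr setICl measure0.
Qed.

Lemma mnormalizeE d (T : measurableType d) (mu : {measure set T -> \bar R})
    (P : probability T R) (r : R) (A : set T) : mu setT = r%:E -> (0 < r)%R ->
  mnormalize mu P A = mu A * r^-1%:E.
Proof. by move=> muT r0; rewrite /mnormalize muT /= eqe gt_eqF. Qed.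

(** The speed [vnorm a] occurs in the density and in the total length, and cancels. The parameter
    interval is closed up for the fundamental theorem of calculus. *)
Lemma tau_integral (g : R * R -> \bar R) : measurable_fun setT g ->
  (forall u, 0 <= g u) ->
  \int[tau R a e]_(u in Dtor a e) g u = ((totient e)%:R * (2 * pi))^-1%:E *
   \sum_(j < e | coprime j e)
     \int[lebesgue_measure]_(t in `[0%R, (2 * pi)%R]%classic) g (component a e j t).
Proof.
move=> mg g0; have mD := measurable_Dtor.
have va0 := vnorm_gt0 R a_prim.
have phi0 : (0 < (totient e)%:R :> R)%R by rewrite ltr0n totient_gt0.
have pi0 := @pi_gt0 R.
have N0 : (0 < (totient e)%:R * (2 * pi * vnorm R a) :> R)%R.
  by rewrite !mulr_gt0.
have mgD : measurable_fun (Dtor a e) g by exact: measurable_funTS.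
have c0 : (0 <= ((totient e)%:R * (2 * pi * vnorm R a))^-1 :> R)%R.
  by rewrite invr_ge0 ltW.
transitivity (\int[mscale (NngNum c0) (@arc_length R a e)]_(u in Dtor a e) g u).
  apply: eq_measure_integral => A mA _.
  apply: etrans (mnormalizeE _ _ (arc_length_setT R a e) N0) _; exact: muleC.
rewrite ge0_integral_mscale//.
rewrite ge0_integral_measure_sum// big_mkcond /=.
have term (j : 'I_e) : \int[if coprime j e then @component_length R a e j else mzero]_(u in Dtor a e) g u =
  (vnorm R a)%:E * (if coprime j e then
     \int[lebesgue_measure]_(t in `[0%R, (2 * pi)%R]%classic) g (component a e j t) else 0).
  case: ifPn => cj; last by rewrite integral_measure_zero mule0.
  rewrite ge0_integral_mscale//; congr (_ * _).
  have mc : @measurable_fun _ _ (measurableTypeR R) _ setT (component a e j) :=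
    @measurable_component R a e j.
  have mgc : @measurable_fun _ _ (measurableTypeR R) _ setT (g \o component a e j).
    exact: measurableT_comp.
  pose nu : {measure set (measurableTypeR R) -> \bar R} :=
    mrestr (@lebesgue_measure R) (measurable_itv `[0%R, (2 * pi)%R[).
  have H := ge0_integral_pushforward mc nu mD mgD (fun u _ => g0 u).
  transitivity (\int[pushforward nu (component a e j)]_(u in Dtor a e) g u).
    by apply: eq_measure_integral => A mA _; reflexivity.
  rewrite H.
  have -> : component a e j @^-1` Dtor a e = [set: R].
    by apply/seteqP; split => // t _; exact: component_D.
  rewrite ge0_integral_mrestr//; last by move=> t; exact: g0.
  rewrite integral_itv_bndo_bndc//; exact: measurable_funTS.
under eq_bigr do rewrite term.
rewrite -ge0_sume_distrr; last first.
  move=> j _; case: ifP => // _; exact: integral_ge0.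
rewrite -big_mkcond /= muleA -EFinM; congr (_%:E * _).
move: (vnorm R a) (pi : R) ((totient e)%:R : R) va0 pi0 phi0 => v p t v0 p0 t0.
by field; rewrite !gt_eqF.
Qed.

End Tau.

(** * The measure [tau] as a mean *)

Section TauMean.
Variable R : realType.
Local Notation C := R[i].
Local Notation normc := (@Normc.normc R).
Let normcP : absolute_value normc := normc_absolute_value R.

Definition torus_point (u : R * R) : C * C := (expi u.1, expi u.2).

Lemma on_torus_point u : on_torus (torus_point u).
Proof. by split; exact: normc_expi. Qed.

Lemma monomial_torus_point b u :
  monomial b (torus_point u) = expi (b.1%:~R * u.1 + b.2%:~R * u.2).
Proof. by rewrite /monomial -!expiXz -expiD. Qed.

Lemma Re_mul_expi (c : C) t :
  complex.Re (c * expi t) = complex.Re c * cos t - complex.Im c * sin t.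
Proof. by case: c. Qed.

Lemma torus_lipschitz_bounded (h : C * C -> R) : torus_lipschitz h ->
  exists M, forall z, on_torus z -> `|h z| <= M.
Proof.
move=> [L L0 hL]; exists (`|h (1, 1)| + L * 4) => z [z1 z2].
have o1 : on_torus ((1, 1) : C * C) by split; exact: (abv1 normcP).
have -> : h z = h (1, 1) + (h z - h (1, 1)) by ring.
apply: le_trans (ler_normD _ _) _; rewrite lerD2l.
apply: le_trans (hL _ _ (conj z1 z2) o1) _; rewrite ler_wpM2l//=.
have H w : normc w = 1 -> normc (w - 1) <= 2.
  move=> w1; apply: le_trans (abvB normcP _ _) _; rewrite w1 (abv1 normcP); lra.
by have := H _ z1; have := H _ z2; lra.
Qed.

(** The function is a pointwise limit of trigonometric polynomials in the angles. *)
Lemma measurable_torus_lipschitz h : torus_lipschitz h ->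
  measurable_fun setT (h \o torus_point).
Proof.
move=> hl.
have /choice[F HF] : forall n : nat, exists F : R * R -> R, measurable_fun setT F /\
    forall u, `|h (torus_point u) - F u| <= n.+1%:R^-1.
  move=> n; have n0 : 0 < n.+1%:R^-1 :> R by rewrite invr_gt0.
  have [T [c [b H]]] := trigonometric_approximation hl n0.
  exists (fun u => \sum_t complex.Re (c t * monomial (b t) (torus_point u))).
  split; last by move=> u; apply/H/on_torus_point.
  apply: measurable_sum => t.
  under eq_fun do rewrite monomial_torus_point Re_mul_expi.
  have ml : measurable_fun setT (fun u : R * R =>
      (b t).1%:~R * u.1 + (b t).2%:~R * u.2 : measurableTypeR R).
    by apply: measurable_funD; apply: measurable_funM => //; exact: measurable_cst.
  apply: measurable_funB; apply: measurable_funM; try exact: measurable_cst.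
  - apply: (measurableT_comp (f := (@cos R))) ml; apply: continuous_measurable_fun.
    exact: continuous_cos.
  - apply: (measurableT_comp (f := (@sin R))) ml; apply: continuous_measurable_fun.
    exact: continuous_sin.
apply: (@measurable_fun_cvg _ _ _ _ F) => [m|u _]; first by have [] := HF m.
apply/cvgrPdist_le => eps eps0; near=> n.
have [_ /(_ u) /le_trans] := HF n; apply.
by apply: ltW; near: n; exact: near_infty_natSinv_lt (PosNum eps0).
Unshelve. all: by end_near.
Qed.

Variables (a : int * int) (e : nat).
Hypotheses (a_prim : primitive_vec a) (e_gt0 : (0 < e)%N).

Definition tau_mean (h : C * C -> R) : R :=
  \int[tau R a e]_(u in Dtor a e) h (torus_point u).

Lemma tau_Dtor : tau R a e (Dtor a e) = 1%E.
Proof.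
have mD := @measurable_Dtor R a e.
have := tau_integral (R := R) a_prim e_gt0 (measurable_cst (1%E : \bar R)) (fun=> lee01).
rewrite integral_cst// mul1e => ->.
have pi0 := @pi_gt0 R; have p20 : 0 < 2 * pi :> R by rewrite mulr_gt0.
have cstE : (\int[lebesgue_measure]_(t in `[0%R, (2 * pi)%R]%classic) 1 = (2 * pi : R)%:E)%E.
  rewrite integral_cst ?mul1e//=.
  by rewrite lebesgue_measure_itv /= lte_fin p20 oppr0 adde0.
under eq_bigr do rewrite cstE.
rewrite sumEFin -EFinM; congr EFin; rewrite sumr_const.
have -> : #|[pred j : 'I_e | coprime j e]| = totient e.
  rewrite totient_count_coprime big_mkord -sum1_card big_mkcond /=.
  by apply: eq_bigr => j _; rewrite inE coprime_sym; case: ifP.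
rewrite -[X in _ * X]mulr_natl; apply: mulVf.
by rewrite gt_eqF// mulr_gt0// ltr0n totient_gt0.
Qed.

Lemma tau_integrable h : torus_lipschitz h ->
  (tau R a e).-integrable (Dtor a e) (EFin \o (h \o torus_point)).
Proof.
move=> hl; apply: measurable_bounded_integrable.
- exact: measurable_Dtor.
- apply: le_lt_trans (ltry 1); rewrite -tau_Dtor; exact: lexx.
- by apply: measurable_funTS; exact: measurable_torus_lipschitz.
have [M HM] := torus_lipschitz_bounded hl.
exists M; split; first exact: num_real.
move=> x Mx u _; apply: le_trans (HM _ (on_torus_point u)) (ltW Mx).
Qed.

Lemma tau_meanP : mean tau_mean.
Proof.
have mD := @measurable_Dtor R a e.
split.
- by move=> g h gl hl; apply: RintegralD => //; exact: tau_integrable.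
- by move=> c h hl; apply: RintegralZl => //; exact: tau_integrable.
- move=> g h gl hl gh; apply: le_Rintegral => //; try exact: tau_integrable.
  by move=> u _; apply/gh/on_torus_point.
- rewrite /tau_mean Rintegral_cst//= ?mul1r//. by rewrite tau_Dtor.
Qed.

End TauMean.

(** * Integrals of characters over the components *)

Section TauMonomial.
Variable R : realType.
Local Notation C := R[i].
Local Notation normc := (@Normc.normc R).
Let normcP : absolute_value normc := normc_absolute_value R.

Lemma is_derive_affine (al D t : R) : is_derive t 1 (fun s : R => al + D * s) D.
Proof.
have -> : (fun s : R => al + D * s) = cst al + D *: (id : R -> R) by [].
have H := is_deriveD (is_derive_cst al t 1) (is_deriveZ D (is_derive_id t 1)).
by apply: (@is_derive_eq _ _ _ _ _ _ _ _ H); rewrite add0r /GRing.scale /= mulr1.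
Qed.

Lemma is_derive_trig (A B K al D t : R) : D != 0 ->
  is_derive t 1 (fun s => K * s + D^-1 * (A * sin (al + D * s) + B * cos (al + D * s)))
    (K + (A * cos (al + D * t) - B * sin (al + D * t))).
Proof.
move=> D0.
have ds : is_derive t 1 (fun s : R => sin (al + D * s)) (cos (al + D * t) * D).
  exact: (is_derive1_comp (is_derive_sin _) (is_derive_affine al D t)).
have dc : is_derive t 1 (fun s : R => cos (al + D * s)) (- sin (al + D * t) * D).
  exact: (is_derive1_comp (is_derive_cos _) (is_derive_affine al D t)).
set S := fun s => sin _ in ds *; set Co := fun s => cos _ in dc *.
have -> : (fun s => K * s + D^-1 * (A * sin (al + D * s) + B * cos (al + D * s))) =
   K *: (id : R -> R) + D^-1 *: (A *: S + B *: Co) by [].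
have H := is_deriveD (is_deriveZ K (is_derive_id t 1))
  (is_deriveZ D^-1 (is_deriveD (is_deriveZ A ds) (is_deriveZ B dc))).
apply: (@is_derive_eq _ _ _ _ _ _ _ _ H); rewrite /GRing.scale /=.
by move: (cos _) (sin _) => x y; field.
Qed.

Lemma integral_trig (A B K al : R) (D : int) : D != 0 ->
  (\int[lebesgue_measure]_(t in `[0%R, (2 * pi)%R])
     (K + (A * cos (al + D%:~R * t) - B * sin (al + D%:~R * t)))%:E = (2 * pi * K)%:E)%E.
Proof.
move=> D0; have D0' : D%:~R != 0 :> R by rewrite intr_eq0.
have dF t := is_derive_trig A B K al t D0'.
set F := fun s => K * s + _ in dF.
set f := fun t => K + (A * cos (al + D%:~R * t) - B * sin (al + D%:~R * t)) in dF *.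
have cF : continuous F.
  move=> t; apply: differentiable_continuous; apply/derivable1_diffP.
  by have [] := dF t.
have cf : continuous f.
  move=> t; apply: differentiable_continuous; apply/derivable1_diffP.
  pose f' : R -> R := fun t => K + (A * cos (al + D%:~R * t) - B * sin (al + D%:~R * t)).
  have ds : derivable (fun s : R => sin (al + D%:~R * s)) t 1.
    by have [] := is_derive1_comp (is_derive_sin _) (is_derive_affine al D%:~R t).
  have dc : derivable (fun s : R => cos (al + D%:~R * s)) t 1.
    by have [] := is_derive1_comp (is_derive_cos _) (is_derive_affine al D%:~R t).
  apply: derivableD; first exact: derivable_cst.
  by apply: derivableB; exact: derivableZ.
have pi0 := @pi_gt0 R; have p20 : 0 < 2 * pi :> R by rewrite mulr_gt0.
rewrite (continuous_FTC2 p20 (F := F)).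
- rewrite -EFinB; congr EFin; rewrite /F !mulr0 addr0.
  have := expiD al (D%:~R * (2 * pi)); rewrite expiXz expi_2pi exp1rz mulr1.
  by rewrite /expi => -[-> ->]; ring.
- exact: continuous_subspaceT.
- split.
  + by move=> t _; have [] := dF t.
  + by apply: cvg_at_right_filter; exact: cF.
  + by apply: cvg_at_left_filter; exact: cF.
- by move=> t _; rewrite derive1E; have [_] := dF t.
Qed.

Variables (a : int * int) (e : nat).
Hypotheses (a_prim : primitive_vec a) (e_gt0 : (0 < e)%N).

(** The slope in t is the integer det(a, b): along a component chi^b is constant if b is parallel to
    a and runs through full periods otherwise. *)
Lemma component_monomial b j t : monomial b (torus_point (component a e j t)) =
  expi (2 * pi * j%:R / (e%:R * vnorm R a ^+ 2) * (b.1 * a.1 + b.2 * a.2)%:~R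
    + (a.1 * b.2 - a.2 * b.1)%:~R * t).
Proof.
rewrite monomial_torus_point /component /= intrD intrB !intrM; congr expi; ring.
Qed.

(** Adding [normc c] makes the integrand nonnegative, as [tau_integral] demands; [tau_mean_monomial]
    subtracts it again. *)
Lemma integral_component_monomial c b j :
  (\int[lebesgue_measure]_(t in `[0%R, (2 * pi)%R])
   (normc c + complex.Re (c * monomial b (torus_point (component a e j t))))%:E =
  (2 * pi * (normc c + if a.1 * b.2 - a.2 * b.1 == 0 then
      complex.Re (c * monomial b (torus_point (component a e j 0))) else 0))%:E)%E.
Proof.
have pi0 := @pi_gt0 R; have p20 : 0 < 2 * pi :> R by rewrite mulr_gt0.
case: eqP => [D0|/eqP D0].
  rewrite component_monomial D0 mul0r addr0.
  under eq_integral do rewrite component_monomial D0 mul0r addr0.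
  rewrite integral_cst//= lebesgue_measure_itv /= lte_fin p20 oppr0 adde0.
  by rewrite -EFinM mulrC.
under eq_integral do rewrite component_monomial Re_mul_expi.
by rewrite integral_trig// addr0.
Qed.

Lemma tau_mean_monomial c b :
  @tau_mean R a e (fun z => complex.Re (c * monomial b z)) =
  if a.1 * b.2 - a.2 * b.1 == 0 then (totient e)%:R^-1 *
     \sum_(j < e | coprime j e) complex.Re (c * monomial b (torus_point (component a e j 0)))
  else 0.
Proof.
have pi0 := @pi_gt0 R; have p20 : 0 < 2 * pi :> R by rewrite mulr_gt0.
have phi0 : 0 < (totient e)%:R :> R by rewrite ltr0n totient_gt0.
have Im := tau_meanP R a_prim e_gt0; have [ID _ _ _] := Im.
pose h z := normc c + complex.Re (c * monomial b z).
have hl : torus_lipschitz h.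
  by apply: torus_lipschitzD; [exact: torus_lipschitz_cst|exact: torus_lipschitz_monomial].
suff : tau_mean a e h = normc c + if a.1 * b.2 - a.2 * b.1 == 0 then (totient e)%:R^-1 *
     \sum_(j < e | coprime j e) complex.Re (c * monomial b (torus_point (component a e j 0)))
  else 0.
  rewrite /h ID ?(mean_cst _ Im)//; first by move=> /addrI.
  - exact: torus_lipschitz_cst.
  - exact: torus_lipschitz_monomial.
have h0 u : (0 <= (h (torus_point u))%:E)%E.
  rewrite lee_fin /h; have := normc_ge_Re (c * monomial b (torus_point u)).
  rewrite (abvM normcP) (normc_monomial _ (on_torus_point u)) mulr1 ler_norml => /andP[].
  lra.
have mh : measurable_fun setT (fun u : R * R => (h (torus_point u))%:E).
  by apply/measurable_EFinP; exact: measurable_torus_lipschitz.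
rewrite /tau_mean /Rintegral tau_integral//.
under eq_bigr do rewrite integral_component_monomial.
rewrite sumEFin -EFinM /= -mulr_sumr big_split /= sumr_const.
have -> : #|[pred j : 'I_e | coprime j e]| = totient e.
  rewrite totient_count_coprime big_mkord -sum1_card big_mkcond /=.
  by apply: eq_bigr => j _; rewrite inE coprime_sym; case: ifP.
rewrite -(mulr_natl (normc c) (totient e)).
case: ifP => _; last rewrite big1// ?addr0.
all: move: (pi : R) pi0 ((totient e)%:R : R) phi0 => p p0 t t0; field; by rewrite !gt_eqF.
Qed.

End TauMonomial.
(** * Heights as averages *)

Section HeightAverage.
Variable R : realType.
Local Notation C := R[i].
Local Notation normc := (@Normc.normc R).
Let normcP : absolute_value normc := normc_absolute_value R.

(** This is exp f in the coordinates of the torus. *)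
Definition torus_sup (z : C * C) : R :=
  Num.max (normc (z.2 - z.1)) (Num.max (normc (z.2 - 1)) (normc (z.1 - 1))).

Definition average n (z : 'I_n -> C * C) (h : C * C -> R) : R :=
  n%:R^-1 * \sum_i h (z i).

Lemma averageP n (z : 'I_n -> C * C) : (0 < n)%N ->
  (forall i, on_torus (z i)) -> mean (average z).
Proof.
move=> n0 zt; have n0' : n%:R != 0 :> R by rewrite pnatr_eq0 -lt0n.
rewrite /average; split.
- by move=> g h _ _; rewrite big_split mulrDr.
- by move=> c h _; rewrite -mulr_sumr mulrCA.
- move=> g h _ _ gh; rewrite ler_wpM2l ?invr_ge0//; apply: ler_sum => i _.
  exact: gh.
- by rewrite sumr_const card_ord mulVf.
Qed.

Lemma abv_subV (F : fieldType) (w : F -> R) (x y : F) : absolute_value w ->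
  w x = 1 -> w y = 1 -> w (x^-1 - y^-1) = w (x - y).
Proof.
move=> Hw x1 y1; have x0 : x != 0 by rewrite -(abv_gt0 Hw) x1.
have y0 : y != 0 by rewrite -(abv_gt0 Hw) y1.
have -> : x^-1 - y^-1 = (y - x) / (x * y) by field; rewrite x0 y0.
by rewrite (abvM Hw) (abvV Hw) (abvM Hw) x1 y1 mulr1 invr1 mulr1 (abv_distC Hw).
Qed.

Lemma max3E (F : 'I_3 -> R) : (forall i, 0 <= F i) ->
  \big[Num.max/0]_i F i = Num.max (F 0) (Num.max (F 1) (F (1 + 1))).
Proof.
move=> F0; rewrite !big_ord_recl big_ord0.
rewrite (max_l (F0 _)); congr (Num.max (F _) (Num.max (F _) (F _))); exact: val_inj.
Qed.

(** The height is read off in one unspecified number field. Such a field exists, the coordinates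
    being algebraic, so the default value 0 of [xget] does not interfere. *)
Lemma inter_height_number_field g : exists (K : fieldExtType rat)
    (iota : {rmorphism K -> algC}) (y : 'rV[K]_3),
  map_mx iota y = inter_point g /\ inter_height R g = height_over R y.
Proof.
rewrite /inter_height /height; case: xgetP => [h _ [K [iota [y [yE ->]]]]|H].
  by exists K, iota, y.
have [K [iota [s1 sE _]]] := num_field_exists
  [seq inter_point g 0 i | i : 'I_3].
have sz : size s1 = 3 by rewrite -(size_map iota) sE size_map size_enum_ord.
case: (H (height_over R (\row_(i < 3) s1`_i))); exists K, iota, (\row_i s1`_i).
split=> //; apply/rowP => i; rewrite !mxE -(nth_map _ 0) ?sz// sE.
by rewrite (nth_map ord0) ?size_enum_ord// nth_ord_enum mxE.
Qed.

(** The points [z i] are the images of g under the embeddings of K. The function G is arbitrary, so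
    the average formula also applies to the logarithm of |1 - y|. *)
Lemma inter_height_average g : nontrivial_torsion_point g ->
  exists n (z : 'I_n -> C * C), [/\ (0 < n)%N, forall i, on_torus (z i),
    forall b N, N.-primitive_root (chi b g) ->
      (forall i, N.-primitive_root (monomial b (z i))) /\
      forall zeta (G : C -> R), N.-primitive_root zeta ->
        average z (fun x => G (monomial b x)) =
        (totient N)%:R^-1 * \sum_(y <- primitive_powers zeta N) G y
  & forall N, (1 < N)%N -> N.-primitive_root g.1 \/ N.-primitive_root g.2 ->
      `|inter_height R g - average z (@ln R \o torus_sup)| <= ln N%:R / (totient N)%:R].
Proof.
move=> [[[m1 m10 g1] [m2 m20 g2]] g11].
have [K [iota [y [yE ->]]]] := inter_height_number_field g.
have [theta [sigma [sinj sgen srat]]] := number_field_embeddings K R[i].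
(* K is only known to contain the coordinates of the intersection point; those of g are recovered
   from them. *)
pose t1 : K := (1 + y 0 (1 + 1))^-1; pose t2 : K := (1 - y 0 1)^-1.
have i1 : iota t1 = g.1.
  have := congr1 (fun M : 'rV_3 => M 0 (1 + 1)) yE; rewrite !mxE /= => E.
  by rewrite fmorphV rmorphD rmorph1 E addrC subrK invrK.
have i2 : iota t2 = g.2.
  have := congr1 (fun M : 'rV_3 => M 0 1) yE; rewrite !mxE /= => E.
  by rewrite fmorphV rmorphB rmorph1 E opprB addrC subrK invrK.
have y1 : y 0 1 = 1 - t2^-1 by rewrite invrK; ring.
have y2 : y 0 (1 + 1) = t1^-1 - 1 by rewrite invrK; ring.
clearbody t1 t2; have y0 : y 0 0 = t2^-1 - t1^-1.
  apply: (fmorph_inj iota); rewrite rmorphB !fmorphV i1 i2.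
  by have := congr1 (fun M : 'rV_3 => M 0 0) yE; rewrite !mxE.
have t1X : t1 ^+ m1 = 1 by apply: (fmorph_inj iota); rewrite rmorphXn /= i1 g1 rmorph1.
have t2X : t2 ^+ m2 = 1 by apply: (fmorph_inj iota); rewrite rmorphXn /= i2 g2 rmorph1.
have w1 (w : K -> R) : absolute_value w -> w t1 = 1.
  by move=> Hw; exact: (abv_root1 Hw m10).
have w2 (w : K -> R) : absolute_value w -> w t2 = 1.
  by move=> Hw; exact: (abv_root1 Hw m20).
have wy0 (w : K -> R) : absolute_value w -> w (y 0 0) = w (t2 - t1).
  by move=> Hw; rewrite y0 (abv_subV Hw) ?w1 ?w2.
have wy1 (w : K -> R) : absolute_value w -> w (y 0 1) = w (1 - t2).
  by move=> Hw; rewrite y1 -[in LHS]invr1 (abv_subV Hw) ?w2// (abv1 Hw).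
have wy2 (w : K -> R) : absolute_value w -> w (y 0 (1 + 1)) = w (1 - t1).
  by move=> Hw; rewrite y2 -[X in _ - X]invr1 (abv_subV Hw) ?w1 ?(abv1 Hw)// (abv_distC Hw).
have n0 : (0 < \dim {:K})%N by rewrite adim_gt0.
exists (\dim {:K}), (fun i => (sigma i t1, sigma i t2)).
have Hs i : absolute_value (normc \o sigma i) := absolute_value_comp (sigma i) normcP.
split=> //.
- by move=> i; split => /=; [exact: (w1 _ (Hs i))|exact: (w2 _ (Hs i))].
- move=> b N bN; have xN : N.-primitive_root (t1 ^ b.1 * t2 ^ b.2).
    by rewrite -(fmorph_primitive_root iota) rmorphM !fmorphXz i1 i2.
  split=> [i|zeta G zN].
    by rewrite /monomial /= -!fmorphXz -rmorphM fmorph_primitive_root.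
  have := sum_embeddings_primitive_root G (srat _) xN zN.
  have phi0 : (totient N)%:R != 0 :> R.
    by rewrite pnatr_eq0 -lt0n totient_gt0 (prim_order_gt0 zN).
  move=> H; rewrite /average; apply: (mulfI phi0); rewrite mulrCA mulVKf//.
  have n0' : (\dim {:K})%:R != 0 :> R by rewrite pnatr_eq0 -lt0n.
  rewrite -[RHS](mulKf n0') -H; congr (_ * (_ * _)); apply: eq_bigr => i _.
  by rewrite rmorphM !fmorphXz.
move=> N N1 gN; have : exists (i0 : 'I_3) (s : K), N.-primitive_root s /\
    forall w : K -> R, absolute_value w -> w (y 0 i0) = w (1 - s).
  case: gN => gN; [exists (1 + 1), t1|exists 1, t2].
  - by rewrite -(fmorph_primitive_root iota) i1.
  - by rewrite -(fmorph_primitive_root iota) i2.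
move=> [i0 [s [sN sE]]].
have fin p w : prime p -> extends (rat_abs R (Some p)) w -> forall i, w (y 0 i) <= 1.
  move=> pp ew i; have [Hw _] := ew.
  have [->|->|->] : [\/ i = 0, i = 1 | i = 1 + 1].
    by case: i => -[|[|[|k]]] // ?;
      [constructor 1|constructor 2|constructor 3]; exact: val_inj.
  - by rewrite wy0//; apply: (finite_absB_le1 pp ew); rewrite ?w1 ?w2.
  - by rewrite wy1//; apply: (finite_absB_le1 pp ew); rewrite ?(abv1 Hw) ?w2.
  - by rewrite wy2//; apply: (finite_absB_le1 pp ew); rewrite ?(abv1 Hw) ?w1.
have [T [T01 ->]] := height_over_torsion N1 sN
  (fun p w (_ : prime p) (ew : extends (rat_abs R (Some p)) w) => sE w ew.1) fin.
rewrite (sum_archimedean_places sinj sgen srat).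
have -> : (\dim {:K})%:R^-1 * \sum_i ln (\big[Num.max/0]_(j < 3) arch_abs sigma i (y 0 j)) =
    average (fun i => (sigma i t1, sigma i t2)) (@ln R \o torus_sup).
  rewrite /average; congr (_ * _); apply: eq_bigr => i _ /=.
  rewrite max3E => [|j]; last exact: (abv_ge0 (Hs i)).
  rewrite /arch_abs wy0// wy1// wy2// /torus_sup /= !rmorphB rmorph1.
  by rewrite ![normc (1 - _)](abv_distC normcP).
rewrite addrAC subrr add0r ler_norml; move: T01 => /andP[-> /le_trans]; apply.
by rewrite divr_ge0// ln_ge0// ler1n ltnW.
Qed.

End HeightAverage.
(** * The logarithmic singularity *)

Section LogDistance.
Variable R : realType.
Local Notation C := R[i].
Local Notation normc := (@Normc.normc R).
Let normcP : absolute_value normc := normc_absolute_value R.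

Lemma dist_max_le (x y x' y' : R) :
  `|Num.max x y - Num.max x' y'| <= `|x - x'| + `|y - y'|.
Proof.
have := ler_norm (x - x'); have := ler_norm (y - y').
have := ler_norm (x' - x); have := ler_norm (y' - y).
rewrite (distrC x') (distrC y') ler_norml.
have := normr_ge0 (x - x'); have := normr_ge0 (y - y').
by case: (leP x y) => h1; case: (leP x' y') => h2; lra.
Qed.

Lemma dist_ln_le (d x y : R) : 0 < d -> d <= x -> d <= y ->
  `|ln x - ln y| <= d^-1 * `|x - y|.
Proof.
move=> d0; wlog yx : x y / y <= x => [H dx dy|dx dy].
  case: (leP y x) => [/H|/ltW/H]; first exact.
  by rewrite distrC (distrC x); apply.
have y0 : 0 < y by exact: lt_le_trans dy.
have x0 : 0 < x by exact: lt_le_trans dx.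
rewrite !ger0_norm ?subr_ge0 ?ler_ln ?posrE//.
rewrite -ln_div ?posrE//.
have -> : x / y = 1 + (x - y) / y by field; rewrite gt_eqF.
apply: le_trans (le_ln1Dx _) _.
  by apply: lt_le_trans (_ : 0 <= _); rewrite ?ltrN10// divr_ge0 ?subr_ge0// ltW.
by rewrite mulrC ler_wpM2r ?subr_ge0// lef_pV2.
Qed.

Lemma torus_lipschitz_max g h : torus_lipschitz g -> torus_lipschitz h ->
  torus_lipschitz (fun z => Num.max (g z) (h z) : R).
Proof.
move=> [L L0 gL] [L' L'0 hL]; exists (L + L'); first exact: addr_ge0.
move=> z w zt wt; rewrite mulrDl.
by apply: le_trans (dist_max_le _ _ _ _) _; rewrite lerD ?gL ?hL.
Qed.

Lemma torus_lipschitz_ln_max h d : torus_lipschitz h -> 0 < d ->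
  torus_lipschitz (fun z => ln (Num.max (h z) d) : R).
Proof.
move=> hl d0.
have [L L0 HL] := torus_lipschitz_max hl (torus_lipschitz_cst d).
exists (d^-1 * L); first by rewrite mulr_ge0// invr_ge0 ltW.
move=> z w zt wt; apply: le_trans (dist_ln_le d0 _ _) _; rewrite ?le_max ?lexx ?orbT//.
by rewrite -mulrA ler_wpM2l ?invr_ge0 ?(ltW d0)// HL.
Qed.

Lemma dist_normc_le (x y : C) : `|normc x - normc y| <= normc (x - y).
Proof.
rewrite ler_norml (abv_sub_le normcP) andbT lerNl opprB (abv_distC normcP).
exact: (abv_sub_le normcP).
Qed.

Lemma torus_lipschitz_normc (p : C * C -> C) :
  (forall z w, normc (p z - p w) <= normc (z.1 - w.1) + normc (z.2 - w.2)) ->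
  torus_lipschitz (normc \o p).
Proof.
move=> pL; exists 1 => // z w _ _; rewrite mul1r.
exact: le_trans (dist_normc_le _ _) (pL z w).
Qed.

Lemma torus_lipschitz_sup : torus_lipschitz (@torus_sup R).
Proof.
have n0 := abv_ge0 normcP.
apply: torus_lipschitz_max; last apply: torus_lipschitz_max.
- apply: (@torus_lipschitz_normc (fun z => z.2 - z.1)) => z w.
  have -> : z.2 - z.1 - (w.2 - w.1) = - (z.1 - w.1) + (z.2 - w.2) by ring.
  by apply: le_trans (abvD normcP _ _) _; rewrite (abvN normcP).
- apply: (@torus_lipschitz_normc (fun z => z.2 - 1)) => z w.
  have -> : z.2 - 1 - (w.2 - 1) = z.2 - w.2 by ring.
  by rewrite lerDr n0.
- apply: (@torus_lipschitz_normc (fun z => z.1 - 1)) => z w.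
  have -> : z.1 - 1 - (w.1 - 1) = z.1 - w.1 by ring.
  by rewrite lerDl n0.
Qed.

Definition ln_dist (d : R) (y : C) : R := ln (Num.max (normc (1 - y)) d).

Lemma torus_lipschitz_ln_dist d : 0 < d -> torus_lipschitz (fun z => ln_dist d z.1).
Proof.
move=> d0; apply: torus_lipschitz_ln_max => //.
apply: (@torus_lipschitz_normc (fun z => 1 - z.1)) => z w.
have -> : 1 - z.1 - (1 - w.1) = - (z.1 - w.1) by ring.
by rewrite (abvN normcP) lerDl (abv_ge0 normcP).
Qed.

(** A function of s chi^b is a function of the first coordinate composed with this self-map of the
    torus, so that measures on the circle can be handled as means on the torus. *)
Definition twist (s : C) b (z : C * C) : C * C := (s * monomial b z, 1).

Lemma on_torus_twist s b z : normc s = 1 -> on_torus z -> on_torus (twist s b z).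
Proof.
move=> s1 zt; split; last exact: (abv1 normcP).
by rewrite /= (abvM normcP) s1 normc_monomial// mul1r.
Qed.

Lemma torus_lipschitz_twist h s b : normc s = 1 -> torus_lipschitz h ->
  torus_lipschitz (h \o twist s b).
Proof.
move=> s1 [L L0 hL]; exists (L * (`|b.1|%N%:R + `|b.2|%N%:R)).
  by rewrite mulr_ge0// addr_ge0.
move=> z w zt wt; apply: le_trans (hL _ _ (on_torus_twist b s1 zt) (on_torus_twist b s1 wt)) _.
have -> : (twist s b z).2 - (twist s b w).2 = 0 by exact: subrr.
have -> : (twist s b z).1 - (twist s b w).1 = s * (monomial b z - monomial b w).
  by rewrite mulrBr.
rewrite (abv0 normcP) addr0 (abvM normcP) s1 mul1r -mulrA ler_wpM2l//.
apply: le_trans (normc_monomial_sub_le b zt wt) _.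
rewrite mulrDl !mulrDr; have H n x : 0 <= (n%:R : R) * normc x.
  by rewrite mulr_ge0 ?(abv_ge0 normcP).
have := H `|b.1|%N (z.2 - w.2); have := H `|b.2|%N (z.1 - w.1); lra.
Qed.

Lemma mean_twist I s b : mean I -> normc s = 1 -> mean (fun h => I (h \o twist s b)).
Proof.
move=> [ID IZ IM I1] s1; have tl := torus_lipschitz_twist b s1.
split=> [g h gl hl|c h hl|g h gl hl gh|//].
- by rewrite -ID//; exact: tl.
- by rewrite -IZ//; exact: tl.
- by apply: IM; [exact: tl|exact: tl|move=> z zt; exact/gh/on_torus_twist].
Qed.

Lemma mean_unique (I J : (C * C -> R) -> R) : mean I -> mean J ->
  (forall c b, I (fun z => complex.Re (c * monomial b z)) =
               J (fun z => complex.Re (c * monomial b z))) ->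
  forall h, torus_lipschitz h -> I h = J h.
Proof.
move=> Im Jm IJ h hl.
have H := weyl_criterion (fun=> Im) Jm (fun c b => _) hl.
have {}H : I h @[_ --> \oo] --> J h by apply: H => c b; rewrite IJ; exact: cvg_cst.
exact: cvg_unique (cvg_cst _) H.
Qed.

(** Put p = |1 - y| and q = |1 + y|, so that |1 - y^2| = p q and p^2 + q^2 = 4. One of p, q is at
    least 1, which gives the lower bound; both are at most 2, so a factor truncated at d leaves a
    product of at most 2 d. *)
Lemma ln_dist_sqr (d : R) (y : C) : normc y = 1 -> 0 < d <= 1 ->
  ln_dist d (y ^+ 2) <= ln_dist d y + ln_dist d (- y) <= ln_dist (2 * d) (y ^+ 2).
Proof.
move=> y1 /andP[d0 d1]; rewrite /ln_dist opprK.
have -> : 1 - y ^+ 2 = (1 - y) * (1 + y) by ring.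
rewrite (abvM normcP) -lnM ?posrE ?lt_max ?d0 ?orbT//.
have := normc_parallelogram y1.
have p0 := abv_ge0 normcP (1 - y); have q0 := abv_ge0 normcP (1 + y).
have p2 : normc (1 - y) <= 2.
  by apply: le_trans (abvB normcP _ _) _; rewrite (abv1 normcP) y1; lra.
have q2 : normc (1 + y) <= 2.
  by apply: le_trans (abvD normcP _ _) _; rewrite (abv1 normcP) y1; lra.
move: p0 q0 p2 q2; set p := normc (1 - y); set q := normc (1 + y).
move=> p0 q0 p2 q2 pq; clearbody p q.
have pm : p <= Num.max p d by rewrite le_max lexx.
have qm : q <= Num.max q d by rewrite le_max lexx.
have dp : d <= Num.max p d by rewrite le_max lexx orbT.
have dq : d <= Num.max q d by rewrite le_max lexx orbT.
have M0 : 0 < Num.max p d * Num.max q d by rewrite mulr_gt0// (lt_le_trans d0).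
have l1 : 0 < Num.max (p * q) d by rewrite lt_max d0 orbT.
have l2 : 0 < Num.max (p * q) (2 * d) by rewrite lt_max [X in _ || X]mulr_gt0 ?orbT.
rewrite !ler_ln ?posrE//.
apply/andP; split.
  rewrite ge_max ler_pM//=.
  have [p1|p1] := leP 1 p.
    by rewrite -[leLHS]mul1r ler_pM// ?(ltW d0)// (le_trans p1).
  have q1 : 1 <= q by nra.
  by rewrite -[leLHS]mulr1 ler_pM// ?(ltW d0)// (le_trans q1).
rewrite le_max; case: (leP p d) => pd; last case: (leP q d) => qd.
- by apply/orP; right; rewrite mulrC ler_pM2r// ge_max q2; lra.
- by apply/orP; right; rewrite ler_pM2r.
- by rewrite lexx.
Qed.

End LogDistance.

(** * Integrals of the truncated logarithmic distance *)

Section TauLogDistance.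
Variable R : realType.
Local Notation C := R[i].
Local Notation normc := (@Normc.normc R).
Let normcP : absolute_value normc := normc_absolute_value R.
Variables (a : int * int) (e : nat).
Hypotheses (a_prim : primitive_vec a) (e_gt0 : (0 < e)%N).

Local Notation I := (@tau_mean R a e).
Let ImP : mean I := tau_meanP R a_prim e_gt0.
Local Notation transversal b := (a.1 * b.2 - a.2 * b.1 != 0).

Lemma twist_monomial c s b k (z : C * C) :
  c * monomial k (twist s b z) = c * s ^ k.1 * monomial (b.1 * k.1, b.2 * k.1) z.
Proof.
rewrite /monomial /twist /= exp1rz mulr1 !expfzMl !exprz_exp; ring.
Qed.

Lemma tau_mean_twist_monomial c s b k : transversal b ->
  I (fun z => complex.Re (c * monomial k (twist s b z))) =
  if k.1 == 0 then complex.Re c else 0.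
Proof.
move=> Db; under eq_fun do rewrite twist_monomial.
case: eqP => [->|/eqP k0].
  rewrite -[RHS](mean_cst (complex.Re c) ImP); congr I; apply/funext => z.
  by rewrite !mulr0 /monomial !expr0z !mulr1.
rewrite tau_mean_monomial//= ifN//.
have -> : a.1 * (b.2 * k.1) - a.2 * (b.1 * k.1) = (a.1 * b.2 - a.2 * b.1) * k.1 by ring.
exact: mulf_neq0.
Qed.

(** For transversal b the image of [tau] under s chi^b is the Haar measure of the circle, whatever s
    and b are; on monomials only the trivial frequency survives. *)
Lemma tau_mean_twist s s' b b' h : normc s = 1 -> normc s' = 1 ->
  transversal b -> transversal b' -> torus_lipschitz h ->
  I (h \o twist s b) = I (h \o twist s' b').
Proof.
move=> s1 s1' Db Db'; apply: (mean_unique (mean_twist b ImP s1) (mean_twist b' ImP s1')).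
move=> c k; rewrite /comp; etransitivity; first exact: tau_mean_twist_monomial.
by apply/esym; exact: tau_mean_twist_monomial.
Qed.

Variable b : int * int.
Hypothesis Db : transversal b.

Lemma torus_lipschitz_ln_dist_monomial d c : 0 < d ->
  torus_lipschitz (fun z => ln_dist d (monomial c z) : R).
Proof.
move=> d0; have := torus_lipschitz_twist c (abv1 normcP) (torus_lipschitz_ln_dist d0).
by rewrite /comp /=; under eq_fun do rewrite mul1r.
Qed.

Definition tau_ln_dist d := I (fun z => ln_dist d (monomial b z)).

Lemma tau_ln_dist_twist d s c : 0 < d -> normc s = 1 -> transversal c ->
  I (fun z => ln_dist d (s * monomial c z)) = tau_ln_dist d.
Proof.
move=> d0 s1 Dc; have := tau_mean_twist s1 (abv1 normcP) Dc Db (torus_lipschitz_ln_dist d0).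
by rewrite /comp /= => ->; rewrite /tau_ln_dist; under eq_fun do rewrite mul1r.
Qed.

(* The mean is invariant under [y |-> - y] and [y |-> y ^+ 2], where [y] is the value
   of the character, so that the factorization of [1 - y ^+ 2] gives a doubling
   inequality. *)
Lemma tau_ln_dist_double d : 0 < d <= 1 ->
  tau_ln_dist d <= 2 * tau_ln_dist d <= tau_ln_dist (2 * d).
Proof.
move=> d01; have /andP[d0 d1] := d01; have d20 : 0 < 2 * d by rewrite mulr_gt0.
pose b2 := (b.1 * 2, b.2 * 2).
have Db2 : transversal b2.
  have -> : a.1 * b2.2 - a.2 * b2.1 = (a.1 * b.2 - a.2 * b.1) * 2 by rewrite /=; ring.
  by rewrite mulf_neq0.
have sq x : 0 < x -> tau_ln_dist x = I (fun z => ln_dist x (monomial b z ^+ 2)).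
  move=> x0; rewrite -(tau_ln_dist_twist x0 (abv1 normcP) Db2); congr I; apply/funext => z.
  by rewrite mul1r /monomial exprMn -!exprz_exp.
have N1 : normc (-1) = 1 by rewrite (abvN normcP) (abv1 normcP).
have [ID _ IM _] := ImP.
have l2 x : 0 < x -> torus_lipschitz (fun z => ln_dist x (monomial b z ^+ 2) : R).
  move=> x0; have := torus_lipschitz_ln_dist_monomial b2 x0.
  by congr torus_lipschitz; apply/funext => z; rewrite /monomial exprMn -!exprz_exp.
have lN : torus_lipschitz (fun z => ln_dist d (- monomial b z) : R).
  have := torus_lipschitz_twist b N1 (torus_lipschitz_ln_dist d0).
  by rewrite /comp /=; under eq_fun do rewrite mulN1r.
have lP := torus_lipschitz_ln_dist_monomial b d0.
have -> : 2 * tau_ln_dist d = I (fun z => ln_dist d (monomial b z) + ln_dist d (- monomial b z)).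
  rewrite ID// mulr_natl mulr2n; congr (_ + _).
  by rewrite -(tau_ln_dist_twist d0 N1 Db); under eq_fun do rewrite mulN1r.
rewrite (sq _ d0) (sq _ d20); apply/andP; split; apply: IM; try exact: l2;
  try exact: torus_lipschitzD.
- by move=> z zt; have /andP[] := ln_dist_sqr (normc_monomial b zt) d01.
- by move=> z zt; have /andP[] := ln_dist_sqr (normc_monomial b zt) d01.
Qed.

(** The induction starts from ln 2 at d = 1, because |1 - y| <= 2. Nonnegativity is the inequality J
    <= 2 J in [tau_ln_dist_double]. *)
Lemma tau_ln_dist_small n : 0 <= tau_ln_dist (2^-1 ^+ n) <= 2^-1 ^+ n * ln 2.
Proof.
have h01 m : 0 < (2^-1 ^+ m : R) <= 1.
  by rewrite exprn_gt0 ?invr_gt0// exprn_ile1 ?invr_ge0// invf_le1// ler1n.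
apply/andP; split; first by have /andP[+ _] := tau_ln_dist_double (h01 n); lra.
elim: n => [|n IH].
  rewrite expr0 mul1r -[leRHS](mean_cst _ ImP); have [_ _ IM _] := ImP.
  apply: IM; [exact: torus_lipschitz_ln_dist_monomial|exact: torus_lipschitz_cst|].
  move=> z zt; rewrite /ln_dist ler_ln ?posrE ?lt_max ?ltr01 ?orbT// ge_max ler1n andbT.
  apply: le_trans (abvB normcP _ _) _.
  by rewrite (abv1 normcP) normc_monomial.
have /andP[_] := tau_ln_dist_double (h01 n.+1).
by rewrite exprS mulrA divff// mul1r => /le_trans/(_ IH); lra.
Qed.

End TauLogDistance.

(** * Comparison of f with the logarithm of one character *)

Section LogSup.
Variable R : realType.
Local Notation C := R[i].
Local Notation normc := (@Normc.normc R).
Let normcP : absolute_value normc := normc_absolute_value R.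

Definition ln_sup (d : R) (z : C * C) : R := ln (Num.max (torus_sup z) d).

Lemma torus_lipschitz_ln_sup d : 0 < d -> torus_lipschitz (ln_sup d).
Proof. exact/torus_lipschitz_ln_max/torus_lipschitz_sup. Qed.

Lemma torus_sup_le2 (z : C * C) : on_torus z -> torus_sup z <= 2.
Proof.
move=> [z1 z2]; rewrite !ge_max; apply/and3P; split; apply: le_trans (abvB normcP _ _) _;
  by rewrite ?(abv1 normcP) ?z1 ?z2.
Qed.

Lemma torus_sup_monomial b (z : C * C) : on_torus z ->
  normc (1 - monomial b z) <= (`|b.1|%N + `|b.2|%N)%:R * torus_sup z.
Proof.
move=> zt; have o1 : on_torus ((1, 1) : C * C) by split; exact: (abv1 normcP).
have m1 : monomial b ((1, 1) : C * C) = 1 by rewrite /monomial !exp1rz mulr1.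
rewrite (abv_distC normcP) -m1; apply: le_trans (normc_monomial_sub_le b zt o1) _.
by rewrite natrD mulrDl lerD// ler_wpM2l// /torus_sup !le_max lexx ?orbT.
Qed.

Variables (b : int * int) (A : R).
Hypothesis bA : (`|b.1|%N + `|b.2|%N)%:R <= A.

(** If exp f >= d, then f_d = f and the other two terms have difference at most 0. If exp f < d,
    then |1 - y| <= A d, and the lower bound reduces to |1 - y| <= A exp f. For y = 1 the logarithm
    would take its default value 0. *)
Lemma ln_sup_bounds d (z : C * C) : on_torus z -> 0 < d -> 0 < A ->
  ln_dist (A * d) (monomial b z) - ln A <= ln_sup d z /\
  (monomial b z != 1 -> ln_sup d z + ln (normc (1 - monomial b z)) -
     ln_dist (A * d) (monomial b z) <= ln (torus_sup z) <= ln_sup d z).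
Proof.
move=> zt d0 A0.
have zA : normc (1 - monomial b z) <= A * torus_sup z.
  apply: le_trans (torus_sup_monomial b zt) _; rewrite ler_wpM2r//.
  by rewrite le_max (abv_ge0 normcP).
have m0 : 0 < Num.max (torus_sup z) d by rewrite lt_max d0 orbT.
split.
  rewrite lerBlDl /ln_sup -lnM ?posrE// /ln_dist ler_ln ?posrE ?mulr_gt0// ?lt_max ?mulr_gt0 ?orbT//.
  rewrite ge_max; apply/andP; split; last by rewrite ler_pM2l// le_max lexx orbT.
  by apply: le_trans zA _; rewrite ler_pM2l// le_max lexx.
rewrite eq_sym -subr_eq0 -(abv_gt0 normcP) => y0.
have s0 : 0 < torus_sup z by rewrite -(pmulr_rgt0 _ A0) (lt_le_trans y0).
rewrite /ln_sup /ln_dist [X in _ && X]ler_ln ?posrE// le_max lexx andbT.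
rewrite lerBlDr; case: (leP d (torus_sup z)) => sd.
  by rewrite lerD2l ler_ln ?posrE ?lt_max ?y0// le_max lexx.
have -> : Num.max (normc (1 - monomial b z)) (A * d) = A * d.
  by apply: max_r; apply: le_trans zA _; rewrite ler_pM2l// ltW.
rewrite -!lnM ?posrE ?mulr_gt0// ler_ln ?posrE ?mulr_gt0//.
by rewrite [leLHS]mulrC [leRHS]mulrCA [leRHS]mulrA ler_pM2r.
Qed.

End LogSup.

(** * The integral [eta] as a limit of truncations *)

Section EtaLimit.
Variable R : realType.
Local Notation C := R[i].
Variables (a : int * int) (e : nat).
Hypotheses (a_prim : primitive_vec a) (e_gt0 : (0 < e)%N).

Lemma lneE (x : R) : lne x%:E = if x <= 0 then -oo%E else (ln x)%:E.
Proof. by []. Qed.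

Lemma ln_max_cvg (x : R) (d : nat -> R) : 0 <= x -> (forall n, 0 < d n) ->
  d n @[n --> \oo] --> 0 ->
  (ln 2 - ln (Num.max x (d n)))%:E @[n --> \oo] --> ((ln 2)%:E - lne x%:E)%E.
Proof.
move=> x0 d0 dc; rewrite lneE; case: leP => x0'.
  have -> : x = 0 by apply/eqP; rewrite eq_le x0'.
  rewrite /=; apply/cvgeyPge => A; have e0 : 0 < expR (ln 2 - A) :> R by exact: expR_gt0.
  move/cvgr0Pnorm_lt : dc => /(_ _ e0); apply: filterS => n.
  rewrite gtr0_norm// lee_fin max_r ?(ltW (d0 n))// => dn.
  by rewrite lerBrDr addrC -lerBrDr -[leRHS]expRK ler_ln ?posrE ?expR_gt0// ltW.
apply: cvg_near_cst; move/cvgr0Pnorm_lt : dc => /(_ _ x0'); apply: filterS => n.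
by rewrite gtr0_norm// => /ltW dn; rewrite max_l.
Qed.

(** Monotone convergence applies to ln 2 - f_d, which is nonnegative since exp f and d are at most
    2, and which increases to ln 2 - f. The limit is finite, so f is integrable and ln 2 can be
    subtracted again. *)
Lemma eta_limit (d : nat -> R) L : (forall n, 0 < d n <= 2) ->
  {homo d : m n / (m <= n)%N >-> n <= m} -> d n @[n --> \oo] --> 0 ->
  @tau_mean R a e (ln_sup (d n)) @[n --> \oo] --> L -> eta R a e = L%:E.
Proof.
move=> d02 dm dc dL; have d0 n : 0 < d n by have /andP[] := d02 n.
have d2 n : d n <= 2 by have /andP[] := d02 n.
pose g n u := (ln 2 - ln_sup (d n) (@torus_point R u))%:E.
have mD := @measurable_Dtor R a e.
have sl n := torus_lipschitz_ln_sup (d0 n).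
have Im := tau_meanP R a_prim e_gt0.
have gl n : torus_lipschitz (fun z : C * C => ln 2 - ln_sup (d n) z : R).
  apply: torus_lipschitzD; first exact: torus_lipschitz_cst.
  by have := torus_lipschitzZ (-1) (sl n); under eq_fun do rewrite mulN1r.
have mg n : measurable_fun (Dtor a e) (g n).
  apply/measurable_EFinP/measurable_funTS; exact: measurable_torus_lipschitz (gl n).
have m0 n u : 0 < Num.max (torus_sup (@torus_point R u)) (d n).
  by rewrite lt_max d0 orbT.
have g0 n u : Dtor a e u -> (0 <= g n u)%E.
  move=> _; rewrite lee_fin subr_ge0 ler_ln ?posrE// ge_max d2 andbT.
  exact/torus_sup_le2/on_torus_point.
have gm u : Dtor a e u -> {homo g^~ u : n m / (n <= m)%N >-> (n <= m)%E}.
  move=> _ m n mn; rewrite lee_fin lerD2l lerN2 ler_ln ?posrE//.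
  by rewrite ge_max; move: (torus_sup _) => x; rewrite !le_max lexx (dm _ _ mn) orbT.
have logmaxE u : logmax u = lne (torus_sup (@torus_point R u))%:E by [].
have glim u : limn (g^~ u) = ((ln 2)%:E - logmax u)%E.
  apply/cvg_lim => //; rewrite logmaxE; apply: ln_max_cvg => //.
  by rewrite le_max (abv_ge0 (normc_absolute_value R)).
have := cvg_monotone_convergence mD mg g0 gm (mu := tau R a e).
under eq_integral do rewrite glim.
have gE n : (\int[tau R a e]_(u in Dtor a e) g n u = (ln 2 - @tau_mean R a e (ln_sup (d n)))%:E)%E.
  have [ID IZ _ _] := Im.
  have -> : ln 2 - @tau_mean R a e (ln_sup (d n)) =
      @tau_mean R a e (fun z => ln 2 + (-1) * ln_sup (d n) z).
    rewrite ID; [|exact: torus_lipschitz_cst|exact: torus_lipschitzZ].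
    by rewrite IZ// mean_cst// mulN1r.
  rewrite /tau_mean /Rintegral fineK.
    by apply: eq_integral => u _; rewrite /g mulN1r.
  apply: integrable_fin_num => //.
  have := tau_integrable a_prim e_gt0 (gl n).
  by apply: eq_integrable => // u _; rewrite /= mulN1r.
under eq_fun do rewrite gE.
move=> H; have {}H : (\int[tau R a e]_(u in Dtor a e) ((ln 2)%:E - logmax u) = (ln 2 - L)%:E)%E.
  apply: (cvg_unique _ H) => //; apply: cvg_EFin; first by near=> n.
  apply: cvgB => //; exact: cvg_cst.
have ml : measurable_fun (Dtor a e) (fun u : R * R => ((ln 2)%:E - logmax u)%E).
  apply: (emeasurable_fun_cvg g) => // u _; rewrite logmaxE; apply: ln_max_cvg => //.
  by rewrite le_max (abv_ge0 (normc_absolute_value R)).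
have pos (u : R * R) : Dtor a e u -> (0 <= (ln 2)%:E - logmax u)%E.
  move=> Du; rewrite -glim; apply: lime_ge; first exact: ereal_nondecreasing_is_cvgn (gm u Du).
  by near=> n; exact: g0.
have il : (tau R a e).-integrable (Dtor a e) (fun u => ((ln 2)%:E - logmax u)%E).
  apply/integrableP; split => //.
  under eq_integral => u /set_mem Du do rewrite gee0_abs ?pos//.
  by rewrite H ltry.
have ic : (tau R a e).-integrable (Dtor a e) (cst (ln 2)%:E).
  exact: (tau_integrable a_prim e_gt0 (torus_lipschitz_cst (ln 2))).
have -> : eta R a e = (\int[tau R a e]_(u in Dtor a e)
    (cst (ln 2)%:E u - ((ln 2)%:E - logmax u)))%E.
  apply: eq_integral => u _ /=.
  rewrite oppeB ?addeA ?subee ?add0e//.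
have Hc : (\int[tau R a e]_(u in Dtor a e) cst (ln 2)%:E u = (ln 2)%:E)%E.
  rewrite integral_cst// -[RHS]mule1 -(tau_Dtor R a_prim e_gt0); reflexivity.
rewrite integralB// H Hc -EFinB; congr EFin; ring.
Unshelve. all: by end_near.
Qed.

End EtaLimit.

(** * Passage to the limit along a strict sequence *)

Section TorsionOrders.
Implicit Types (a b : int * int) (g : algC * algC).

Lemma torsion_chi_order b g : torsion_point g -> exists N, N.-primitive_root (chi b g).
Proof.
move=> [[m1 m10 g1] [m2 m20 g2]].
have m0 : (0 < m1 * m2)%N by rewrite muln_gt0 m10.
have E : chi b g ^+ (m1 * m2) = 1.
  rewrite /chi exprMn !exprnP !exprz_exp ![_ * (m1 * m2)%N%:Z]mulrC.
  rewrite PoszM -!mulrA -exprz_exp -exprnP g1 exp1rz mul1r.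
  by rewrite mulrCA -exprz_exp -exprnP g2 exp1rz.
by have [N NP _] := prim_order_exists m0 E; exists N.
Qed.

Lemma Vtor_order a e g : (0 < e)%N -> Vtor a e g -> e.-primitive_root (chi a g).
Proof.
move=> e0 [_ /=]; have [eps epsP] := C_prim_root_exists e0.
by rewrite (Cintr_Cyclotomic epsP) root_cyclotomic.
Qed.

End TorsionOrders.

Section Equidistribution.
Variable R : realType.
Local Notation C := R[i].
Local Notation normc := (@Normc.normc R).
Let normcP : absolute_value normc := normc_absolute_value R.
Variables (a : int * int) (e : nat) (omega : nat -> algC * algC).
Hypotheses (a_prim : primitive_vec a) (e_gt0 : (0 < e)%N).
Hypotheses (omega_strict : strict_in (Vtor a e) omega)
  (omega_torsion : forall l, nontrivial_torsion_point (omega l)).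

Lemma Re_sum (I : Type) (s : seq I) (c : C) (F : I -> C) :
  \sum_(i <- s) complex.Re (c * F i) = complex.Re (c * \sum_(i <- s) F i).
Proof.
elim: s => [|i s IH]; first by rewrite !big_nil mulr0.
by rewrite !big_cons IH mulrDr; case: (c * F i) => ? ?; case: (c * _).
Qed.

(** On the j-th component chi^a is constantly exp(2 pi i j / e), so the components correspond to the
    primitive e-th roots of unity. *)
Lemma tau_mean_monomial_parallel c r :
  @tau_mean R a e (fun z => complex.Re (c * monomial (a.1 * r, a.2 * r) z)) =
  (totient e)%:R^-1 *
    \sum_(y <- primitive_powers (expi (2 * pi / e%:R)) e) complex.Re (c * y ^ r).
Proof.
rewrite tau_mean_monomial//= [X in X == 0](_ : _ = 0) ?eqxx; last by ring.
rewrite big_primitive_powers big_mkord; congr (_ * _).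
apply: eq_bigr => j _; congr (complex.Re (_ * _)).
rewrite component_monomial mulr0 addr0 -expiXn -expiXz; congr expi.
have v2 : vnorm R a ^+ 2 = a.1%:~R ^+ 2 + a.2%:~R ^+ 2.
  by rewrite sqr_sqrtr// addr_ge0 ?sqr_ge0.
have v0 : vnorm R a ^+ 2 != 0 by rewrite expf_neq0// gt_eqF// vnorm_gt0.
have e0 : e%:R != 0 :> R by rewrite pnatr_eq0 -lt0n.
have -> : (a.1 * r * a.1 + a.2 * r * a.2)%:~R = r%:~R * vnorm R a ^+ 2 :> R.
  by rewrite v2 intrD !intrM; ring.
move: (vnorm R a ^+ 2) v0 (e%:R : R) e0 (pi : R) => v v0 q q0 p.
by field; rewrite v0 q0.
Qed.

Lemma parallel_multiple b : a.1 * b.2 - a.2 * b.1 = 0 ->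
  exists r, b = (a.1 * r, a.2 * r).
Proof.
move=> D0; have [u [v uv]] := Bezoutz a.1 a.2; rewrite [gcdz _ _]a_prim in uv.
have E : a.1 * b.2 = a.2 * b.1 by apply/eqP; rewrite -subr_eq0 D0.
exists (u * b.1 + v * b.2); case: b E {D0} => b1 b2 /= E; congr (_, _).
  transitivity ((u * a.1 + v * a.2) * b1); first by rewrite uv mul1r.
  by rewrite mulrDl -[v * _ * _]mulrA -E; ring.
transitivity ((u * a.1 + v * a.2) * b2); first by rewrite uv mul1r.
by rewrite mulrDl -[u * _ * _]mulrA E; ring.
Qed.

Lemma transversal_exists : exists b, a.1 * b.2 - a.2 * b.1 != 0.
Proof.
have [u [v uv]] := Bezoutz a.1 a.2; rewrite [gcdz _ _]a_prim in uv.
by exists (- v, u); rewrite /= mulrN opprK [a.1 * _]mulrC [a.2 * _]mulrC uv.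
Qed.

Lemma average_orders b : a.1 * b.2 - a.2 * b.1 != 0 -> forall eps : R, 0 < eps ->
  \forall l \near \oo, exists N, [/\ (1 < N)%N, N.-primitive_root (chi b (omega l)),
     ln N%:R / (totient N)%:R < eps & (totient N)%:R^-1 < eps].
Proof.
move=> Db eps eps0; have [M HM] := ln_totient_small eps0.
have [l0 Hl0] := strict_order a_prim e_gt0 omega_strict Db (maxn M 1).
exists l0 => // l /= l0l; have [t _] := omega_torsion l.
have [N NP] := torsion_chi_order b t; exists N.
have := Hl0 _ l0l _ NP; rewrite gtn_max => /andP[MN N1].
by have [? ?] := HM _ MN.
Qed.

(** For b parallel to a the averages do not depend on l, since chi^a takes values of exact order e.
    Otherwise they are c times a Moebius value over phi(N), up to taking real parts, and phi(N)
    tends to infinity. *)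
Lemma average_monomial_cvg (A : nat -> (C * C -> R) -> R) c b :
  (forall l b N zeta G, N.-primitive_root (chi b (omega l)) ->
     N.-primitive_root zeta -> A l (fun x => G (monomial b x)) =
     (totient N)%:R^-1 * \sum_(y <- primitive_powers zeta N) G y) ->
  A l (fun z => complex.Re (c * monomial b z)) @[l --> \oo] -->
  @tau_mean R a e (fun z => complex.Re (c * monomial b z)).
Proof.
move=> HA; have [D0|D0] := eqVneq (a.1 * b.2 - a.2 * b.1) 0.
  have [r ->] := parallel_multiple D0.
  rewrite tau_mean_monomial_parallel; apply: cvg_near_cst; near=> l.
  have aP : e.-primitive_root (chi a (omega l)) by apply: Vtor_order => //; case: omega_strict.
  rewrite -(HA l a e _ (fun y => complex.Re (c * y ^ r)) aP (expi_primitive R e_gt0)).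
  congr (A l _); apply/funext => z.
  by rewrite /monomial /= expfzMl !exprz_exp.
rewrite tau_mean_monomial// ifN//; apply/cvgr0Pnorm_le => eps eps0.
have c1 : 0 < normc c + 1 by rewrite ltr_wpDl// (abv_ge0 normcP).
have [l0 _ Hl0] := average_orders D0 (divr_gt0 eps0 c1).
exists l0 => // l /Hl0 [N [N1 NP _ HN]] /=.
have [zeta zP] := @primitive_root_exists C N (ltnW N1).
rewrite (HA l b N zeta (fun y => complex.Re (c * y)) NP zP) Re_sum.
rewrite normrM ger0_norm ?invr_ge0//.
apply: (@le_trans _ _ (eps / (normc c + 1) * (normc c + 1))); last by rewrite divfK// gt_eqF.
apply: ler_pM; [by rewrite invr_ge0|by []|exact: ltW|].
apply: le_trans (normc_ge_Re _) _; rewrite (abvM normcP).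
apply: (@le_trans _ _ (normc c)); last by rewrite lerDl ler01.
rewrite ler_piMr ?(abv_ge0 normcP)//.
by have [->|->|->] := sum_primitive_roots zP;
  rewrite ?(abvN normcP) ?(abv1 normcP) ?(abv0 normcP).
Unshelve. all: by end_near.
Qed.

Theorem inter_height_cvg :
  (inter_height R (omega l))%:E @[l --> \oo] --> eta R a e.
Proof.
pose T := @tau_mean R a e; have Tm : mean T := tau_meanP R a_prim e_gt0.
have [_ _ TM _] := Tm.
have [b Db] := transversal_exists.
have /choice[Z HZ] : forall l, exists Z : {n : nat & 'I_n -> C * C},
  [/\ (0 < projT1 Z)%N, forall i, on_torus (projT2 Z i),
    forall b N, N.-primitive_root (chi b (omega l)) ->
      (forall i, N.-primitive_root (monomial b (projT2 Z i))) /\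
      forall zeta (G : C -> R), N.-primitive_root zeta ->
        average (projT2 Z) (fun x => G (monomial b x)) =
        (totient N)%:R^-1 * \sum_(y <- primitive_powers zeta N) G y
  & forall N, (1 < N)%N -> N.-primitive_root (omega l).1 \/ N.-primitive_root (omega l).2 ->
      `|inter_height R (omega l) - average (projT2 Z) (@ln R \o @torus_sup R)|
         <= ln N%:R / (totient N)%:R].
  move=> l; have [n [z H]] := inter_height_average R (omega_torsion l).
  by exists (existT _ n z).
pose A l := average (projT2 (Z l)).
have Am l : mean (A l) by have [n0 zt _ _] := HZ l; exact: averageP.
have Acvg h : torus_lipschitz h -> A l h @[l --> \oo] --> T h.
  apply: weyl_criterion => // c k; apply: average_monomial_cvg => l k' N zeta G kN zN.
  by have [_ _ /(_ _ _ kN)[_ H] _] := HZ l; exact: H.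
pose m := (`|b.1| + `|b.2|)%N.
pose q n : R := 2^-1 ^+ n.
have q0 n : 0 < q n by rewrite exprn_gt0// invr_gt0.
have q1 n : q n <= 1 by rewrite exprn_ile1 ?invr_ge0// invf_le1// ler1n.
have qm : {homo q : i j / (i <= j)%N >-> j <= i}.
  by move=> i j ij; rewrite /q ler_wiXn2l// ?invr_ge0// invf_le1// ler1n.
have qc : q n @[n --> \oo] --> 0.
  by apply: cvg_expr; rewrite gtr0_norm ?invr_gt0// invf_lt1// ltr1n.
(* With |b_1| + |b_2| rounded up to a power of 2, B times the level [q (n + m)] is again a power of
   1/2, the form in which [tau_ln_dist_small] is available. *)
pose B : R := 2 ^+ m; have B0 : 0 < B by rewrite exprn_gt0.
have bB : (`|b.1|%N + `|b.2|%N)%:R <= B.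
  by rewrite /B -natrX ler_nat ltnW// ltn_expl.
have Bq n : B * q (n + m)%N = q n.
  by rewrite /B /q exprD mulrCA -exprMn divff ?pnatr_eq0// expr1n mulr1.
have sl n := torus_lipschitz_ln_sup (q0 (n + m)%N).
have dl n := torus_lipschitz_ln_dist_monomial b (q0 n).
pose f n := T (ln_sup (q (n + m)%N)).
have bounds n (z : C * C) : on_torus z ->
  ln_dist (q n) (monomial b z) - ln B <= ln_sup (q (n + m)%N) z /\
  (monomial b z != 1 -> ln_sup (q (n + m)%N) z + ln (normc (1 - monomial b z)) -
     ln_dist (q n) (monomial b z) <= ln (torus_sup z) <= ln_sup (q (n + m)%N) z).
  by move=> zt; rewrite -Bq; exact: ln_sup_bounds.
have fm : {homo f : i j / (i <= j)%N >-> j <= i}.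
  move=> i j ij; apply: TM => // z _; rewrite /ln_sup.
  have mq k : 0 < Num.max (torus_sup z) (q k) by rewrite lt_max q0 orbT.
  rewrite ler_ln ?posrE// ge_max; move: (torus_sup z) => x.
  by rewrite !le_max lexx qm ?orbT// leq_add2r.
pose J n := tau_ln_dist a e b (q n).
have Jb n : 0 <= J n <= q n * ln 2 by exact: tau_ln_dist_small.
(* This bound makes the decreasing sequence of truncated integrals converge to a finite limit. *)
have fb n : - ln B <= f n.
  have /andP[J0 _] := Jb n; apply: (@le_trans _ _ (J n - ln B)); first by lra.
  have [TD _ _ _] := Tm.
  have cl := torus_lipschitz_cst (- ln B).
  have <- : T (fun z => ln_dist (q n) (monomial b z) - ln B) = J n - ln B.
    by rewrite (TD _ _ (dl n) cl) (mean_cst _ Tm).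
  apply: TM => //; first exact: torus_lipschitzD.
  by move=> z /(bounds n)[].
have [L fL] : exists L : R, f n @[n --> \oo] --> L.
  exists (limn f); apply: nonincreasing_is_cvgn => //.
  by exists (- ln B) => _ [n _ <-].
have -> : eta R a e = L%:E.
  apply: (@eta_limit _ _ _ a_prim e_gt0 (fun n => q (n + m)%N)) => //.
  - by move=> n; rewrite q0 (le_trans (q1 _))// ler1n.
  - by move=> i j ij; rewrite qm// leq_add2r.
  - by rewrite (cvg_shiftn m q).
apply: cvg_EFin; first by near=> l.
(* Five errors occur: f n against L, J n against 0, the two averages against f n and J n, and the
   non-Archimedean part of the height. *)
apply/cvgrPdist_le => eps eps0; have [d [d0 dE]] : exists d, 0 < d /\ eps = 5 * d.
  by exists (eps / 5); split; [lra|field].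
have Jc : J n @[n --> \oo] --> 0.
  apply: (@squeeze_cvgr _ _ _ _ (cst 0) (fun n => q n * ln 2)).
  - by near=> n; exact: Jb.
  - exact: cvg_cst.
  - by rewrite -[X in _ --> X](mul0r (ln 2)); apply: cvgMr_tmp.
have [n [fn Jn]] : exists n, `|L - f n| <= d /\ `|0 - J n| <= d.
  move/cvgrPdist_le : fL => /(_ _ d0) fL; move/cvgrPdist_le : Jc => /(_ _ d0) Jc.
  by have [n _ H] := filterI fL Jc; exists n; exact: H (leqnn n).
(* One of the two coordinate characters is transversal to a; the order of that coordinate tends to
   infinity, which makes the non-Archimedean part vanish in the limit. *)
have [c [Dc cE]] : exists c : int * int, a.1 * c.2 - a.2 * c.1 != 0 /\
    forall g : algC * algC, chi c g = g.1 \/ chi c g = g.2.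
  have [a1|a1] := eqVneq a.1 0.
    exists (1, 0); rewrite /= mulr0 mulr1 sub0r oppr_eq0; split.
      by apply: contra_eq_neq a_prim => a2; rewrite a1 a2 gcd0z.
    by move=> g; left; rewrite /chi expr1z expr0z mulr1.
  exists (0, 1); rewrite /= mulr0 mulr1 subr0; split => // g.
  by right; rewrite /chi expr1z expr0z mul1r.
have /cvgrPdist_le /(_ _ d0) s_near := Acvg _ (sl n).
have /cvgrPdist_le /(_ _ d0) d_near := Acvg _ (dl n).
have c_near := average_orders Dc d0; have b_near := average_orders Db d0.
near=> l.
have sl_near : `|f n - A l (ln_sup (q (n + m)%N))| <= d by near: l.
have dl_near : `|J n - A l (fun z => ln_dist (q n) (monomial b z))| <= d by near: l.
have [N [N1 NP HN _]] : exists N, [/\ (1 < N)%N, N.-primitive_root (chi c (omega l)),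
     ln N%:R / (totient N)%:R < d & (totient N)%:R^-1 < d] by near: l.
have [N' [N'1 N'P HN' _]] : exists N, [/\ (1 < N)%N, N.-primitive_root (chi b (omega l)),
     ln N%:R / (totient N)%:R < d & (totient N)%:R^-1 < d] by near: l.
have [k0 zt /(_ _ _ N'P)[zb Hb] /(_ N N1)] := HZ l; rewrite -/(A l) => Hh.
have {Hh HN}hA : `|inter_height R (omega l) - A l (@ln R \o @torus_sup R)| <= d.
  apply: le_trans (ltW HN); apply: Hh.
  by case: (cE (omega l)) => <-; [left|right].
have [zeta zP] := @primitive_root_exists C N' (ltnW N'1).
have lnA : 0 <= A l (fun z => ln (normc (1 - monomial b z))).
  rewrite [leRHS](Hb zeta (fun y => ln (normc (1 - y))) zP) mulr_ge0 ?invr_ge0//.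
  by have /andP[] := sum_ln_primitive_roots N'1 zP.
have zb1 i : monomial b (projT2 (Z l) i) != 1.
  apply: contraTneq N'1 => E; have := prim_order_dvd (zb i) 1.
  by rewrite expr1 E eqxx dvdn1 => /eqP ->.
have up : A l (@ln R \o @torus_sup R) <= A l (ln_sup (q (n + m)%N)).
  rewrite ler_wpM2l ?invr_ge0//; apply: ler_sum => i _.
  by have [_ /(_ (zb1 i))/andP[]] := bounds n _ (zt i).
have low : A l (ln_sup (q (n + m)%N)) + A l (fun z => ln (normc (1 - monomial b z))) -
    A l (fun z => ln_dist (q n) (monomial b z)) <= A l (@ln R \o @torus_sup R).
  rewrite /A /average -mulrDr -mulrBr -big_split -sumrB ler_wpM2l ?invr_ge0//.
  apply: ler_sum => i _.
  by have [_ /(_ (zb1 i))/andP[]] := bounds n _ (zt i).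
rewrite -[(fine \o _) l]/(inter_height R (omega l)).
move: fn Jn sl_near dl_near hA lnA up low; rewrite dE sub0r normrN !ler_norml.
move: (A l _) (A l (fun=> ln_dist _ _)) (A l (ln_sup _)) (A l (@ln R \o _)) (f n) (J n) (inter_height _ _).
move=> ? ? ? ? ? ? ? /andP[? ?] /andP[? ?] /andP[? ?] /andP[? ?] /andP[? ?] ? ? ?.
by apply/andP; split; lra.
Unshelve. all: by end_near.
Qed.

End Equidistribution.

Theorem theorem7p3 (R : realType) (a : int * int) (e : nat)
    (omega : nat -> algC * algC) :
  primitive_vec a -> (0 < e)%N ->
  strict_in (Vtor a e) omega ->
  (forall l, nontrivial_torsion_point (omega l)) ->
  (inter_height R (omega l))%:E @[l --> \oo] --> eta R a e.
Proof. exact: inter_height_cvg. Qed.
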